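(* Let $\alpha_\infty\approx 3.14619$ be the unique root greater than $1$ of $a=e^{a-2}$. Applying the online rounding procedure $\mathrm{ROUND}$ to the continuous online algorithm $\mathrm{CONT}$ (both described in the context) produces a randomized online algorithm with free disposal, for maximizing a non-negative monotone submodular function under a partition matroid constraint, with competitive ratio $\frac1{\alpha_\infty}$. That is, for every partition matroid, every non-negative monotone submodular $f$, and every finite arrival sequence fixed before the algorithm's randomness is sampled, the set $\widetilde S$ held at the end satisfies $\mathbf{E}[f(\widetilde S)]\ge\frac1{\alpha_\infty}f(\mathsf{OPT})$.
   Context: Partition matroid: the finite ground set is a disjoint union $\Omega=\bigcup_{l\in[L]}\Omega_l$ with positive integer capacities $k_l$; $X\subseteq\Omega$ is independent iff $|X\cap\Omega_l|\le k_l$ for all $l$. Let $l(u)$ be the index with $u\in\Omega_{l(u)}$. Online problem with free disposal: distinct elements arrive one by one in a finite sequence of unknown length. The algorithm maintains an independent set, initially empty; when $u$ arrives it may remove elements and may include $u$, as long as independence is kept; rejected or removed elements cannot be retrieved. The algorithm knows $l(u)$ when $u$ arrives and knows the capacities. $\mathsf{OPT}$ is an independent set of elements of the sequence maximizing $f$. Continuous objects: $S\in\mathbb{R}_+^\Omega$ is identified with the set $\{(u,t):u\in\Omega,\,0<t\le S_u\}\subset\Omega\times\mathbb{R}_+$ (such sets are called valid), where $\Omega\times\mathbb{R}_+$ carries the product of counting and Lebesgue measure, denoted $\|\cdot\|$. $S|_{\Omega_l}:=\{(u,t)\in S:u\in\Omega_l\}$. $S$ is feasible if $\|S|_{\Omega_l}\|\le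 k_l$ for all $l$. Let $\mathsf{R}(S)\subseteq\Omega$ be the random set including each $u$ independently with probability $1-e^{-S_u}$, and $\widehat f(S):=\mathbf{E}[f(\mathsf{R}(S))]$. For a valid $B$, $\widehat f(u|B):=\lim_{t\to0^+}\frac{\widehat f(B\oplus(u,[t]))-\widehat f(B)}{t}$, where $B\oplus(u,[t])$ is $B$ with coordinate $u$ increased by $t$. The algorithm is assumed to have oracle access to $\widehat f$ and to $\widehat f(\cdot|\cdot)$ and can monitor and change variables continuously. Algorithm $\mathrm{CONT}$ (with $\alpha=\alpha_\infty$): maintains a feasible valid $S$ and the valid set $A$ of all pairs ever added to $S$, both initially empty. In the round of $u$, at the instant when $S_u$ has been increased to $t$, put $w(u,t):=\widehat f(u|A)$ with $A$ the set at that instant; this defines $w$ on $A$, and $w(B):=\int_B w(z)\,dz$ for $B\subseteq A$. When $u\in\Omega_l$ arrives (with $S_u=0$): while $w(u,S_u)>\frac1{k_l}\left(\alpha\, w(S|_{\Omega_l})-w(A|_{\Omega_l})\right)$, increase $S_u=t$ and $A_u=t$ continuously (adding the pairs $(u,t)$ to $S$ and $A$); whenever $\|S|_{\Omega_l}\|=k_l$, simultaneously remove pairs of minimum $w$-value from $S|_{\Omega_l}$: letting $T:=\{v\in\Omega_l:(v,S_v)\in\arg\min_{z\in S|_{\Omega_l}}w(z)\}$, $w_v(\tau):=w(v,\tau)$ (a decreasing function of $\tau$) and $\eta_v:=|w_v'(S_v)|$, for each $v\in T$ decrease $S_v$ at rate $\frac{dS_v}{dt}=-\frac{\eta_v^{-1}}{\sum_{s\in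 T}\eta_s^{-1}}$. Thus an element leaves $T$ only when its coordinate drops to $0$, and new elements may join $T$. Procedure $\mathrm{ROUND}$: let $\mathbf{B}:=\bigcup_{l\in[L]}\{l\}\times(0,k_l]$ with Lebesgue measure on each interval. When a pair $(u,t)$ is added to $S$ it is assigned a point $\varphi(u,t)\in\mathbf{B}$ such that: (1) $\varphi(u,t)\in\{l(u)\}\times(0,k_{l(u)}]$; (2) at any moment $\varphi|_S:S\to\mathbf{B}$ is injective; (3) $\|\varphi(B)\|=\|B\|$ for every measurable $B\subseteq S$. Before any element arrives, a random set $\mathcal{Z}\subset\mathbf{B}$ is formed by sampling, for each $l$, $k_l$ points uniformly and independently from $\{l\}\times(0,k_l]$. At any moment, when $\mathrm{CONT}$ holds $S$, the randomized algorithm holds $\widetilde S:=\{u\in\Omega:\exists t,\ (u,t)\in S\text{ and }\varphi(u,t)\in\mathcal{Z}\}$.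
   Formalization: In ROUND, conditions (2) and (3) are required at the end of each round rather than at any moment: at instants within a round they cannot hold when two or more elements of T shrink simultaneously. Every assignment meeting the literal conditions is still covered. *)

(* Defs.v *)
From mathcomp Require Import all_boot all_order all_algebra.
From mathcomp Require Import all_classical all_reals all_analysis.

Set Implicit Arguments.
Unset Strict Implicit.
Unset Printing Implicit Defensive.

Import Order.TTheory GRing.Theory Num.Theory.
Import numFieldTopology.Exports numFieldNormedType.Exports.

Local Open Scope classical_set_scope.
Local Open Scope ring_scope.

Section SetFunctions.
Context {R : realType} {E : finType}.
Implicit Type f : {set E} -> R.

Definition nonneg_setfun f := forall X : {set E}, 0 <= f X.

Definition monotone_setfun f :=
  forall X Y : {set E}, X \subset Y -> f X <= f Y.

Definition submodular_setfun f :=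
  forall X Y : {set E}, f (X :|: Y)%SET + f (X :&: Y)%SET <= f X + f Y.

(* The expectation of [f] on the random set that contains each [u]
   independently with probability [1 - expR (- S u)]. *)
Definition fhat f (S : E -> R) : R :=
  \sum_(X : {set E})
    (\prod_(u in X) (1 - expR (- S u))) *
    (\prod_(u in (~: X)%SET) expR (- S u)) * f X.

(* [B] with coordinate [u] increased by [t]. *)
Definition incr (B : E -> R) (u : E) (t : R) : E -> R :=
  fun v => if v == u then B v + t else B v.

Definition fhat_at f (u : E) (B : E -> R) : R :=
  lim ((fhat f (incr B u t) - fhat f B) / t @[t --> 0^'+]).

End SetFunctions.

Section Matroid.
Context {R : realType} {E : finType} {L : nat}.
Variables (part : E -> 'I_L) (k : 'I_L -> nat).

Definition indep (X : {set E}) : bool :=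
  [forall l, #|[set u in X | part u == l]%SET| <= k l]%N.

Definition is_opt (f : {set E} -> R) (s : seq E) (O : {set E}) : Prop :=
  [/\ indep O, {subset O <= s} &
      forall X : {set E}, indep X -> {subset X <= s} -> f X <= f O].

End Matroid.

(* Subsets of [I * R] with the product of the counting and the Lebesgue
   measure: sections are Borel sets, and the measure of a set is the sum of the
   measures of its sections.  It is used with [I] the ground set (where the
   valid sets live) and with [I] the set of classes (for the target of the
   rounding assignment). *)
Section CountingTimesLebesgue.
Context {R : realType} {I : finType}.
Implicit Type B : set (I * R).

Definition smeasurable B : Prop :=
  forall i, measurable (xsection B i : set (measurableTypeR R)).

Definition mass B : \bar R :=
  (\sum_(i : I) lebesgue_measure (xsection B i))%E.

Definition integ (w : I -> R -> R) B : R :=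
  \sum_(i : I) \int[lebesgue_measure]_(t in xsection B i) w i t.

Definition argmin_on (w : I -> R -> R) B : set (I * R) :=
  [set z | B z /\ forall y, B y -> w z.1 z.2 <= w y.1 y.2].

End CountingTimesLebesgue.

Section Algorithm.
Context {R : realType} {E : finType} {L : nat}.

(* The valid set with coordinates [S]. *)
Definition region (S : E -> R) : set (E * R) := [set z | 0 < z.2 <= S z.1].

(* What the algorithm has in memory between two arrivals: the coordinates of
   [S] and [A], the weights and the rounding assignment.  The last two are
   meaningful on the region of [A] only; [weight v] is kept as a function on
   the whole of [R] so that it can be differentiated at its end point. *)
Record state := State {
  cur : E -> R;
  ever : E -> R;
  weight : E -> R -> R;
  assign : E -> R -> 'I_L * R }.

Definition initial (st : state) : Prop :=
  (forall v, cur st v = 0) /\ (forall v, ever st v = 0).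

Variables (alpha : R) (k : 'I_L -> nat).
Variables (part : E -> 'I_L) (f : {set E} -> R).

Definition restr (l : 'I_L) (B : set (E * R)) : set (E * R) :=
  [set z | B z /\ part z.1 = l].

Definition feasible (S : E -> R) : Prop :=
  forall l, (mass (restr l (region S)) <= (k l)%:R%:E)%E.

Definition threshold (w : E -> R -> R) (S A : E -> R) (l : 'I_L) : R :=
  (k l)%:R^-1 *
  (alpha * integ w (restr l (region S)) - integ w (restr l (region A))).

(* The set T of the elements whose topmost pair has minimum weight in class
   [l]; they all have [0 < S v]. *)
Definition tops (w : E -> R -> R) (S : E -> R) (l : 'I_L) : {set E} :=
  [set v | (part v == l) &&
           `[< argmin_on w (restr l (region S)) (v, S v) >]]%SET.

Definition eta (w : E -> R -> R) (S : E -> R) (v : E) : R :=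
  `| derive1 (w v) (S v) |.

Definition removal_rate (w : E -> R -> R) (S : E -> R) (l : 'I_L) (v : E) : R :=
  if (mass (restr l (region S)) == (k l)%:R%:E) && (v \in tops w S l) then
    (eta w S v)^-1 / \sum_(x in tops w S l) (eta w S x)^-1
  else 0.

Definition right_derivative (g : R -> R) (t a : R) : Prop :=
  (g (t + h) - g t) / h @[h --> 0^'+] --> a.

(* The round of [u].  The clock [t] is the amount added so far to coordinate
   [u], the round lasts [d], and [S t] are the coordinates of the current set
   at the instant [t].  The velocity of [S] jumps when its class becomes full
   and when the set T changes, so the flow is stated with right derivatives,
   which exist at every instant of [0, d[. *)
Definition cont_round (u : E) (st st' : state) : Prop :=
  let l := part u in
  let w := weight st' in
  let A t := incr (ever st) u t in
  cur st u = 0 /\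
  (forall v, weight st' v =
     if v == u then fun t => fhat_at f u (A t) else weight st v) /\
  exists (d : R) (S : R -> E -> R),
    0 <= d /\
    S 0 = cur st /\ S d = cur st' /\ A d = ever st' /\
    (forall v, {within `[0, d], continuous (fun t => S t v)}) /\
    (forall t, 0 <= t <= d -> (forall v, 0 <= S t v) /\ feasible (S t)) /\
    (forall t, 0 <= t < d ->
       w u (S t u) > threshold w (S t) (A t) l /\
       forall v, right_derivative (fun r => S r v) t
                   ((v == u)%:R - removal_rate w (S t) l v)) /\
    ~~ (w u (S d u) > threshold w (S d) (A d) l).

Definition phi (st : state) (z : E * R) : 'I_L * R := assign st z.1 z.2.

(* Pairs keep their point for ever.  Injectivity and preservation of measure
   are required whenever a round is over, not at the instants inside a round:
   the latter is contradictory as soon as two elements are in T, since then,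
   for injectivity, a.e. pair [(u, t)] would have to reuse a point freed at the
   very instant [t], although each element of T frees points at a rate smaller
   than 1, so that lengths would not be preserved. *)
Definition round_ok (st st' : state) : Prop :=
  [/\ forall z, region (ever st) z -> phi st' z = phi st z,
      forall z, region (ever st') z ->
        (phi st' z).1 = part z.1 /\ 0 < (phi st' z).2 <= (k (part z.1))%:R,
      {in region (cur st') &, injective (phi st')} &
      forall B : set (E * R), B `<=` region (cur st') -> smeasurable B ->
        smeasurable (phi st' @` B) /\ mass (phi st' @` B) = mass B].

Definition step (st : state) (u : E) (st' : state) : Prop :=
  cont_round u st st' /\ round_ok st st'.

Inductive execution : seq E -> state -> Prop :=
| execution_nil st : initial st -> execution [::] st
| execution_rcons s u st st' :
    execution s st -> step st u st' -> execution (rcons s u) st'.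

(* [{l : 'I_L & 'I_(k l)}] indexes the sample points; [z i] is the position of
   the [i]-th one in the interval of the class [tag i]. *)
Definition held (st : state) (z : {l : 'I_L & 'I_(k l)} -> R) : {set E} :=
  [set u | `[< exists t, region (cur st) (u, t) /\
                         exists i, phi st (u, t) = (tag i, z i) >]]%SET.

End Algorithm.

Arguments state R E L : clear implicits.

(* A deterministic rule computing the state from what is known after the
   arrival of [s]: it uses neither the later arrivals, nor the classes of the
   elements that did not arrive, nor the values of [f] on sets that did not
   entirely arrive. *)
Definition online_rule (R : realType) (E : finType) (L : nat)
    (alg : (E -> 'I_L) -> ({set E} -> R) -> seq E -> state R E L) : Prop :=
  forall part part' f f' s,
    {in s, part =1 part'} ->
    (forall X : {set E}, {subset X <= s} -> f X = f' X) ->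
    alg part f s = alg part' f' s.

Section Sampling.
Context {R : realType} {L : nat} {d : measure_display} {T : measurableType d}.
Variables (P : probability T R) (k : 'I_L -> nat).

Definition mutually_independent (I : finType) (Z : I -> {RV P >-> R}) : Prop :=
  forall B : I -> set (measurableTypeR R), (forall i, measurable (B i)) ->
    P (\bigcap_i (Z i @^-1` B i)) = (\prod_(i : I) P (Z i @^-1` B i))%E.

Definition uniform_samples (Z : {l : 'I_L & 'I_(k l)} -> {RV P >-> R}) : Prop :=
  mutually_independent Z /\
  forall i (B : set (measurableTypeR R)), measurable B ->
    P (Z i @^-1` B) =
    (((k (tag i))%:R^-1)%:E *
     lebesgue_measure (B `&` [set x : R | 0 < x <= (k (tag i))%:R]%R))%E.

End Sampling.

(* Main.v *)
Require Import Defs.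
From mathcomp Require Import all_boot all_order all_algebra.
From mathcomp Require Import all_classical all_reals all_analysis.
From mathcomp Require Import measurable_realfun.
From mathcomp Require Import ring lra.

(** In the round of [u] the weights are [w(u, t) = e^(-t) c_u], where [c_u] is the
    gain of [u] over the set [A] held at its arrival.  Say that a class is
    admissible when, for every level [x], the set [A_x] of its pairs of weight at
    most [x] satisfies [(alpha - 1) w(A_x) - alpha w(A_x \ S_x) <= k x], where [S_x]
    consists of the [k] heaviest units of [A_x].  As a function of its mass [r], the
    weight [G] of [A_x] then satisfies [k G'(r) >= (alpha - 1) G(r) - alpha G(r - k)],
    and [alpha = e^(alpha - 2)] turns this into [G(r) >= alpha G(r - k)].  Hence the
    quantity [D = alpha w(S) - w(A)] is at least [3/2 k] times the least weight in
    [S].  While the loop runs, [k w(u, t) > D]: so [u] is not removed in its own round,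
    [D] does not decrease, and admissibility is preserved; real induction over time
    combines the three facts, both for an arbitrary solution of the flow and to
    build one.

    At the end of its round, an element [o] of OPT has [k w(o, A_o) <= D].  Summing over
    OPT gives [f(OPT) <= f(0) + w(A) + sum_l D_l = f(0) + alpha w(S)], which is at most
    [alpha fhat(S)]; replacing the sample points one by one by independent coins shows
    that [fhat(S) <= E f(held)].  For the rounding, the occupied part of each interval
    is kept a finite union of half-open intervals, so that new pairs can be sent
    increasingly and isometrically to the free part. *)

Set Implicit Arguments.
Unset Strict Implicit.
Unset Printing Implicit Defensive.

Import Order.TTheory GRing.Theory Num.Theory.
Import numFieldTopology.Exports numFieldNormedType.Exports.

Local Open Scope classical_set_scope.
Local Open Scope ring_scope.

(** * Real induction, differential inequalities, and the bound [alpha > 3] *)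

Section RealLine.
Context {R : realType}.
Implicit Types (a b x t : R) (g : R -> R).

(** The three facts about a round are circular: the bound on [D] presupposes admissibility and that
    [S] consists of the heaviest pairs of [A]; the latter presupposes that [u] has not been removed;
    and this is in turn read off the bound on [D]. So at each instant they are carried forward
    jointly.

    The root condition makes [lam = alpha - 2] a characteristic exponent of the delay equation
    [G' = (alpha - 1) G - alpha G(r - 1)]: substituting [expR (lam * r)] gives
    [lam = alpha - 1 - alpha * expR (- lam)], where [alpha * expR (- lam) = 1]. One delay then
    multiplies the solution by exactly [alpha].

    The factor [3/2] is chosen because it exceeds [alpha / (alpha - 1)], which amounts to
    [alpha > 3]: exchanging a pair of weight [x] for one of weight [w] changes [D] by
    [(alpha - 1) * w - alpha * x], which is nonnegative as soon as [w >= 3/2 * x].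

    The flow has a discontinuous right-hand side; its existence rests on an explicit formula, the
    truncation of [A] at the level that leaves the mass [min(total, k)]. *)

Lemma real_induction (P : R -> Prop) a b : a <= b -> P a ->
  (forall t, a <= t < b -> P t -> exists2 t', t < t' <= b & P t') ->
  (forall t, a < t <= b ->
     (forall s, a <= s < t -> exists2 s', s < s' < t & P s') -> P t) ->
  P b.
Proof.
move=> leab Pa Pext Plim.
pose S := [set t | a <= t <= b /\ P t].
have Sa : S a by split; rewrite ?lexx.
have hS : has_sup S.
  split; first by exists a.
  by exists b => t [/andP[_ ->]].
have aS : a <= sup S by apply: sup_upper_bound.
have Sb : sup S <= b by apply: ge_sup; [exists a | move=> t [/andP[_ ->]]].
have PS : P (sup S).
  have [eqa|nea] := eqVneq (sup S) a; first by rewrite eqa.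
  have lta : a < sup S by rewrite lt_neqAle eq_sym nea.
  have [PS|nPS] := pselect (P (sup S)); first by [].
  apply: Plim; first by rewrite lta.
  move=> s /andP[as_ sS].
  have e0 : 0 < sup S - s by rewrite subr_gt0.
  have [s' [/andP[as' s'b] Ps']] := sup_adherent e0 hS.
  rewrite opprB addrCA subrr addr0 => ss'.
  exists s' => //; rewrite ss' /= lt_neqAle; apply/andP; split.
    by apply/eqP => E; apply: nPS; rewrite -E.
  by apply: sup_upper_bound => //; split => //; rewrite as' s'b.
have [<-//|neb] := eqVneq (sup S) b.
have ltb : sup S < b by rewrite lt_neqAle neb.
have [|t' /andP[St' t'b] Pt'] := Pext (sup S) _ PS; first by rewrite aS.
have : t' <= sup S.
  by apply: sup_upper_bound => //; split=> //; rewrite t'b (le_trans aS (ltW St')).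
by rewrite leNgt St'.
Qed.

Lemma within_itvP a b g :
  {within `[a, b], continuous g} <->
  forall t, a <= t <= b -> forall e, 0 < e ->
  exists2 d, 0 < d & forall s, a <= s <= b -> `|s - t| < d -> `|g s - g t| < e.
Proof.
rewrite subspace_continuousP; split=> H t.
  move=> tab e e0.
  have /H /cvgrPdist_lt /(_ e e0) : (`[a, b]%classic : set R) t.
    by rewrite /= in_itv.
  rewrite near_withinE => /nbhs_ballP [d /= d0 Hd].
  exists d => // s sab sd; rewrite distrC; apply: Hd.
    by rewrite /ball /= distrC.
  by rewrite /= in_itv.
rewrite /= in_itv /= => tab; apply/cvgrPdist_lt => e e0.
have [d d0 Hd] := H t tab e e0.
rewrite near_withinE; apply/nbhs_ballP; exists d => //= s.
rewrite /ball /= in_itv /= => sd sab; rewrite distrC; apply: Hd => //.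
by rewrite distrC.
Qed.

(** One good point to the right of each [t], with an arbitrarily small loss of slope [e], is enough:
    real induction stays above the line of slope [- e], and continuity handles the limits. *)
Lemma dini_ge a b g : a <= b -> {within `[a, b], continuous g} ->
  (forall t e, a <= t < b -> 0 < e ->
     exists2 t', t < t' <= b & g t - e * (t' - t) <= g t') ->
  g a <= g b.
Proof.
move=> ab /within_itvP gc H; apply/ler_addgt0Pr => e0 e0_gt0.
(* The total loss [e * (b - a)] is at most [e0]; the [+ 1] keeps the denominator positive when
   [a = b]. *)
pose e := e0 / (b - a + 1).
have ba1 : 0 < b - a + 1 by lra.
have e_gt0 : 0 < e by apply: divr_gt0.
suff : g a - e * (b - a) <= g b.
  have : e * (b - a) <= e0.
    rewrite /e mulrAC ler_pdivrMr //; nra.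
  lra.
apply: (@real_induction (fun t => g a - e * (t - a) <= g t) a b ab).
- by rewrite subrr mulr0 subr0.
- move=> t tab gt; have [t' tt' gt'] := H t e tab e_gt0.
  by exists t' => //; lra.
- move=> t /andP[at_ tb] Hs; apply/ler_addgt0Pr => e1 e1_gt0.
  have tab : a <= t <= b by rewrite tb ltW.
  have [d d0 Hd] := gc t tab _ e1_gt0.
  pose s := Num.max a (t - d / 2).
  have /Hs [s' /andP[ss' s't] Ps'] : a <= s < t.
    by rewrite /s le_max lexx gt_max at_ /=; lra.
  have := ss'; rewrite /s gt_max => /andP[as' ts'].
  have /Hd : a <= s' <= b by lra.
  have : `|s' - t| < d by rewrite distrC gtr0_norm; lra.
  move=> /[swap] /[apply]; rewrite ltr_distl => /andP[_ gs'].
  have : e * (s' - a) <= e * (t - a) by apply: ler_wpM2l; lra.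
  lra.
Qed.

(** Multiply by [1 - x]: the left-hand side becomes at most 1, the right-hand side
    [1 + x^2 (1 - 2x)]. *)
Lemma expR_le_quadratic (x : R) : 0 <= x <= 2^-1 ->
  expR x <= 1 + x + 2 * x ^+ 2.
Proof.
move=> /andP[x0 x1].
have h1 := expR_ge1Dx (- x).
have h3 : expR x * expR (- x) = 1 by rewrite -expRD subrr expR0.
have h5 : expR x * (1 - x) <= 1 by rewrite -[leRHS]h3 ler_wpM2l ?expR_ge0.
have h6 : 1 <= (1 + x + 2 * x ^+ 2) * (1 - x).
  have -> : (1 + x + 2 * x ^+ 2) * (1 - x) = 1 + x ^+ 2 * (1 - 2 * x) by ring.
  by rewrite lerDl mulr_ge0 ?exprn_ge0 //; lra.
have x1' : 0 < 1 - x by lra.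
by rewrite -(ler_pM2r x1'); lra.
Qed.

(** The factor [expR (- (c * t))] turns [g' >= c g] into monotonicity. Increments stand in for the
    derivative, because the function [G] of the delay inequality is only known to be Lipschitz. *)
Lemma gronwall_ge (c : R) a b g : 0 <= c -> a <= b ->
  {within `[a, b], continuous g} ->
  (forall t e, a <= t < b -> 0 < e -> exists2 h0, 0 < h0 &
     forall h, 0 < h -> h <= h0 -> t + h <= b ->
       g t + c * h * g t - e * h <= g (t + h)) ->
  expR (c * (b - a)) * g a <= g b.
Proof.
move=> c0 ab gc H.
pose q t := expR (- (c * t)) * g t.
suff : q a <= q b.
  rewrite /q => /(ler_wpM2l (expR_ge0 (c * b))).
  by rewrite !mulrA -!expRD subrr expR0 mul1r mulrBr.
apply: dini_ge => // [|t e tab e0].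
  move=> t; apply: cvgM; last exact: gc.
  apply: continuous_subspaceT => x.
  apply: continuous_comp; last exact: continuous_expR.
  by apply: cvgN; apply: cvgM; [exact: cvg_cst|exact: cvg_id].
have Et := expR_gt0 (- (c * t)).
set m := expR (- (c * t)) in Et *.
have e20 : 0 < e / 2 / m by rewrite !divr_gt0.
have [h0 h0_gt0 Hh] := H t _ tab e20.
(* the error of the first order expansion is at most [c^2 h^2 m |g t|] *)
pose M := m * c ^+ 2 * `|g t| + 1.
have M0 : 0 < M.
  by rewrite /M; apply: ltr_wpDl => //; rewrite !mulr_ge0 // ?exprn_ge0 // ltW.
pose h := Num.min h0 (Num.min (b - t) (e / 2 / M)).
have h_gt0 : 0 < h by rewrite /h !lt_min h0_gt0 !divr_gt0//; lra.
have hh0 : h <= h0 by rewrite /h ge_min lexx.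
have hb : h <= b - t by rewrite /h !ge_min lexx orbT.
have hM : h <= e / 2 / M by rewrite /h !ge_min lexx !orbT.
exists (t + h); first by lra.
have := Hh h h_gt0 hh0 ltac:(lra).
rewrite /q.
have -> : expR (- (c * (t + h))) = m * expR (- (c * h)).
  by rewrite -expRD mulrDr opprD.
set E := expR (- (c * h)).
have E0 : 0 < E by apply: expR_gt0.
have E1 : E <= 1 by rewrite /E expR_le1 oppr_le0 mulr_ge0// ltW.
have ch0 : 0 <= c * h by apply: mulr_ge0 => //; exact: ltW.
have k1 : E * (1 + c * h) <= 1.
  have h3 : E * expR (c * h) = 1 by rewrite /E -expRD addNr expR0.
  by rewrite -[leRHS]h3 ler_wpM2l ?expR_ge1Dx// ltW.
have k2 : 1 - (c * h) ^+ 2 <= E * (1 + c * h).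
  have := expR_ge1Dx (- (c * h)); rewrite -/E => h1.
  have -> : 1 - (c * h) ^+ 2 = (1 + - (c * h)) * (1 + c * h) by ring.
  by apply: ler_wpM2r => //; lra.
move=> /(ler_wpM2l (ltW E0)) /(ler_wpM2l (ltW Et)).
move=> H1; rewrite -mulrA; apply: le_trans H1.
have -> : m * (E * (g t + c * h * g t - e / 2 / m * h)) =
   m * (E * (1 + c * h)) * g t - e / 2 * E * h by field; rewrite gt_eqF.
have k3 : e / 2 * E * h <= e / 2 * h.
  by rewrite -mulrA ler_wpM2l ?ler_piMl //; lra.
have k4 : m * g t - m * (E * (1 + c * h)) * g t <= e / 2 * h.
  have -> : m * g t - m * (E * (1 + c * h)) * g t =
     m * ((1 - E * (1 + c * h)) * g t) by ring.
  have l1 : (1 - E * (1 + c * h)) * g t <= (c * h) ^+ 2 * `|g t|.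
    apply: le_trans (_ : (1 - E * (1 + c * h)) * `|g t| <= _).
      by apply: ler_wpM2l (ler_norm _); lra.
    by apply: ler_wpM2r; [exact: normr_ge0 | lra].
  apply: le_trans (ler_wpM2l (ltW Et) l1) _.
  have -> : m * ((c * h) ^+ 2 * `|g t|) = h * (M - 1) * h by rewrite /M; ring.
  rewrite ler_wpM2r ?(ltW h_gt0)//.
  have : h * M <= e / 2 by rewrite -ler_pdivlMr.
  have : h * (M - 1) <= h * M by apply: ler_wpM2l; lra.
  lra.
have -> : t + h - t = h by ring.
rewrite -/m.
lra.
Qed.

(** Provides the instant at which the loop condition fails for the first time. *)
Lemma first_failure g b : 0 <= b -> {within `[0, b], continuous g} ->
  (forall t, 0 <= t <= b -> 0 < g t) \/
  exists2 d, 0 <= d <= b & g d <= 0 /\ forall t, 0 <= t < d -> 0 < g t.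
Proof.
move=> b0 /within_itvP gc.
have [|nex] := pselect (exists2 d, 0 <= d <= b &
    g d <= 0 /\ forall t, 0 <= t < d -> 0 < g t); first by right.
left; suff : forall t, 0 <= t <= b -> 0 < g t by [].
apply: (@real_induction (fun x => forall t, 0 <= t <= x -> 0 < g t) 0 b b0).
- move=> t t0; have {t0}-> : t = 0 by lra.
  rewrite ltNge; apply/negP => g0; apply: nex; exists 0; first by lra.
  by split => // s; lra.
- move=> t t0b IH.
  have gt : 0 < g t by apply: IH; lra.
  have [|d d0 Hd] := gc t _ _ gt; first by lra.
  exists (Num.min b (t + d / 2)).
    by rewrite lt_min ge_min lexx /=; lra.
  move=> s /andP[s0]; rewrite le_min => /andP[sb sd].
  have [st|ts] := leP s t; first by apply: IH; rewrite s0.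
  have : `|s - t| < d by rewrite gtr0_norm; lra.
  move/Hd; rewrite s0 sb => /(_ isT); rewrite ltr_distl; lra.
- move=> t /andP[t0 tb] IH s /andP[s0 st].
  have lts s1 : 0 <= s1 < t -> 0 < g s1.
    move=> /andP[s10 s1t]; have [|s' ? Hs'] := IH s1; first by rewrite s10.
    by apply: Hs'; rewrite s10 /= ltW //; lra.
  have [->|nst] := eqVneq s t; last first.
    by apply: lts; rewrite s0 lt_neqAle nst.
  rewrite ltNge; apply/negP => g0; apply: nex; exists t; first by lra.
  by split.
Qed.

Lemma alpha_gt3 (alpha : R) : 1 < alpha -> alpha = expR (alpha - 2) -> 3 < alpha.
Proof.
move=> a1 aE; pose l := alpha - 2.
have lE : expR l = l + 2 by rewrite -aE /l; ring.
(* From [expR (- 1/6) >= 5/6] follows [expR (1/6) <= 6/5], and [(6/5)^6 < 3]. *)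
have e3 : expR 1 < 3 :> R.
  have h1 : expR 1 = expR (6^-1) ^+ 6 :> R.
    by rewrite -expRM_natl mulfV // pnatr_eq0.
  have h2 := expR_ge1Dx (- 6^-1 : R).
  have h3 : expR (- 6^-1) * expR (6^-1) = 1 :> R by rewrite -expRD addNr expR0.
  have h4 := expR_gt0 (6^-1 : R).
  have h5 : expR (6^-1) <= 6 / 5 :> R by nra.
  rewrite h1; apply: (@le_lt_trans _ _ ((6 / 5) ^+ 6)); last by lra.
  by apply: lerXn2r => //; rewrite nnegrE; lra.
(* The tangent of [expR] at [l], whose slope is also [l + 2], lies below the graph. At 0 this
   excludes [-1 < l < 0]; at 1, together with [expR 1 < 3], it excludes [0 <= l <= 1]. *)
have tang (x : R) : (l + 2) * (1 + (x - l)) <= expR x.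
  have -> : expR x = (l + 2) * expR (x - l).
    by rewrite -lE -expRD addrC subrK.
  by apply: ler_wpM2l; [rewrite /l; lra | exact: expR_ge1Dx].
have t0 := tang 0; have t1 := tang 1; rewrite expR0 in t0.
have l1 : -1 < l by rewrite /l; lra.
suff : 1 < l by rewrite /l; lra.
rewrite ltNge; apply/negP => l_le1.
have [l0|l0] := ltP l 0; first by nra.
nra.
Qed.

End RealLine.

(** * Growth under the delay inequality, with the delay normalised to 1 *)

Section DelayGrowth.
Context {R : realType}.
Variables (alpha N C : R) (G : R -> R).
Hypotheses (alpha_gt1 : 1 < alpha) (alphaE : alpha = expR (alpha - 2)).
Hypothesis G_lip : forall r s, 0 <= r -> r <= s -> s <= N ->
  0 <= G s - G r <= C * (s - r).
Hypothesis G_neg : forall r, r <= 0 -> G r = 0.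
Hypothesis G_delay : forall r h, 0 <= r -> 0 <= h -> r + h <= N ->
  G r + h * ((alpha - 1) * G r - alpha * G (r - 1)) <= G (r + h).

Let lam := alpha - 2.

Let lam_gt1 : 1 < lam.
Proof. by have := alpha_gt3 alpha_gt1 alphaE; rewrite /lam; lra. Qed.

Let G_cont a b : 0 <= a -> b <= N -> {within `[a, b], continuous G}.
Proof.
move=> a0 bN; apply/within_itvP => t tab e e0.
pose C' := `|C| + 1.
have C'0 : 0 < C' by rewrite /C'; have := normr_ge0 C; lra.
have CC' : C <= C' by rewrite /C'; have := ler_norm C; lra.
exists (e / C'); first by rewrite divr_gt0.
move=> s sab; rewrite ltr_pdivlMr // => H; apply: le_lt_trans H.
have GL r1 r2 : a <= r1 -> r1 <= r2 -> r2 <= b ->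
    `|G r2 - G r1| <= `|r2 - r1| * C'.
  move=> h1 h2 h3; have /andP[h4 h5] := G_lip (le_trans a0 h1) h2 (le_trans h3 bN).
  have d0 : 0 <= r2 - r1 by lra.
  rewrite ger0_norm // (ger0_norm d0) mulrC; apply: le_trans h5 _.
  exact: ler_wpM2r.
have [st|ts] := leP s t; last by apply: GL; lra.
by rewrite distrC [X in _ <= X * _]distrC; apply: GL; lra.
Qed.

Let G_ge0 r : r <= N -> 0 <= G r.
Proof.
move=> rN; have [r0|r0] := leP r 0; first by rewrite G_neg.
have /andP[] := @G_lip 0 r (lexx _) (ltW r0) rN.
by rewrite (G_neg (lexx 0)) subr0.
Qed.

Let lamE : expR lam = alpha.
Proof. by rewrite /lam -alphaE. Qed.

Let Q (m : R) := forall r s, r <= s -> s <= m -> s <= N ->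
  expR (lam * (s - r)) * G r <= G s.

(** Method of steps: on [[m, m + 1]] the delayed argument lies below [m], where the rate [lam] is
    known, so the delayed term is at most the exponential through [G m]. Comparing [G] with that
    exponential yields [alpha * G (r - 1) <= G r], and the inequality then reads
    [G' >= (alpha - 1) G - G = lam G]. *)
Let Q_step m : 0 <= m -> m <= N -> Q m -> Q (m + 1).
Proof.
have lam1 := lam_gt1; have a3 := alpha_gt3 alpha_gt1 alphaE.
have lE : alpha = lam + 2 by rewrite /lam; ring.
move=> m0 mN Qm; pose M := Num.min (m + 1) N.
have Mm : M <= m + 1 by rewrite /M ge_min lexx.
have MN : M <= N by rewrite /M ge_min lexx orbT.
have delay_le r : m <= r <= M -> alpha * G (r - 1) <= expR (lam * (r - m)) * G m.
  move=> rmM; have := Qm (r - 1) m ltac:(lra) (lexx _) mN.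
  move/(ler_wpM2l (expR_ge0 (lam * (r - m)))); apply: le_trans.
  rewrite mulrA -expRD -mulrDr (_ : r - m + (m - (r - 1)) = 1); last by ring.
  by rewrite mulr1 lamE.
have grow r : m <= r <= M -> expR (lam * (r - m)) * G m <= G r.
  move=> rmM; rewrite -subr_ge0.
  (* With [B] the exponential through [G m], one has [g' >= (lam + 1) G - B - lam B = (lam + 1) g]
     and [g m = 0]. *)
  pose g x := G x - expR (lam * (x - m)) * G m.
  have gm : g m = 0 by rewrite /g subrr mulr0 expR0 mul1r subrr.
  suff : expR ((lam + 1) * (r - m)) * g m <= g r by rewrite gm mulr0.
  apply: gronwall_ge; [lra | lra | | ].
    apply: within_continuousB; first by apply: G_cont; lra.
    apply: continuous_subspaceT => x; apply: cvgM; last exact: cvg_cst.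
    apply: continuous_comp; last exact: continuous_expR.
    apply: cvgM; first exact: cvg_cst.
    by apply: cvgB; [exact: cvg_id | exact: cvg_cst].
  move=> t e tmr e0.
  pose B := expR (lam * (t - m)) * G m.
  have B0 : 0 <= B by rewrite mulr_ge0 ?expR_ge0 ?G_ge0.
  pose D := 2 * lam ^+ 2 * B + 1.
  have D0 : 0 < D by rewrite /D; have := mulr_ge0 (sqr_ge0 lam) B0; lra.
  (* The first bound gives [lam * h <= 1/2], for the quadratic estimate of [expR]; the second keeps
     its error [2 (lam h)^2 B] below [e * h]. *)
  exists (Num.min (2^-1 / lam) (e / D)).
    by rewrite lt_min !divr_gt0 //; lra.
  move=> h h0; rewrite le_min => /andP[].
  rewrite !ler_pdivlMr // => [hl he|]; last by lra.
  move=> thr; have := G_delay (r := t) (h := h) ltac:(lra) ltac:(lra) ltac:(lra).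
  have dl := delay_le t ltac:(lra); rewrite -/B in dl.
  have -> : g t = G t - B by [].
  have -> : g (t + h) = G (t + h) - expR (lam * h) * B.
    by rewrite /g /B mulrA -expRD; congr (_ - expR _ * _); ring.
  have q := @expR_le_quadratic _ (lam * h).
  have lh0 : 0 <= lam * h <= 2^-1 by apply/andP; split; [apply: mulr_ge0|]; lra.
  have {q lh0} := ler_wpM2r B0 (q lh0).
  have hdl := ler_wpM2l (ltW h0) dl.
  have hDe := ler_wpM2l (ltW h0) he.
  have hh : 0 <= h * h by apply: mulr_ge0; exact: ltW.
  rewrite lE in hdl *; rewrite /D in hDe; nra.
have slope r : m <= r <= M -> alpha * G (r - 1) <= G r.
  by move=> rmM; apply: le_trans (delay_le r rmM) (grow r rmM).
have mono r s : m <= r -> r <= s -> s <= M -> expR (lam * (s - r)) * G r <= G s.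
  move=> mr rs sM; apply: gronwall_ge; [lra | lra | by apply: G_cont; lra | ].
  move=> t e trs e0; exists 1 => // h h0 _ ths.
  apply: le_trans (G_delay (r := t) (h := h) _ _ _); [|lra..].
  have := ler_wpM2l (ltW h0) (slope t ltac:(lra)).
  have := mulr_gt0 e0 h0; rewrite lE; lra.
move=> r s rs sm sN.
have sM : s <= M by rewrite /M le_min sm.
have [sm'|ms] := leP s m; first exact: Qm.
have [mr|rm] := leP m r; first exact: mono.
have := Qm r m (ltW rm) (lexx _) mN.
move/(ler_wpM2l (expR_ge0 (lam * (s - m)))).
rewrite mulrA -expRD -mulrDr (_ : s - m + (m - r) = s - r); last by ring.
by move/le_trans; apply; apply: mono => //; exact: ltW.
Qed.

Lemma delay_growth r : r <= N -> alpha * G (r - 1) <= G r.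
Proof.
move=> rN.
(* [Q_step] may start at any [m <= N], so the integers up to [N + 1] are reached, and these cover
   [[0, N]]. *)
have Qn n : n%:R <= N + 1 -> Q n%:R.
  elim: n => [_ s t st t0 tN|n IH nN].
    rewrite (G_neg (le_trans st t0)) (G_neg t0) mulr0 //.
  rewrite -natr1; rewrite -natr1 in nN; apply: Q_step; [exact: ler0n | lra |].
  by apply: IH; lra.
have Qr : 0 <= r -> Q r.
  move=> r0; pose n := Num.bound r.
  have : r < n%:R by apply: archi_boundP.
  elim: n => [|n IH]; first by move=> /lt_le_trans => /(_ _ r0); rewrite ltxx.
  move=> rn; have [rn'|nr] := ltP r n%:R; first exact: IH.
  have : Q n.+1%:R by apply: Qn; rewrite -natr1; lra.
  by move=> q s t st tr tN; apply: q => //; apply: le_trans tr (ltW rn).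
have [r0|r0] := leP r 0; first by rewrite !G_neg ?mulr0 //; lra.
have := Qr (ltW r0) (r - 1) r ltac:(lra) (lexx _) rN.
rewrite (_ : r - (r - 1) = 1); last by ring.
by rewrite mulr1 lamE.
Qed.

End DelayGrowth.

(** * Mass and weight of the pairs below a level *)

Section LowerTail.
Context {R : realType}.
Variables (alpha K : R) (n J : R -> R).

(* [n xi] and [J xi] stand for the number and the total weight of the pairs of a
   valid set whose weight is at most [expR xi]. *)
Record lower_tail (M x0 : R) : Prop := LowerTail {
  tail_sandwich : forall eta xi, eta <= xi ->
    expR eta * (n xi - n eta) <= J xi - J eta <= expR xi * (n xi - n eta);
  tail_lipschitz : forall eta xi, eta <= xi -> n xi - n eta <= M * (xi - eta);
  tail_ge0 : 0 <= M;
  tail_mass_ge0 : forall xi, 0 <= n xi;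
  tail_mass0 : n x0 = 0;
  tail_weight0 : J x0 = 0 }.

(* The loop condition of the algorithm, imposed on all the sets obtained by
   keeping only the pairs whose weight is at most [expR xi]. *)
Definition admissible := forall xi eta, n xi <= n eta + K ->
  (alpha - 1) * J xi <= alpha * J eta + K * expR xi.

Variables (M x0 : R).
Hypothesis nJ : lower_tail M x0.

(** Follows from the sandwich alone: as [expR eta < expR xi], its two ends are in order only if the
    mass in between is nonnegative. *)
Lemma tail_mass_mono eta xi : eta <= xi -> n eta <= n xi.
Proof.
move=> le; have /andP[h1 h2] := tail_sandwich nJ le.
move: le; rewrite le_eqVlt => /predU1P[->//|lt].
have : expR eta < expR xi by rewrite ltr_expR.
have := expR_gt0 eta; rewrite -subr_ge0; nra.
Qed.

Lemma tail_weight_mono eta xi : eta <= xi -> J eta <= J xi.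
Proof.
move=> le; have /andP[h1 _] := tail_sandwich nJ le.
have : 0 <= expR eta * (n xi - n eta).
  by rewrite mulr_ge0 ?expR_ge0 // subr_ge0 tail_mass_mono.
lra.
Qed.

(** Makes [J] a function of the mass, although a mass may be attained on a whole interval of
    levels. *)
Lemma tail_weight_congr xi eta : n xi = n eta -> J xi = J eta.
Proof.
wlog : xi eta / eta <= xi.
  move=> H e; have [le|lt] := leP eta xi; first exact: H.
  by rewrite (H eta xi) // ltW.
move=> le e; have := tail_sandwich nJ le; rewrite e subrr !mulr0; lra.
Qed.

Lemma tail_weight_le xi eta : n xi <= n eta -> J xi <= J eta.
Proof.
move=> h; have [le|lt] := leP xi eta; first exact: tail_weight_mono.
rewrite (@tail_weight_congr xi eta) //; apply/eqP.
by rewrite eq_le h tail_mass_mono // ltW.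
Qed.

Lemma tail_ivt lo hi r : n lo <= r <= n hi -> exists2 x, n x = r & lo <= x <= Num.max lo hi.
Proof.
move=> /andP[lor rhi]; have [hl|lh] := leP hi lo.
  exists lo; last by rewrite lexx.
  by apply/eqP; rewrite eq_le lor /= (le_trans rhi) // tail_mass_mono.
have M1 : 0 < M + 1 by have := tail_ge0 nJ; lra.
have nc : {within `[lo, hi], continuous n}.
  apply/within_itvP => t tab e e0; exists (e / (M + 1)); first by rewrite divr_gt0.
  move=> s sab; rewrite ltr_pdivlMr // => H; apply: le_lt_trans H.
  have L u v : u <= v -> `|n v - n u| <= `|v - u| * (M + 1).
    move=> uv; have h := tail_lipschitz nJ uv; have h1 := tail_mass_mono uv.
    rewrite !ger0_norm ?subr_ge0 //; apply: le_trans h _.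
    by rewrite mulrC; apply: ler_wpM2l; lra.
  have [st|ts] := leP s t; last by apply: L; lra.
  by rewrite distrC [X in _ <= X * _]distrC; apply: L.
have rI : Num.min (n lo) (n hi) <= r <= Num.max (n lo) (n hi).
  by rewrite ge_min le_max lor rhi orbT.
have [x] := IVT (ltW lh) nc rI.
by rewrite in_itv /= => xi nx; exists x.
Qed.

Lemma tail_weight_ge0 xi : 0 <= J xi.
Proof.
rewrite -(tail_weight0 nJ); apply: tail_weight_le.
by rewrite (tail_mass0 nJ) (tail_mass_ge0 nJ).
Qed.

Hypotheses (alpha_gt1 : 1 < alpha) (alphaE : alpha = expR (alpha - 2)).
Hypotheses (K_gt0 : 0 < K) (adm : admissible).

(* [J] as a function of [n] satisfies a delay inequality with delay [K]. *)
Lemma tail_growth xi eta : n eta + K <= n xi -> alpha * J eta <= J xi.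
Proof.
move=> le.
have x0xi : x0 <= xi.
  rewrite leNgt; apply/negP => /ltW /tail_mass_mono.
  by have := tail_mass_ge0 nJ eta; have := tail_mass0 nJ; have := K_gt0; lra.
(* [lev r] is a level below which the mass is [K * r]; measuring mass in units of [K] normalises the
   delay to 1. *)
have ex r : exists x, 0 <= r -> K * r <= n xi -> n x = K * r /\ x <= xi.
  have [r0|?] := leP 0 r; last by exists 0 => ?; lra.
  have [rN|?] := leP (K * r) (n xi); last by exists 0 => ? ?; lra.
  have [|x nx /andP[_ xle]] := @tail_ivt x0 xi (K * r).
    by rewrite (tail_mass0 nJ) rN mulr_ge0 // ltW.
  by exists x => _ _; split => //; rewrite max_r in xle.
have [lev levP] := choice ex.
pose N := n xi / K.
have KN : K * N = n xi by rewrite /N mulrC divfK // gt_eqF.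
have KrN r : r <= N -> K * r <= n xi by rewrite -KN ler_pM2l.
pose G r := if r <= 0 then 0 else J (lev r).
have GE r x : 0 <= r -> n x = K * r -> r <= N -> G r = J x.
  rewrite le_eqVlt /G => /predU1P[<-|r0] nx rN.
    rewrite lexx -(tail_weight0 nJ); apply: tail_weight_congr.
    by rewrite nx (tail_mass0 nJ) mulr0.
  rewrite leNgt r0 /=; apply: tail_weight_congr.
  by rewrite nx; have [] := levP r (ltW r0) (KrN _ rN).
have GJ r : 0 <= r -> r <= N -> G r = J (lev r).
  by move=> r0 rN; apply: GE => //; have [] := levP r r0 (KrN _ rN).
have slope r s : 0 <= r -> r <= s -> s <= N ->
    expR (lev r) * (K * (s - r)) <= G s - G r <= expR xi * (K * (s - r)).
  move=> r0 rs sN; have s0 := le_trans r0 rs; have rN := le_trans rs sN.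
  rewrite !GJ //.
  have [nr xr] := levP r r0 (KrN _ rN); have [ns xs] := levP s s0 (KrN _ sN).
  have [lrs|lsr] := leP (lev r) (lev s).
    have := tail_sandwich nJ lrs; rewrite ns nr -mulrBr => /andP[-> h] /=.
    apply: le_trans h _; apply: ler_wpM2r; last by rewrite ler_expR.
    by rewrite mulr_ge0 ?subr_ge0 // ltW.
  have nle := tail_mass_mono (ltW lsr).
  have -> : J (lev s) = J (lev r).
    apply: tail_weight_congr; apply/eqP; rewrite eq_le nle ns nr.
    by rewrite ler_pM2l // rs.
  have : K * s <= K * r by rewrite -ns -nr.
  rewrite ler_pM2l // => sr; have -> : s = r by apply/eqP; rewrite eq_le sr.
  by rewrite !subrr !mulr0 lexx.
have growth r : r <= N -> alpha * G (r - 1) <= G r.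
  apply: (@delay_growth _ alpha N (expR xi * K)) => //.
  - move=> r1 s r0 rs sN; have /andP[h1 h2] := slope r1 s r0 rs sN.
    rewrite -mulrA h2 andbT; apply: le_trans h1.
    by rewrite !mulr_ge0 ?expR_ge0 ?subr_ge0 // ltW.
  - by move=> r1 r0; rewrite /G r0.
  - move=> r1 h r0 h0 rhN; have rN : r1 <= N by lra.
    have /andP[sl _] := slope r1 (r1 + h) r0 ltac:(lra) rhN.
    rewrite (_ : r1 + h - r1 = h) in sl; last by ring.
    have [nr _] := levP r1 r0 (KrN _ rN).
    (* Admissibility at the levels of the masses [K * r1] and [K * (r1 - 1)]; when [r1 <= 1], the
       empty level [x0] replaces the second one. *)
    have a1 : (alpha - 1) * G r1 - alpha * G (r1 - 1) <= K * expR (lev r1).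
      rewrite GJ // lerBlDl.
      have [r11|r11] := leP (r1 - 1) 0.
        rewrite /G r11 mulr0 add0r.
        have := @adm (lev r1) x0; rewrite nr (tail_mass0 nJ) (tail_weight0 nJ).
        rewrite mulr0 !add0r; apply; have := K_gt0; nra.
      rewrite GJ ?(ltW r11) //; last by lra.
      have [nr' _] := levP (r1 - 1) (ltW r11) (KrN (r1 - 1) ltac:(lra)).
      by apply: adm; rewrite nr nr'; lra.
    have := ler_wpM2l h0 a1; lra.
pose r0 := n eta / K.
have Kr0 : K * r0 = n eta by rewrite /r0 mulrC divfK // gt_eqF.
have r00 : 0 <= r0 by rewrite divr_ge0 ?(tail_mass_ge0 nJ) // ltW.
have r1N : r0 + 1 <= N by rewrite -(ler_pM2l K_gt0) KN mulrDr Kr0 mulr1.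
have := growth _ r1N; rewrite (_ : r0 + 1 - 1 = r0); last by ring.
rewrite (GE r0 eta) //; [|lra].
move/le_trans; apply; rewrite GJ //; [|lra].
by apply: tail_weight_mono; have [] := levP (r0 + 1) ltac:(lra) (KrN _ r1N).
Qed.

(** At the top level and the level of a cut of mass [K], the right-hand side is [D]. If
    [J eta <= K * expR eta / 2], then the [K] units between the levels weigh at least
    [K * expR eta], and [alpha - 1 > 2] suffices. Otherwise [J xi >= alpha * J eta] leaves at least
    [alpha (alpha - 2) J eta >= 3 J eta]. *)
Lemma tail_gap xi eta : n eta + K <= n xi ->
  3 / 2 * K * expR eta <= (alpha - 1) * J xi - alpha * J eta.
Proof.
have a3 := alpha_gt3 alpha_gt1 alphaE; move=> le.
have g := tail_growth le; have e0 := expR_gt0 eta; have K0 := K_gt0.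
have [sm|lg] := leP (J eta) (K * expR eta / 2).
  have eta_xi : eta <= xi.
    by rewrite leNgt; apply/negP => /ltW /tail_mass_mono; lra.
  have /andP[h _] := tail_sandwich nJ eta_xi.
  have h1 : expR eta * K <= J xi - J eta.
    by apply: le_trans h; apply: ler_wpM2l; lra.
  have h2 : (alpha - 1) * (expR eta * K) <= (alpha - 1) * (J xi - J eta).
    by apply: ler_wpM2l; lra.
  have h3 : 2 * (expR eta * K) <= (alpha - 1) * (expR eta * K).
    by apply: ler_wpM2r; [apply: mulr_ge0; exact: ltW | lra].
  lra.
have h4 : (alpha - 1) * (alpha * J eta) <= (alpha - 1) * J xi.
  by apply: ler_wpM2l; lra.
have h5 : 3 * J eta <= alpha * (alpha - 2) * J eta.
  apply: ler_wpM2r; last by nra.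
  by apply: le_trans (ltW lg); rewrite !mulr_ge0 ?invr_ge0 //; exact: ltW.
lra.
Qed.

(** The loop tests the whole class, whereas admissibility concerns every level: the whole class
    turns out to be the worst case. A violation at [xi] forces [3/2 * expR eta1 < expR xi], and then
    raising [xi] to [xi1], and [eta] along with it, can only increase the excess. *)
Lemma tail_excess_mono xi1 delta :
  (forall xi, n xi <= n xi1) ->
  (forall eta, n xi1 <= n eta + K -> (alpha - 1) * J xi1 <= alpha * J eta + delta) ->
  forall xi eta, n xi <= n eta + K -> (alpha - 1) * J xi <= alpha * J eta + delta.
Proof.
have a3 := alpha_gt3 alpha_gt1 alphaE.
move=> top Hd xi eta le.
wlog le1 : xi le / xi <= xi1.
  move=> H; have [h|h] := leP xi xi1; first exact: H.
  have e : n xi = n xi1 by apply/eqP; rewrite eq_le top tail_mass_mono // ltW.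
  by rewrite (tail_weight_congr e); apply: H => //; rewrite -e.
have mJ := tail_weight_mono le1; have mn := tail_mass_mono le1.
have [s|s] := leP (n xi1) (n eta + K).
  have h := Hd _ s.
  have : (alpha - 1) * J xi <= (alpha - 1) * J xi1 by apply: ler_wpM2l; lra.
  lra.
(* The mass above [eta1] is exactly [K]. *)
have [|eta1 n1 /andP[e1 _]] := @tail_ivt eta xi1 (n xi1 - K).
  by have := K_gt0; lra.
have h1 := Hd eta1 ltac:(lra).
have gap := @tail_gap xi1 eta1 ltac:(lra).
have ad := @adm xi eta le.
have /andP[s1 _] := tail_sandwich nJ le1.
have /andP[_ s2] := tail_sandwich nJ e1.
rewrite leNgt; apply/negP => bad.
(* [delta] is at least [3/2 * K * expR eta1] by the gap, while by [adm] the excess at [xi] is at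
   most [K * expR xi]. *)
have c1 : 3 / 2 * expR eta1 < expR xi.
  have K0 := K_gt0; rewrite -(ltr_pM2l K_gt0); lra.
have d0 : 0 <= n xi1 - n xi by lra.
have e0 := expR_gt0 eta1.
have c2 : alpha * expR eta1 <= (alpha - 1) * expR xi.
  have h : (alpha - 1) * (3 / 2 * expR eta1) <= (alpha - 1) * expR xi.
    by apply: ler_wpM2l; lra.
  nra.
have c3 : alpha * (J eta1 - J eta) <= alpha * (expR eta1 * (n xi1 - n xi)).
  apply: ler_wpM2l; first by lra.
  by apply: le_trans s2 _; apply: ler_wpM2l; [exact: ltW | lra].
have c4 : (alpha - 1) * (expR xi * (n xi1 - n xi)) <= (alpha - 1) * (J xi1 - J xi).
  by apply: ler_wpM2l => //; lra.
have := ler_wpM2r d0 c2; lra.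
Qed.

End LowerTail.

(** * Bars of pairs with exponentially decaying weights *)

Section Profile.
Context {R : realType}.

Lemma expR_diff_bounds (p q : R) : p <= q ->
  expR (- q) * (q - p) <= expR (- p) - expR (- q) <= expR (- p) * (q - p).
Proof.
move=> pq; have ep := expR_gt0 (- p); have eq := expR_gt0 (- q).
have h1 : expR (- p) = expR (- q) * expR (q - p).
  by rewrite -expRD; congr expR; ring.
have h2 : expR (- q) = expR (- p) * expR (- (q - p)).
  by rewrite -expRD; congr expR; ring.
have h3 := ler_wpM2l (ltW eq) (expR_ge1Dx (q - p)).
have h4 := ler_wpM2l (ltW ep) (expR_ge1Dx (- (q - p))).
by apply/andP; split; lra.
Qed.

(** Projection of [z] onto [[0, a]]. *)
Definition clip (a z : R) : R := Num.min a (Num.max z 0).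

Lemma clipP (a z : R) : 0 <= a ->
  [\/ a <= z /\ clip a z = a, 0 <= z <= a /\ clip a z = z | z <= 0 /\ clip a z = 0].
Proof.
rewrite /clip => a0; have [z0|z0] := leP z 0.
  by constructor 3; split => //; apply: min_r.
have [az|za] := leP a z; first by constructor 1.
by constructor 2; rewrite (ltW z0) ltW.
Qed.

Variables (E : finType) (C : {set E}).
Implicit Types (a y S : E -> R).

(* The pair [(v, t)] has weight [expR (y v - t)]: [above a y xi v] is the length of
   the part of weight more than [expR xi] of the bar of [v]. *)
Definition above a y (xi : R) (v : E) : R := clip (a v) (y v - xi).
Definition total S : R := \sum_(v in C) S v.
Definition value y S : R := \sum_(v in C) expR (y v) * (1 - expR (- S v)).
Definition low_mass a y (xi : R) : R := total a - total (above a y xi).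
Definition low_value a y (xi : R) : R := value y a - value y (above a y xi).

Lemma low_massE a y xi : low_mass a y xi = \sum_(v in C) (a v - above a y xi v).
Proof. by rewrite /low_mass /total -sumrB. Qed.

Lemma low_valueE a y xi : low_value a y xi =
  \sum_(v in C) expR (y v) * (expR (- above a y xi v) - expR (- a v)).
Proof. by rewrite /low_value /value -sumrB; apply: eq_bigr => v _; ring. Qed.

Lemma above_ge0 a y xi v : 0 <= a v -> 0 <= above a y xi v.
Proof. by rewrite /above => a0; case: (clipP (y v - xi) a0) => -[? ->]; lra. Qed.

Lemma above_le a y xi v : 0 <= a v -> above a y xi v <= a v.
Proof. by rewrite /above => a0; case: (clipP (y v - xi) a0) => -[? ->]; lra. Qed.

Lemma above_antitone a y xi eta v : 0 <= a v -> eta <= xi ->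
  0 <= above a y eta v - above a y xi v <= xi - eta.
Proof.
rewrite /above => a0 le.
by case: (clipP (y v - xi) a0) => -[? ->]; case: (clipP (y v - eta) a0) => -[? ->]; lra.
Qed.

(** The pairs of the bar between the two heights have weights between [expR eta] and [expR xi]: if
    the heights differ, the clipping can only lower the upper one and raise the lower one ([k1],
    [k2]). *)
Lemma above_sandwich a y xi eta v : 0 <= a v -> eta <= xi ->
  let d := above a y eta v - above a y xi v in
  expR eta * d <= expR (y v) * (expR (- above a y xi v) - expR (- above a y eta v))
    <= expR xi * d.
Proof.
move=> a0 le /=; have /andP[h _] := above_antitone y a0 le.
have [->|ne] := eqVneq (above a y xi v) (above a y eta v).
  by rewrite !subrr !mulr0 lexx.
have lt : above a y xi v < above a y eta v by rewrite lt_neqAle ne -subr_ge0.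
have k1 : above a y eta v <= y v - eta.
  by move: lt; rewrite /above; case: (clipP (y v - xi) a0) => -[? ->];
     case: (clipP (y v - eta) a0) => -[? ->]; lra.
have k2 : y v - xi <= above a y xi v.
  by move: lt; rewrite /above; case: (clipP (y v - xi) a0) => -[? ->];
     case: (clipP (y v - eta) a0) => -[? ->]; lra.
have /andP[d1 d2] := expR_diff_bounds (ltW lt).
have ey := expR_ge0 (y v).
apply/andP; split.
  apply: le_trans (ler_wpM2l ey d1); rewrite mulrA -expRD.
  by apply: ler_wpM2r; [lra | rewrite ler_expR; lra].
apply: le_trans (ler_wpM2l ey d2) _; rewrite mulrA -expRD.
by apply: ler_wpM2r; [lra | rewrite ler_expR; lra].
Qed.

Lemma profile_bounds a y : exists x0 x1 : R, forall v,
  x0 <= y v - a v /\ y v <= x1.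
Proof.
have : exists x0 x1 : R, forall v, v \in enum E -> x0 <= y v - a v /\ y v <= x1.
  elim: (enum E) => [|w s [x0 [x1 IH]]]; first by exists 0, 0.
  exists (Num.min x0 (y w - a w)), (Num.max x1 (y w)) => v.
  rewrite inE => /predU1P[->|/IH[h1 h2]].
    by rewrite ge_min le_max !lexx !orbT.
  by rewrite ge_min le_max h1 h2.
by move=> [x0 [x1 H]]; exists x0, x1 => v; apply: H; rewrite mem_enum.
Qed.

(** The Lipschitz constant is the number of bars, because a rise of the level by [xi - eta] shortens
    each by at most that much. *)
Lemma low_tail a y x0 : (forall v, 0 <= a v) -> (forall v, x0 <= y v - a v) ->
  lower_tail (low_mass a y) (low_value a y) #|C|%:R x0.
Proof.
move=> a0 hx0.
have ab0 v : above a y x0 v = a v.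
  rewrite /above; have := hx0 v; have := a0 v.
  by case: (clipP (y v - x0) (a0 v)) => -[? ->]; lra.
split => //.
- move=> eta xi le; rewrite !low_massE !low_valueE -!sumrB !mulr_sumr.
  apply/andP; split; apply: ler_sum => v _;
    have /= := above_sandwich y (a0 v) le; lra.
- move=> eta xi le; rewrite !low_massE -sumrB.
  apply: (@le_trans _ _ (\sum_(v in C) (xi - eta))).
    by apply: ler_sum => v _; have := above_antitone y (a0 v) le; lra.
  by rewrite sumr_const mulr_natl.
- move=> xi; rewrite low_massE; apply: sumr_ge0 => v _.
  by rewrite subr_ge0 above_le.
- by rewrite low_massE big1 // => v _; rewrite ab0 subrr.
- by rewrite low_valueE big1 // => v _; rewrite ab0 subrr mulr0.
Qed.

Lemma low_mass_top a y x1 : (forall v, 0 <= a v) -> (forall v, y v <= x1) ->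
  low_mass a y x1 = total a /\ low_value a y x1 = value y a.
Proof.
move=> a0 hx1.
have ab0 v : above a y x1 v = 0.
  rewrite /above; have := hx1 v; have := a0 v.
  by case: (clipP (y v - x1) (a0 v)) => -[? ->]; lra.
split.
  by rewrite low_massE /total; apply: eq_bigr => v _; rewrite ab0 subr0.
rewrite /low_value [value y (above _ _ _)]big1 ?subr0 // => v _.
by rewrite ab0 oppr0 expR0 subrr mulr0.
Qed.

Lemma low_mass_le a y xi : (forall v, 0 <= a v) -> low_mass a y xi <= total a.
Proof.
by move=> a0; rewrite /low_mass lerBlDr lerDl sumr_ge0 // => v _; exact: above_ge0.
Qed.

End Profile.

(** * Stability under the addition of a small mass *)

Section Perturbation.
Context {R : realType}.
Variables (alpha K : R) (n J n' J' : R -> R) (M x0 x1 h c : R).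
Hypotheses (nJ : lower_tail n J M x0) (alpha_gt1 : 1 < alpha).
Hypotheses (h_ge0 : 0 <= h) (K_ge0 : 0 <= K).
Hypotheses (nn' : forall xi, n xi <= n' xi <= n xi + h).
Hypotheses (JJ' : forall xi, J xi <= J' xi <= J xi + c * h).
Hypothesis top : forall xi, n xi <= n x1.

Lemma tail_perturb (B : R) xi eta :
  (forall eta, n xi <= n eta + K -> (alpha - 1) * J xi <= alpha * J eta + B) ->
  n' xi <= n' eta + K ->
  (alpha - 1) * J' xi <=
    alpha * J' eta + B + h * ((alpha - 1) * c + alpha * expR x1).
Proof.
move=> H le.
(* [eta] is raised to make up for the extra mass [h]; the slice passed over has mass at most [h],
   hence weight at most [h * expR x1]. If no more than [h] is left above [eta], the top level, or
   [eta] itself if it is higher, will do. *)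
have [eta' n1 J1] : exists2 eta', n xi <= n eta' + K & J eta' <= J eta + h * expR x1.
  have h0 := h_ge0; have K0 := K_ge0.
  have Je eta' : eta <= eta' -> eta' <= x1 -> n eta' <= n eta + h ->
      J eta' <= J eta + h * expR x1.
    move=> le1 le2 ln; have /andP[_] := tail_sandwich nJ le1.
    have : expR eta' * (n eta' - n eta) <= expR x1 * h.
      apply: le_trans (_ : expR eta' * h <= _).
        by apply: ler_wpM2l; [exact: expR_ge0 | lra].
      by apply: ler_wpM2r => //; rewrite ler_expR.
    lra.
  have [/andP[_ p1] /andP[p2 _]] := (nn' eta, nn' xi).
  have [s|s] := leP (n x1) (n eta + h).
    have [ex|xe] := leP eta x1.
      by exists x1; [have := top xi; lra | exact: Je].
    exists eta; first by have := top xi; have := tail_mass_mono nJ (ltW xe); lra.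
    by rewrite lerDl mulr_ge0 ?expR_ge0.
  have [|eta' ne] := @tail_ivt _ _ _ _ _ nJ eta x1 (n eta + h); first by lra.
  have ex : eta <= x1.
    by rewrite leNgt; apply/negP => /ltW /(tail_mass_mono nJ); lra.
  rewrite max_r // => /andP[e1 e2].
  by exists eta'; [lra | apply: Je => //; lra].
have h1 := H _ n1.
have a0 : 0 <= alpha by have := alpha_gt1; lra.
have a1 : 0 <= alpha - 1 by have := alpha_gt1; lra.
have h2 := ler_wpM2l a0 J1.
have /andP[_ /(ler_wpM2l a1) h3] := JJ' xi.
have /andP[/(ler_wpM2l a0) h4 _] := JJ' eta.
lra.
Qed.

End Perturbation.

(** * Admissibility while the bar of [u] grows *)

Section Round.
Context {R : realType} {E : finType}.
Variables (alpha K : R) (C : {set E}) (a y : E -> R) (u : E).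
Hypotheses (alpha_gt1 : 1 < alpha) (alphaE : alpha = expR (alpha - 2)).
Hypotheses (K_gt0 : 0 < K) (a_ge0 : forall v, 0 <= a v).
Hypotheses (uC : u \in C) (au : a u = 0).

Let A t := incr a u t.

Lemma incr_ge0 t v : 0 <= t -> 0 <= A t v.
Proof.
by move=> t0; rewrite /A /incr; case: eqP => // _; exact: addr_ge0.
Qed.

Definition round_adm t :=
  admissible alpha K (low_mass C (A t) y) (low_value C (A t) y).

Lemma low_massD1 t xi : low_mass C (A t) y xi =
  t - clip t (y u - xi) + \sum_(v in C | v != u) (a v - above a y xi v).
Proof.
rewrite low_massE (bigD1 u uC) /= /above /A /incr eqxx au add0r; congr (_ + _).
by apply: eq_bigr => v /andP[_ /negbTE ->].
Qed.

Lemma low_valueD1 t xi : low_value C (A t) y xi =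
  expR (y u) * (expR (- clip t (y u - xi)) - expR (- t)) +
  \sum_(v in C | v != u) expR (y v) * (expR (- above a y xi v) - expR (- a v)).
Proof.
rewrite low_valueE (bigD1 u uC) /= /above /A /incr eqxx au add0r; congr (_ + _).
by apply: eq_bigr => v /andP[_ /negbTE ->].
Qed.

Lemma low_mass_incr s t xi : 0 <= s <= t ->
  low_mass C (A s) y xi <= low_mass C (A t) y xi <= low_mass C (A s) y xi + (t - s).
Proof.
move=> st; have s0 : 0 <= s by lra. have t0 : 0 <= t by lra.
rewrite !low_massD1; set X := \sum_(_ in _ | _) _.
by case: (clipP (y u - xi) s0) => -[? ->]; case: (clipP (y u - xi) t0) => -[? ->]; lra.
Qed.

Lemma low_value_incr s t xi : 0 <= s <= t ->
  low_value C (A s) y xi <= low_value C (A t) y xi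
    <= low_value C (A s) y xi + expR (y u) * (t - s).
Proof.
move=> st; have s0 : 0 <= s by lra. have t0 : 0 <= t by lra.
rewrite !low_valueD1; set X := \sum_(_ in _ | _) _.
suff : 0 <= expR (- clip t (y u - xi)) - expR (- t) -
         (expR (- clip s (y u - xi)) - expR (- s)) <= t - s.
  move=> /andP[/(mulr_ge0 (expR_ge0 (y u))) h1].
  move=> /(ler_wpM2l (expR_ge0 (y u))) h2; lra.
have D (p q : R) : 0 <= p -> p <= q -> 0 <= expR (- p) - expR (- q) <= q - p.
  move=> p0 pq; have /andP[h1 h2] := expR_diff_bounds pq.
  have e1 : expR (- p) <= 1 by rewrite expR_le1 oppr_le0.
  have e0 := expR_ge0 (- q).
  have pq' : 0 <= q - p by lra.
  have h3 := ler_wpM2r pq' e1; have h4 := mulr_ge0 e0 pq'; lra.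
set z := y u - xi.
have D0t := D 0 t (lexx _) t0; have Dst := D s t s0 ltac:(lra).
rewrite oppr0 expR0 in D0t.
case: (clipP z s0) => -[hs ->]; case: (clipP z t0) => -[ht ->].
- by lra.
- by have := D z t ltac:(lra) ltac:(lra); lra.
- have -> : s = 0 by lra.
  rewrite ?oppr0 ?expR0; lra.
- have -> : z = s by lra.
  lra.
- by lra.
- have -> : z = 0 by lra.
  rewrite ?oppr0 ?expR0; lra.
- have tz : t = 0 by lra. have sz : s = 0 by lra.
  by rewrite tz sz !oppr0 !expR0; lra.
- have -> : z = 0 by lra.
  rewrite ?oppr0 ?expR0; lra.
- by rewrite !oppr0 !expR0; lra.
Qed.

(** [x1] depends on [y] only and can be fixed before [t], which makes the constant of
    [round_perturb] uniform in time. *)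
Lemma round_tail : exists x1 : R, forall t, 0 <= t -> exists x0 : R,
  [/\ lower_tail (low_mass C (A t) y) (low_value C (A t) y) #|C|%:R x0,
      forall xi, low_mass C (A t) y xi <= low_mass C (A t) y x1,
      low_mass C (A t) y x1 = total C (A t) & low_value C (A t) y x1 = value C y (A t)].
Proof.
have [x0' [x1 H1]] := profile_bounds a y.
exists x1 => t t0; have A0 v := incr_ge0 v t0.
have [x0 [x1' H]] := profile_bounds (A t) y.
have [h1 h2] := low_mass_top C A0 (fun v => (H1 v).2).
exists x0; split => //; first by apply: low_tail => // v; exact: (H v).1.
by move=> xi; rewrite h1; exact: low_mass_le.
Qed.

(** As [C1] is independent of [s] and [t], the bound serves both to move forward in time and to pass
    to limits. *)
Lemma round_perturb : exists2 C1, 0 <= C1 & forall s t, 0 <= s <= t ->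
  forall B xi eta,
  (forall eta, low_mass C (A s) y xi <= low_mass C (A s) y eta + K ->
     (alpha - 1) * low_value C (A s) y xi <= alpha * low_value C (A s) y eta + B) ->
  low_mass C (A t) y xi <= low_mass C (A t) y eta + K ->
  (alpha - 1) * low_value C (A t) y xi <=
     alpha * low_value C (A t) y eta + B + (t - s) * C1.
Proof.
have [x1 Hx] := round_tail.
exists ((alpha - 1) * expR (y u) + alpha * expR x1).
  have a1 : 0 <= alpha - 1 by have := alpha_gt1; lra.
  have a0 : 0 <= alpha by lra.
  by rewrite addr_ge0 // mulr_ge0 ?expR_ge0.
move=> s t st B xi eta H1 H2.
have [x0 [T top _ _]] := Hx s ltac:(lra).
apply: (tail_perturb (n := low_mass C (A s) y) (J := low_value C (A s) y)
   (n' := low_mass C (A t) y) (J' := low_value C (A t) y) (x1 := x1) (K := K) T) => //.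
- lra.
- exact: ltW.
- by move=> z; exact: low_mass_incr.
- by move=> z; exact: low_value_incr.
Qed.

(** The levels below the weights of the new pairs see no change. At the higher ones, the excess is
    at most [delta] plus an error proportional to the elapsed time, and the strict loop condition
    leaves room for it. *)
Lemma round_adm_extend t delta : 0 <= t -> round_adm t ->
  (forall eta, total C (A t) <= low_mass C (A t) y eta + K ->
     (alpha - 1) * value C y (A t) <= alpha * low_value C (A t) y eta + delta) ->
  delta < K * expR (y u - t) ->
  exists2 t', t < t' & forall s, t <= s <= t' -> round_adm s.
Proof.
move=> t0 adm Hd dlt.
have [C1 C10 HC] := round_perturb.
have [x1 Hx] := round_tail; have [x0 [T top n1 J1]] := Hx t t0.
have ex : forall xi eta, low_mass C (A t) y xi <= low_mass C (A t) y eta + K ->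
    (alpha - 1) * low_value C (A t) y xi <= alpha * low_value C (A t) y eta + delta.
  apply: (tail_excess_mono T alpha_gt1 alphaE K_gt0 adm top).
  by rewrite n1 J1.
pose Kc := K * expR (y u - t).
have Kc0 : 0 < Kc by rewrite mulr_gt0 ?expR_gt0.
(* The length [x] solves [delta + x * C1 = Kc * (1 - x)]: growth of the error against decay of the
   weight of [u]. *)
exists (t + (Kc - delta) / (C1 + Kc)).
  by rewrite ltrDl divr_gt0 ?subr_gt0 //; lra.
move=> s /andP[ts]; rewrite -lerBlDl ler_pdivlMr; last by lra.
move=> sd xi eta le; have s0 : 0 <= s by lra.
have [x0' [T' _ _ _]] := Hx s s0.
have [xe|ex'] := ltP xi eta.
  have m := tail_weight_mono T' (ltW xe).
  have := tail_weight_ge0 T' xi; have := mulr_ge0 (ltW K_gt0) (expR_ge0 xi).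
  have : alpha * low_value C (A s) y xi <= alpha * low_value C (A s) y eta.
    by apply: ler_wpM2l => //; have := alpha_gt1; lra.
  lra.
(* All pairs added since [t] weigh at least [expR (y u - s)]; in the first case nothing has changed
   below [xi]. *)
have [sm|lg] := leP xi (y u - s).
  have Ez z : z <= xi -> low_mass C (A s) y z = low_mass C (A t) y z /\
    low_value C (A s) y z = low_value C (A t) y z.
    move=> zx; rewrite !low_massD1 !low_valueD1.
    have -> : clip s (y u - z) = s.
      by case: (clipP (y u - z) s0) => -[? ->]; lra.
    have -> : clip t (y u - z) = t.
      by case: (clipP (y u - z) t0) => -[? ->]; lra.
    by rewrite !subrr.
  move: le; have [-> ->] := Ez xi (lexx _); have [-> ->] := Ez eta ex'; exact: adm.
have := HC t s ltac:(lra) delta xi eta (ex xi) le.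
have : Kc * (1 - (s - t)) <= K * expR xi.
  apply: (@le_trans _ _ (Kc * expR (- (s - t)))).
    by rewrite ler_wpM2l ?expR_ge1Dx // ltW.
  rewrite /Kc -mulrA -expRD ler_wpM2l ?ler_expR //; first exact: ltW.
  lra.
lra.
Qed.

Lemma round_adm_closed t : 0 < t ->
  (forall s, 0 <= s < t -> exists2 s', s < s' < t & round_adm s') -> round_adm t.
Proof.
move=> t0 H xi eta le.
apply/ler_addgt0Pr => e e0.
have [C1 C10 HC] := round_perturb.
have [|s] := H (Num.max 0 (t - e / (C1 + 1))).
  by rewrite le_max lexx gt_max t0 /= ltrBlDr ltrDl divr_gt0 //; lra.
rewrite gt_max => /andP[/andP[s0 ts] st] adm.
have {}ts : (t - s) * (C1 + 1) <= e.
  by rewrite -ler_pdivlMr; lra.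
have := HC s t ltac:(lra) _ xi eta (adm xi) le.
lra.
Qed.

End Round.

(** * Right derivatives and monotonicity *)

Section RightDerivative.
Context {R : realType}.
Implicit Types (g : R -> R) (a b t l s : R).

Lemma right_derivativeP g t l : right_derivative g t l <->
  forall e, 0 < e -> exists2 d, 0 < d &
    forall h, 0 < h < d -> `|g (t + h) - g t - l * h| <= e * h.
Proof.
have E h : 0 < h -> `|l - (g (t + h) - g t) / h| = `|g (t + h) - g t - l * h| / h.
  move=> h0; have -> : l - (g (t + h) - g t) / h = - ((g (t + h) - g t - l * h) / h).
    by field; rewrite gt_eqF.
  by rewrite normrN normf_div (gtr0_norm h0).
split=> [/cvgrPdist_le H e e0|H].
  have := H e e0; rewrite near_withinE => /nbhs_ballP [d /= d0 Hd].
  exists d => // h /andP[h0 hd]; have := Hd h; rewrite /ball /= sub0r normrN.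
  by rewrite gtr0_norm // => /(_ hd h0); rewrite E // ler_pdivrMr.
apply/cvgrPdist_le => e e0; have [d d0 Hd] := H e e0.
rewrite near_withinE; apply/nbhs_ballP; exists d => //= h.
rewrite /ball /= sub0r normrN => hd h0; rewrite E // ler_pdivrMr //.
by apply: Hd; rewrite h0 /= (le_lt_trans (ler_norm h)).
Qed.

Lemma right_derivative_cst c t : right_derivative (cst c) t (0 : R).
Proof.
by apply/right_derivativeP => e e0; exists 1 => // h h0;
   rewrite subrr mul0r subr0 normr0 mulr_ge0; lra.
Qed.

Lemma right_derivativeD g1 g2 t l1 l2 : right_derivative g1 t l1 ->
  right_derivative g2 t l2 -> right_derivative (fun s => g1 s + g2 s) t (l1 + l2).
Proof.
move=> H1 H2.
rewrite /right_derivative (_ : (fun h => _) = (fun h : R =>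
  (g1 (t + h) - g1 t) / h + (g2 (t + h) - g2 t) / h)); first exact: cvgD.
by apply/funext => h; rewrite -mulrDl; congr (_ / _); ring.
Qed.

Lemma right_derivativeN g t l : right_derivative g t l ->
  right_derivative (fun s => - g s) t (- l).
Proof.
move=> H; rewrite /right_derivative (_ : (fun h => _) = (fun h : R =>
  - ((g (t + h) - g t) / h))); first exact: cvgN.
by apply/funext => h; rewrite -mulNr; congr (_ / _); ring.
Qed.

Lemma right_derivative_id t : right_derivative (fun s : R => s) t 1.
Proof.
apply/right_derivativeP => e e0; exists 1 => // h h0.
have -> : t + h - t - 1 * h = 0 by ring.
by rewrite normr0 mulr_ge0; lra.
Qed.

Lemma right_derivative_sum (I : finType) (P : pred I) (g : I -> R -> R) t (l : I -> R) :
  (forall i, right_derivative (g i) t (l i)) ->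
  right_derivative (fun s => \sum_(i | P i) g i s) t (\sum_(i | P i) l i).
Proof.
move=> H; elim: (index_enum I) => [|i s IH].
  rewrite big_nil; have -> : (fun r => \sum_(j <- [::] | P j) g j r) = cst 0.
    by apply/funext => r; rewrite big_nil.
  exact: right_derivative_cst.
rewrite big_cons; have -> : (fun r => \sum_(j <- i :: s | P j) g j r) =
    (fun r => if P i then g i r + \sum_(j <- s | P j) g j r else \sum_(j <- s | P j) g j r).
  by apply/funext => r; rewrite big_cons.
by case: (P i) => //; apply: right_derivativeD.
Qed.

Lemma within_continuous_sum (I : finType) (P : pred I) (g : I -> R -> R) a b :
  (forall i, {within `[a, b], continuous (g i)}) ->
  {within `[a, b], continuous (fun s => \sum_(i | P i) g i s)}.
Proof.
move=> H; elim: (index_enum I) => [|i s IH].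
  have -> : (fun r => \sum_(j <- [::] | P j) g j r) = cst 0.
    by apply/funext => r; rewrite big_nil.
  by apply: continuous_subspaceT; exact: cst_continuous.
have -> : (fun r => \sum_(j <- i :: s | P j) g j r) =
    (fun r => if P i then g i r + \sum_(j <- s | P j) g j r else \sum_(j <- s | P j) g j r).
  by apply/funext => r; rewrite big_cons.
by case: (P i) => //; apply: within_continuousD.
Qed.

(** The truncation [Num.min (g t) c] is constant just after an instant where [g] exceeds [c], and
    has no downward slope at the other instants; so it never decreases. *)
Lemma right_derivative_barrier g a b c : a <= b -> {within `[a, b], continuous g} ->
  (forall t, a <= t < b -> g t <= c -> exists2 l, 0 <= l & right_derivative g t l) ->
  Num.min (g a) c <= g b.
Proof.
move=> ab gc H.
suff : Num.min (g a) c <= Num.min (g b) c.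
  by move/le_trans; apply; rewrite ge_min lexx.
have lip x y : `|Num.min x c - Num.min y c| <= `|x - y|.
  have L p q : p <= q -> `|Num.min p c - Num.min q c| <= `|p - q|.
    move=> pq; rewrite [in leRHS]distrC [leRHS]ger0_norm ?subr_ge0 //.
    by case: (leP p c); case: (leP q c) => ? ?;
       rewrite distrC ger0_norm; lra.
  have [xy|yx] := leP x y; first exact: L.
  by rewrite distrC [leRHS]distrC; apply: L; exact: ltW.
apply: (@dini_ge _ a b (fun t => Num.min (g t) c)) => //.
  move/within_itvP : gc => gc; apply/within_itvP => t tab e e0.
  have [d d0 Hd] := gc t tab e e0; exists d => // s sab sd.
  by apply: le_lt_trans (lip _ _) _; exact: Hd.
move=> t e tab e0; have [gt|gt] := leP (g t) c.
  have [l l0 /right_derivativeP /(_ e e0) [d d0 Hd]] := H t tab gt.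
  pose h := Num.min (d / 2) (b - t).
  have h0 : 0 < h by rewrite lt_min; lra.
  have hd : h <= d / 2 by rewrite ge_min lexx.
  have hb : h <= b - t by rewrite ge_min lexx orbT.
  exists (t + h); first by lra.
  have := Hd h ltac:(lra); rewrite ler_norml => /andP[h1 _].
  have lh : 0 <= l * h by rewrite mulr_ge0 // ltW.
  have eh : 0 <= e * h by rewrite mulr_ge0 // ltW.
  have -> : t + h - t = h by ring.
  by rewrite le_min; apply/andP; split; lra.
move/within_itvP : gc => gc.
have [|d d0 Hd] := gc t _ (g t - c) ltac:(lra); first by lra.
pose h := Num.min (d / 2) (b - t).
have h0 : 0 < h by rewrite lt_min; lra.
have hd : h <= d / 2 by rewrite ge_min lexx.
have hb : h <= b - t by rewrite ge_min lexx orbT.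
exists (t + h); first by lra.
have : `|t + h - t| < d by rewrite (_ : t + h - t = h); [rewrite gtr0_norm; lra | ring].
move/Hd => /(_ ltac:(lra)); rewrite ltr_distl => /andP[h1 _].
have -> : t + h - t = h by ring.
have eh : 0 <= e * h by rewrite mulr_ge0 // ltW.
by rewrite le_min; apply/andP; split; lra.
Qed.

Lemma right_derivative_ge0 g a b : a <= b -> {within `[a, b], continuous g} ->
  (forall t, a <= t < b -> exists2 l, 0 <= l & right_derivative g t l) -> g a <= g b.
Proof.
move=> ab gc H; have := @right_derivative_barrier g a b (g a) ab gc.
by rewrite minxx; apply => t tab _; exact: H.
Qed.

Lemma right_derivative_le0 g a b : a <= b -> {within `[a, b], continuous g} ->
  (forall t, a <= t < b -> exists2 l, l <= 0 & right_derivative g t l) -> g b <= g a.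
Proof.
move=> ab gc H; rewrite -lerN2; apply: (@right_derivative_ge0 (fun s => - g s)) => //.
  by move=> x; apply: cvgN; exact: gc.
move=> t tab; have [l l0 Hl] := H t tab; exists (- l); first by lra.
exact: right_derivativeN.
Qed.

Lemma right_derivative_eq0 g a b : a <= b -> {within `[a, b], continuous g} ->
  (forall t, a <= t < b -> right_derivative g t 0) -> g b = g a.
Proof.
move=> ab gc H; apply/eqP; rewrite eq_le.
rewrite (@right_derivative_le0 g a b) ?(@right_derivative_ge0 g a b) //.
  by move=> t tab; exists 0 => //; exact: H.
by move=> t tab; exists 0 => //; exact: H.
Qed.

Lemma left_limit_le0 g a b t : {within `[a, b], continuous g} -> a < t <= b ->
  (forall s, a <= s < t -> exists2 s', s < s' < t & g s' <= 0) -> g t <= 0.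
Proof.
move=> /within_itvP gc tab H; apply/ler_addgt0Pr => e e0.
have [|d d0 Hd] := gc t _ e e0; first by lra.
have [|s] := H (Num.max a (t - d / 2)); first by rewrite le_max lexx gt_max; lra.
rewrite gt_max => /andP[/andP[s1 s2] s3] gs.
have : `|s - t| < d by rewrite distrC gtr0_norm; lra.
move/Hd => /(_ ltac:(lra)); rewrite ltr_distl; lra.
Qed.

Lemma within_continuousW g a b a' b' : {within `[a, b], continuous g} ->
  a <= a' -> b' <= b -> {within `[a', b'], continuous g}.
Proof.
by move=> gc aa bb; apply: continuous_subspaceW gc => x /=; rewrite !in_itv /=; lra.
Qed.

End RightDerivative.

(** * Cuts of a profile at a common level *)

Section Cut.
Context {R : realType} {E : finType}.
Variables (alpha K : R) (C : {set E}) (a y : E -> R).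

(** [y v - S v] is the logarithm of the weight at the top of what is kept of [v]; thus no removed
    pair is heavier than a kept one. *)
Definition cut_of (S : E -> R) : Prop :=
  (forall v, v \in C -> 0 <= S v <= a v) /\
  forall v v', v \in C -> v' \in C -> S v < a v -> 0 < S v' ->
    y v - S v <= y v' - S v'.

Definition full_or_all (S : E -> R) : Prop :=
  total C S = K \/ forall v, v \in C -> S v = a v.

Definition excess (S : E -> R) : R := alpha * value C y S - value C y a.

Lemma total_gt0_ex (S : E -> R) : 0 < total C S -> exists2 v, v \in C & 0 < S v.
Proof.
move=> t0; have [//|nex] := pselect (exists2 v, v \in C & 0 < S v).
move: t0; rewrite ltNge sumr_le0 // => v vC.
by rewrite leNgt; apply/negP => Sv; apply: nex; exists v.
Qed.

(** The level of the cut is the lowest of the tops of the nonempty kept bars. *)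
Lemma cut_level (S : E -> R) : cut_of S -> 0 < total C S ->
  exists m, [/\ m \in C, 0 < S m,
    forall v, v \in C -> 0 < S v -> y m - S m <= y v - S v &
    forall v, v \in C -> S v = above a y (y m - S m) v].
Proof.
move=> [Sa top] /total_gt0_ex[i0 i0C Si0].
have [m /andP[mC Sm] mmin] : exists2 m, (m \in C) && (0 < S m) &
    forall v, (v \in C) && (0 < S v) -> y m - S m <= y v - S v.
  have Pi0 : (i0 \in C) && (0 < S i0) by rewrite i0C Si0.
  case: (@Order.TotalTheory.arg_minP _ _ _ i0 (fun v => (v \in C) && (0 < S v))
    (fun v => y v - S v) Pi0) => m Pm H.
  by exists m.
exists m; split => // [v vC Sv|v vC]; first by apply: mmin; rewrite vC Sv.
have /andP[S0 Sav] := Sa v vC; rewrite /above.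
have a0 := le_trans S0 Sav.
have low : S v < a v -> y v - S v <= y m - S m by move=> ?; exact: top.
have high : 0 < S v -> y m - S m <= y v - S v by move=> ?; apply: mmin; rewrite vC.
have [Sv|Sv] := ltP (S v) (a v); have [Sv0|Sv0] := ltP 0 (S v).
- by have := low Sv; have := high Sv0; case: (clipP (y v - (y m - S m)) a0) => -[? ->]; lra.
- by have := low Sv; case: (clipP (y v - (y m - S m)) a0) => -[? ->]; lra.
- by have := high Sv0; case: (clipP (y v - (y m - S m)) a0) => -[? ->]; lra.
- by case: (clipP (y v - (y m - S m)) a0) => -[? ->]; lra.
Qed.

Lemma above_cut xi : (forall v, 0 <= a v) -> cut_of (above a y xi).
Proof.
move=> a0; split => [v _|v v' _ _]; first by rewrite above_ge0 ?above_le.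
rewrite /above.
by case: (clipP (y v - xi) (a0 v)) => -[? ->]; case: (clipP (y v' - xi) (a0 v')) => -[? ->]; lra.
Qed.

Lemma eq_total (S S' : E -> R) : {in C, S =1 S'} -> total C S = total C S'.
Proof. by move=> H; apply: eq_bigr => v /H. Qed.

Lemma eq_value (S S' : E -> R) : {in C, S =1 S'} -> value C y S = value C y S'.
Proof. by move=> H; apply: eq_bigr => v /H ->. Qed.

Hypotheses (alpha_gt1 : 1 < alpha) (alphaE : alpha = expR (alpha - 2)).
Hypotheses (K_gt0 : 0 < K) (a_ge0 : forall v, 0 <= a v).
Hypothesis adm : admissible alpha K (low_mass C a y) (low_value C a y).

(** [tail_gap] between the top level and the level of the cut, above which the mass is exactly
    [K]. *)
Lemma cut_gap (S : E -> R) : cut_of S -> total C S = K ->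
  exists m, [/\ m \in C, 0 < S m,
    forall v, v \in C -> 0 < S v -> y m - S m <= y v - S v,
    forall v, v \in C -> S v < a v -> y v - S v <= y m - S m &
    3 / 2 * K * expR (y m - S m) <= excess S].
Proof.
move=> cS tS; have [|m [mC Sm mmin lev]] := cut_level cS; first by rewrite tS.
exists m; split => // [v vC Sv|]; first exact: cS.2.
have [x0 [x1 H]] := profile_bounds a y.
have T := low_tail C a_ge0 (fun v => (H v).1).
have [n1 J1] := low_mass_top C a_ge0 (fun v => (H v).2).
have := tail_gap T alpha_gt1 alphaE K_gt0 adm (xi := x1) (eta := y m - S m).
rewrite n1 J1 /low_mass /low_value -(eq_total lev) -(eq_value lev) tS /excess.
by move=> /(_ ltac:(lra)); lra.
Qed.

(** Stated in the form that [tail_excess_mono] takes as hypothesis. The removed pairs are the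
    lightest ones, so they weigh no more than any lower tail whose complement has mass at most
    [K]. *)
Lemma cut_excess (S : E -> R) : cut_of S -> full_or_all S ->
  forall eta, total C a <= low_mass C a y eta + K ->
     (alpha - 1) * value C y a <= alpha * low_value C a y eta + excess S.
Proof.
move=> cS fS eta le; have a1 := alpha_gt1.
have [x0 [x1 H]] := profile_bounds a y.
have T := low_tail C a_ge0 (fun v => (H v).1).
suff : value C y a - value C y S <= low_value C a y eta.
  move/(ler_wpM2l (_ : 0 <= alpha)) => /(_ ltac:(lra)); rewrite /excess; lra.
have [tS|all] := fS; last first.
  by rewrite (eq_value all) subrr; exact: tail_weight_ge0 T _.
have [|m [_ _ _ lev]] := cut_level cS; first by rewrite tS.
rewrite (eq_value lev) -/(low_value _ _ _ _); apply: (tail_weight_le T).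
by rewrite {1}/low_mass -(eq_total lev); lra.
Qed.

Lemma cut_excess_ge0 (S : E -> R) : cut_of S -> full_or_all S -> 0 <= excess S.
Proof.
move=> cS [tS|all].
  have [m [_ _ _ _]] := cut_gap cS tS.
  by apply: le_trans; rewrite !mulr_ge0 ?expR_ge0 // ltW.
rewrite /excess (eq_value all).
have : 0 <= value C y a.
  apply: sumr_ge0 => v _; rewrite mulr_ge0 ?expR_ge0 // subr_ge0 expR_le1.
  by rewrite oppr_le0.
have := alpha_gt1; nra.
Qed.

End Cut.

(** * Continuity in time of [D] and of the loop condition *)

Section ContinuousExcess.
Context {R : realType} {E : finType}.
Implicit Types (g : R -> R) (b : R).

Lemma within_continuous_expR g b : {within `[0, b], continuous g} ->
  {within `[0, b], continuous (fun r => expR (g r))}.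
Proof.
move=> gc x; apply: (@continuous_comp (subspace `[0, b]) R R g expR); first exact: gc.
exact: continuous_expR.
Qed.

Lemma within_continuous_excess (alpha b : R) (C : {set E}) (y : E -> R) (a S : R -> E -> R) :
  (forall v, {within `[0, b], continuous (a ^~ v)}) ->
  (forall v, {within `[0, b], continuous (S ^~ v)}) ->
  {within `[0, b], continuous (fun r => excess alpha C (a r) y (S r))}.
Proof.
have vc (g : R -> E -> R) : (forall v, {within `[0, b], continuous (g ^~ v)}) ->
    {within `[0, b], continuous (fun r => value C y (g r))}.
  move=> gc; apply: within_continuous_sum => v x; apply: cvgM; first exact: cvg_cst.
  apply: cvgB; first exact: cvg_cst.
  by apply: (within_continuous_expR (g := fun r => - g r v)) => z; apply: cvgN; exact: gc.
move=> ac Sc; apply: within_continuousB; last exact: vc.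
by move=> x; apply: cvgM; [exact: cvg_cst | exact: vc].
Qed.

Lemma within_continuous_incr (a : E -> R) (u v : E) b :
  {within `[0, b], continuous (fun r => incr a u r v)}.
Proof.
rewrite /incr; case: eqP => _ x; last exact: cvg_cst.
apply: cvgD; first exact: cvg_cst.
by apply: (continuous_subspaceT (f := id)) => z; exact: cvg_id.
Qed.

Lemma within_continuous_slack (alpha K b : R) (C : {set E}) (a y : E -> R) (u : E)
    (S : R -> E -> R) : (forall v, {within `[0, b], continuous (S ^~ v)}) ->
  {within `[0, b], continuous (fun r =>
     excess alpha C (incr a u r) y (S r) - K * expR (y u - S r u))}.
Proof.
move=> Sc; apply: within_continuousB.
  by apply: within_continuous_excess => // v; exact: within_continuous_incr.
move=> x; apply: cvgM; first exact: cvg_cst.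
apply: (within_continuous_expR (g := fun r => y u - S r u)) => z.
by apply: cvgB; [exact: cvg_cst | exact: Sc].
Qed.

End ContinuousExcess.

(** * An arbitrary solution of the flow during one round *)

Section Flow.
Context {R : realType} {E : finType}.
Variables (alpha K : R) (C : {set E}) (a y : E -> R) (u : E).
Hypotheses (alpha_gt1 : 1 < alpha) (alphaE : alpha = expR (alpha - 2)).
Hypotheses (K_gt0 : 0 < K) (a_ge0 : forall v, 0 <= a v).
Hypotheses (uC : u \in C) (au : a u = 0).
Variables (d : R) (S : R -> E -> R) (rate : R -> E -> R).
Let A t := incr a u t.
Hypotheses (d_ge0 : 0 <= d) (Scont : forall v, {within `[0, d], continuous (S ^~ v)}).
Hypotheses (S_cap : forall t, 0 <= t <= d -> (forall v, 0 <= S t v) /\ total C (S t) <= K).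
Hypotheses (S0cut : cut_of C a y (S 0)) (S0full : full_or_all K C a (S 0)).
Hypothesis adm0 : admissible alpha K (low_mass C a y) (low_value C a y).
Hypothesis rateP : forall t, 0 <= t < d -> (forall v, 0 <= rate t v) /\
  forall v, rate t v != 0 -> [/\ total C (S t) = K, v \in C, 0 < S t v &
    forall v', v' \in C -> 0 < S t v' -> y v - S t v <= y v' - S t v'].
Hypothesis rate_sum : forall t, 0 <= t < d -> \sum_(v in C) rate t v <= 1.
Hypothesis deriv : forall t v, 0 <= t < d ->
  right_derivative (S ^~ v) t ((v == u)%:R - rate t v).
Hypothesis cond : forall t, 0 <= t < d ->
  excess alpha C (A t) y (S t) < K * expR (y u - S t u).

Lemma flow_noninc v s t : v != u -> 0 <= s -> s <= t -> t <= d -> S t v <= S s v.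
Proof.
move=> vu s0 st td; apply: (@right_derivative_le0 _ (S ^~ v) s t) => //.
  exact: within_continuousW (@Scont v) s0 td.
move=> r rst; exists ((v == u)%:R - rate r v); last by apply: (@deriv _ v); lra.
by rewrite (negbTE vu) sub0r oppr_le0; apply: (rateP _).1; lra.
Qed.

Let total_cont s t : 0 <= s -> t <= d ->
  {within `[s, t], continuous (fun r => total C (S r))}.
Proof.
by move=> s0 td; apply: within_continuous_sum => v; exact: (within_continuousW (@Scont v)).
Qed.

Lemma flow_total_mono s t : 0 <= s -> s <= t -> t <= d -> total C (S s) <= total C (S t).
Proof.
move=> s0 st td; apply: (@right_derivative_ge0 _ (fun r => total C (S r)) s t) => //.
  exact: total_cont.
move=> r rst; exists (\sum_(v in C) ((v == u)%:R - rate r v)); last first.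
  by apply: right_derivative_sum => v; apply: (@deriv _ v); lra.
rewrite sumrB (bigD1 u uC) /= eqxx big1 => [|v /andP[_ /negbTE->]] //.
by rewrite addr0 subr_ge0; apply: rate_sum; lra.
Qed.

Lemma flow_rate0 t v : 0 <= t < d -> total C (S t) != K -> rate t v = 0.
Proof. by move=> td tK; apply/eqP/negP => /negP /((rateP td).2 v)[/eqP]; rewrite (negbTE tK). Qed.

Lemma flow_removed_full v t : v != u -> 0 <= t <= d -> S t v < S 0 v -> total C (S t) = K.
Proof.
move=> vu td lt; apply/eqP/negP => /negP tK.
have tK' : total C (S t) < K by rewrite lt_neqAle tK; exact: (S_cap td).2.
suff : S t v = S 0 v by lra.
apply: (@right_derivative_eq0 _ (S ^~ v)); first by lra.
  by apply: (within_continuousW (@Scont v)); lra.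
move=> r rt; have rd : 0 <= r < d by lra.
have := @deriv _ v rd; rewrite (negbTE vu) flow_rate0 ?subrr //.
rewrite lt_eqF //; apply: le_lt_trans tK'; apply: flow_total_mono; lra.
Qed.

Lemma flow_pairwise v v' t : v \in C -> v' \in C -> v != u -> v' != u ->
  0 <= t <= d -> S t v < a v -> 0 < S t v' -> y v - S t v <= y v' - S t v'.
Proof.
move=> vC v'C vu v'u td Sva Sv'.
rewrite leNgt; apply/negP => bad.
(* While [S r v <= sg], the top of [v] is heavier than that of [v'], so [v] is not in T and does not
   move. By the barrier lemma [v] was not shortened at all before [t], and the initial cut already
   contradicts [bad]. *)
pose sg := (S t v + (y v - y v' + S t v')) / 2.
have sg1 : S t v < sg by rewrite /sg; lra.
have sg2 : sg < y v - y v' + S t v' by rewrite /sg; lra.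
have := @right_derivative_barrier _ (S ^~ v) 0 t sg ltac:(lra).
have tc : {within `[0, t], continuous (S ^~ v)}.
  by apply: (within_continuousW (@Scont v)); lra.
move=> /(_ tc); rewrite ge_min [sg <= _]leNgt sg1 orbF.
have hb r : 0 <= r < t -> S r v <= sg -> exists2 l, 0 <= l & right_derivative (S ^~ v) r l.
  move=> rt Sr; have rd : 0 <= r < d by lra.
  exists 0 => //; have := @deriv _ v rd; rewrite (negbTE vu).
  have -> : rate r v = 0; last by rewrite subrr.
  apply/eqP/negP => /negP /((rateP rd).2 v)[_ _ _ /(_ v' v'C)].
  by have := @flow_noninc v' r t v'u ltac:(lra) ltac:(lra) ltac:(lra); lra.
move=> /(_ hb) S0v.
have h1 := flow_noninc v'u (lexx 0) (andP td).1 (andP td).2.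
have h2 := flow_noninc vu (lexx 0) (andP td).1 (andP td).2.
have := S0cut.2 v v' vC v'C ltac:(lra) ltac:(lra); lra.
Qed.

Lemma A0 : A 0 = a.
Proof. by apply/funext => v; rewrite /A /incr addr0 if_same. Qed.

Lemma AE t v : A t v = if v == u then t else a v.
Proof. by rewrite /A /incr; case: eqP => [->|//]; rewrite au add0r. Qed.

(** The facts that support one another; with [flow_pairwise] they say that [S t] is a cut of [A t]
    in which the bar of [u] is whole. *)
Let good t := [/\ round_adm alpha K C a y u t, S t u = t &
  forall v, v \in C -> v != u -> S t v < a v -> y v - S t v <= y u - t].

Let good_cut t : 0 <= t <= d -> good t -> cut_of C (A t) y (S t).
Proof.
move=> td [_ Su rem]; split => [v vC|v v' vC v'C].
  rewrite AE (S_cap td).1 /=; case: eqP => [->|/eqP vu]; first by rewrite Su.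
  apply: le_trans (flow_noninc vu (lexx 0) (andP td).1 (andP td).2) _.
  by case/andP: (S0cut.1 v vC).
rewrite AE; case: (eqVneq v u) => [->|vu]; first by rewrite Su ltxx.
move=> Sva; case: (eqVneq v' u) => [->|v'u] Sv'; first by rewrite Su; exact: rem.
exact: flow_pairwise.
Qed.

Let good_full t : 0 <= t <= d -> S t u = t -> full_or_all K C (A t) (S t).
Proof.
move=> td Su; have [tK|tK] := eqVneq (total C (S t)) K; first by left.
right; have all : forall v, v \in C -> S 0 v = a v.
  case: S0full => // t0.
  have := flow_total_mono (lexx 0) (andP td).1 (andP td).2; rewrite t0.
  by have := (S_cap td).2; move=> h1 h2; rewrite eq_le h1 h2 in tK.
move=> v vC; rewrite AE; case: eqP => [->//|/eqP vu]; rewrite -all //.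
apply/eqP; rewrite eq_le flow_noninc //=; [|lra|lra].
by rewrite leNgt; apply/negP => /(flow_removed_full vu td) e; rewrite e eqxx in tK.
Qed.

Let A_ge0 t v : 0 <= t -> 0 <= A t v.
Proof. exact: incr_ge0. Qed.

(** The loop condition against the lower bound of [cut_gap] puts [u] above the lowest kept top,
    hence above everything removed earlier. *)
Let good0 : 0 < d -> good 0.
Proof.
move=> d0; have Su0 : S 0 u = 0 by have := S0cut.1 u uC; rewrite au; lra.
split => //; first by rewrite /round_adm -/(A 0) A0.
move=> v vC vu Sv; case: S0full => [t0|all]; last by have := all v vC; lra.
have [m [mC Sm mmin rem gap]] := cut_gap alpha_gt1 alphaE K_gt0 a_ge0 adm0 S0cut t0.
have := cond (t := 0) ltac:(lra); rewrite A0 Su0 subr0 => c0.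
have := rem v vC Sv.
have : expR (y m - S 0 m) < expR (y u).
  by rewrite -(ltr_pM2l K_gt0); have := mulr_gt0 K_gt0 (expR_gt0 (y m - S 0 m)); lra.
by rewrite ltr_expR; lra.
Qed.

Let good_extend t : 0 <= t < d -> good t ->
  exists2 t', t < t' <= d & forall s, t <= s <= t' -> good s.
Proof.
move=> td gt; have td' : 0 <= t <= d by lra.
have [adm Su rem] := gt; have t0 : 0 <= t by lra.
have ct := good_cut td' gt; have ft := good_full td' Su.
have ex := cut_excess alpha_gt1 K_gt0 (fun v => A_ge0 v t0) ct ft.
have lt := cond td; rewrite Su in lt.
have [t1 tt1 adm1] := round_adm_extend alpha_gt1 alphaE K_gt0 a_ge0 uC au t0 adm ex lt.
(* The claim comes in two stages: [u] has removal rate 0 for a while, hence [S s u = s]; under this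
   equality the removed tops compare with that of [u]. *)
suff [t2 tt2 H2] : exists2 t2, t < t2 & forall s, t <= s <= t2 -> s < d ->
    rate s u = 0 /\ (S s u = s ->
      forall v, v \in C -> v != u -> S s v < a v -> y v - S s v <= y u - s).
  pose t' := Num.min t1 (Num.min ((t + t2) / 2) ((t + d) / 2)).
  have t'1 : t' <= t1 by rewrite ge_min lexx.
  have t'2 : t' <= (t + t2) / 2 by rewrite !ge_min lexx !orbT.
  have t'd : t' <= (t + d) / 2 by rewrite !ge_min lexx !orbT.
  have tt' : t < t' by rewrite !lt_min; lra.
  have Suid s : t <= s <= t' -> S s u = s.
    move=> ts; apply/eqP; rewrite -subr_eq0; apply/eqP.
    rewrite -[RHS](_ : S t u - t = 0); last by rewrite Su subrr.
    apply: (@right_derivative_eq0 _ (fun r => S r u - r)); first by lra.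
      apply: within_continuousB; first by apply: (within_continuousW (@Scont u)); lra.
      by apply: continuous_subspaceT => x; exact: cvg_id.
    move=> r rt; have := @deriv r u ltac:(lra); rewrite eqxx.
    rewrite (H2 r _ _).1; [|lra|lra].
    rewrite subr0 => h; rewrite -(subrr (1 : R)).
    by apply: right_derivativeD h _; apply: right_derivativeN; exact: right_derivative_id.
  exists t'; first by lra.
  move=> s ts; split; [by apply: adm1; lra | exact: Suid |].
  by apply: (H2 s _ _).2; [lra | lra | exact: Suid].
(* If the class is not full at [t], it is not full shortly after, and nothing is removed. *)
have [tK|tK] := eqVneq (total C (S t)) K; last first.
  clear lt ex tt1 adm1.
  have tK' : total C (S t) < K by rewrite lt_neqAle tK (S_cap td').2.
  have tc := total_cont (lexx 0) (lexx d); move/within_itvP : tc => tc.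
  have [dl dl0 Hdl] := tc t td' (K - total C (S t)) ltac:(lra).
  exists (t + dl / 2); first by lra.
  move=> s ts sd.
  have near r : t <= r <= s -> total C (S r) != K.
    move=> tr; rewrite lt_eqF //; have := Hdl r ltac:(lra).
    by rewrite ger0_norm ?subr_ge0 => [/(_ ltac:(lra))|]; [rewrite ltr_distl|]; lra.
  split; first by apply: flow_rate0; [lra | apply: near; lra].
  move=> _ v vC vu Sva.
  have : S s v = S t v.
    apply: (@right_derivative_eq0 _ (S ^~ v)); first by lra.
      by apply: (within_continuousW (@Scont v)); lra.
    move=> r rt; have := @deriv r v ltac:(lra); rewrite (negbTE vu).
    by rewrite flow_rate0 ?subrr; [|lra|apply: near; lra].
  case: ft => [e|all]; first by rewrite e eqxx in tK.
  by rewrite (all v vC) AE (negbTE vu); lra.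
have [m [mC Sm mmin remm gap]] := cut_gap alpha_gt1 alphaE K_gt0
  (fun v => A_ge0 v t0) adm ct tK.
(* In a full class, the lowest top, that of [m], is strictly below that of [u]. By continuity [m]
   remains present and below [u] for a while: so [u] is not in T, and what is removed weighs no more
   than the top of [m]. *)
have mu : y m - S t m < y u - t.
  rewrite -ltr_expR -(ltr_pM2l K_gt0).
  by have := mulr_gt0 K_gt0 (expR_gt0 (y m - S t m)); lra.
have mneu : m != u by apply/eqP => e; move: mu; rewrite e Su ltxx.
clear lt ex tt1 adm1 gap.
have [d1 d10 H1] := (within_itvP 0 d _).1 (@Scont m) t td' (S t m) Sm.
have gc : {within `[0, d], continuous (fun r => S r u - S r m)}.
  exact: within_continuousB.
have [d2 d20 H2] := (within_itvP 0 d _).1 gc t td' (y u - t - (y m - S t m)) ltac:(lra).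
exists (t + Num.min d1 d2 / 2); first by rewrite ltrDl divr_gt0 // lt_min d10.
move=> s ts sd.
have m1 : Num.min d1 d2 <= d1 by rewrite ge_min lexx.
have m2 : Num.min d1 d2 <= d2 by rewrite ge_min lexx orbT.
have sb : 0 <= s <= d by lra.
have [s1 s2] : s - t < d1 /\ s - t < d2 by split; lra.
have ns : `|s - t| = s - t by rewrite ger0_norm // subr_ge0; case/andP: ts.
have := H1 s sb; rewrite ns ltr_distl => /(_ s1) /andP[]; rewrite subrr => Ssm _.
have := H2 s sb; rewrite ns ltr_distl Su => /(_ s2) h2.
clear H1 H2 s1 s2 d10 d20 m1 m2 ts.
split.
  have sd' : 0 <= s < d by rewrite (andP sb).1.
  by apply/eqP/negP => /negP /((rateP sd').2 u)[_ _ _ /(_ m mC Ssm)]; lra.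
move=> Ss v vC vu Sva; rewrite Ss in h2.
have := flow_pairwise vC mC vu mneu sb Sva Ssm; lra.
Qed.

Lemma flow_good t : 0 < d -> 0 <= t <= d ->
  [/\ round_adm alpha K C a y u t, S t u = t, cut_of C (A t) y (S t) &
      full_or_all K C (A t) (S t)].
Proof.
move=> d0 td; suff gt : good t.
  by have [? ? _] := gt; split => //; [exact: good_cut | exact: good_full].
suff : forall s, 0 <= s <= d -> good s by apply.
(* The predicate covers all instants up to [x], so that holding cofinally below [r] means [good]
   everywhere before [r]. *)
apply: (@real_induction _ (fun x => forall s, 0 <= s <= x -> good s) 0 d) => //.
- by move=> s s0; have -> : s = 0 by [lra]; exact: good0.
- move=> r rd IH; have [t' t'P H] := good_extend rd (IH r ltac:(lra)).
  exists t' => // s st'; have [sr|rs] := leP s r; first by apply: IH; lra.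
  by apply: H; lra.
- move=> r rd IH; have IH' s : 0 <= s < r -> good s.
    by move=> sr; have [s' s'P H] := IH s ltac:(lra); apply: H; lra.
  move=> s sr; have [lt|le] := ltP s r; first by apply: IH'; lra.
  have {le sr}-> : s = r by lra.
  have rd' : 0 <= r <= d by lra.
  have Sr : S r u = r.
    have gc : {within `[0, d], continuous (fun r => S r u - r)}.
      apply: within_continuousB => //.
      by apply: continuous_subspaceT => x; exact: cvg_id.
    have mid x : 0 <= x < r -> exists2 x', x < x' < r & S x' u = x'.
      by move=> xr; exists ((x + r) / 2); [lra | have [] := IH' ((x + r) / 2) ltac:(lra)].
    apply/eqP; rewrite eq_le -subr_le0 -[r <= _]subr_le0 -[r - _]opprB.
    rewrite (@left_limit_le0 _ (fun r => S r u - r) 0 d r gc) //=.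
      rewrite (@left_limit_le0 _ (fun r => - (S r u - r)) 0 d r) //.
        by move=> x; apply: cvgN; exact: gc.
      move=> x xr; have [x' x'P e] := mid x xr; exists x' => //.
      by rewrite e subrr oppr0.
    move=> x xr; have [x' x'P e] := mid x xr; exists x' => //.
    by rewrite e subrr.
  split => //.
    apply: (round_adm_closed alpha_gt1 K_gt0 a_ge0 uC au); first by lra.
    by move=> x xr; exists ((x + r) / 2); [lra | have [] := IH' ((x + r) / 2) ltac:(lra)].
  move=> v vC vu Sva; rewrite -subr_le0.
  have gc : {within `[0, d], continuous (fun r => (y v - y u) + (r - S r v))}.
    apply: within_continuousD.
      by apply: continuous_subspaceT; exact: cst_continuous.
    apply: within_continuousB => //.
    by apply: continuous_subspaceT => x; exact: cvg_id.
  have -> : y v - S r v - (y u - r) = (y v - y u) + (r - S r v) by ring.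
  apply: (@left_limit_le0 _ (fun r => (y v - y u) + (r - S r v)) 0 d r gc) => //.
  move=> x xr.
  (* Shortly before [r] the bar of [v] is already shortened, so the last part of [good] applies
     there and passes to the limit. *)
  have [dl dl0 Hdl] := (within_itvP 0 d _).1 (@Scont v) r rd' (a v - S r v) ltac:(lra).
  pose s' := Num.max ((x + r) / 2) (r - dl / 2).
  have s1 : (x + r) / 2 <= s' by rewrite le_max lexx.
  have s2 : r - dl / 2 <= s' by rewrite le_max lexx orbT.
  have s3 : s' < r by rewrite gt_max; lra.
  exists s'; first by lra.
  have := Hdl s' ltac:(lra); rewrite distrC ger0_norm; last by rewrite subr_ge0; lra.
  move=> /(_ ltac:(lra)); rewrite ltr_distl => h.
  by have [_ _ /(_ v vC vu)] := IH' s' ltac:(lra); lra.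
Qed.

(** The two ends of the round are compared directly. The new pairs have mass [d] and weigh at least
    [expR (y u - d)]; the removed ones have mass at most [d], as the total never decreases, and
    weigh at most the lowest final top [expR X]. The ratio of these weights is at least [3/2], hence
    at least [alpha / (alpha - 1)]. *)
Lemma flow_excess : 0 < d -> excess alpha C a y (S 0) <= excess alpha C (A d) y (S d).
Proof.
move=> d0; have a3 := alpha_gt3 alpha_gt1 alphaE.
have dd : 0 <= d <= d by lra.
have [adm Sd cd fd] := flow_good d0 dd.
have Su0 : S 0 u = 0 by have := S0cut.1 u uC; rewrite au; lra.
have end_cond : excess alpha C (A d) y (S d) <= K * expR (y u - d).
  rewrite -subr_le0.
  have := left_limit_le0 (@within_continuous_slack _ _ alpha K d C a y u S (@Scont)) (t := d).
  rewrite Sd; apply; first by lra.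
  move=> s sd; exists ((s + d) / 2); first by lra.
  by rewrite subr_le0; apply/ltW/cond; lra.
pose w := expR (y u) * (1 - expR (- d)).
have wd : expR (y u - d) * d <= w.
  have /andP[h _] := expR_diff_bounds (ltW d0); rewrite oppr0 expR0 addr0 in h.
  by rewrite expRD -mulrA ler_wpM2l ?expR_ge0.
pose loss := \sum_(v in C | v != u) expR (y v) * (expR (- S d v) - expR (- S 0 v)).
have vA : value C y (A d) = value C y a + w.
  rewrite /value (bigD1 u uC) /= [in RHS](bigD1 u uC) /= au AE eqxx oppr0 expR0.
  rewrite subrr mulr0 add0r addrC; congr (_ + _).
  by apply: eq_bigr => v /andP[_ /negbTE vu]; rewrite AE vu.
have vS : value C y (S d) = value C y (S 0) + w - loss.
  rewrite /value (bigD1 u uC) /= [in RHS](bigD1 u uC) /= Su0 Sd oppr0 expR0.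
  rewrite subrr mulr0 add0r addrC addrAC; congr (_ + _).
  by rewrite -sumrB; apply: eq_bigr => v _; ring.
suff lossP : alpha * loss <= (alpha - 1) * w by rewrite /excess vA vS; lra.
have w0 : 0 <= w.
  by apply: le_trans wd; rewrite mulr_ge0 ?expR_ge0 // ltW.
have [tK|tK] := eqVneq (total C (S d)) K; last first.
  suff -> : loss = 0 by rewrite mulr0 mulr_ge0 //; lra.
  apply: big1 => v /andP[vC vu].
  suff -> : S d v = S 0 v by rewrite subrr mulr0.
  apply/eqP; rewrite eq_le flow_noninc //= leNgt; apply/negP.
  by move=> /(flow_removed_full vu dd) e; rewrite e eqxx in tK.
have [m [mC Sm mmin rem gap]] := cut_gap alpha_gt1 alphaE K_gt0
  (fun v => A_ge0 v d_ge0) adm cd tK.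
set X := y m - S d m in mmin rem gap.
have lossX : loss <= expR X * d.
  apply: (@le_trans _ _ (\sum_(v in C | v != u) expR X * (S 0 v - S d v))).
    apply: ler_sum => v /andP[vC vu]; have ni := flow_noninc vu (lexx 0) d_ge0 (lexx d).
    have [e|ne] := eqVneq (S d v) (S 0 v); first by rewrite e !subrr !mulr0.
    have Sa : S d v < a v.
      apply: lt_le_trans (andP (S0cut.1 v vC)).2.
      by rewrite lt_neqAle ne.
    have /andP[_ h] := expR_diff_bounds ni.
    apply: le_trans (ler_wpM2l (expR_ge0 _) h) _; rewrite mulrA -expRD.
    apply: ler_wpM2r; first by rewrite subr_ge0.
    by rewrite ler_expR; apply: rem => //; rewrite AE (negbTE vu).
  rewrite -mulr_sumr ler_wpM2l ?expR_ge0 // sumrB.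
  have := flow_total_mono (lexx 0) d_ge0 (lexx d).
  by rewrite /total (bigD1 u uC) /= (bigD1 (P := mem C) u uC) /= Su0 Sd; lra.
have eX := expR_gt0 X.
have XU : 3 / 2 * expR X <= expR (y u - d).
  by rewrite -(ler_pM2l K_gt0); lra.
have h1 : alpha * loss <= alpha * (expR X * d) by apply: ler_wpM2l => //; lra.
have h2 : (alpha - 1) * (expR (y u - d) * d) <= (alpha - 1) * w.
  by apply: ler_wpM2l => //; lra.
have h3 : alpha * expR X <= (alpha - 1) * expR (y u - d).
  have h : (alpha - 1) * (3 / 2 * expR X) <= (alpha - 1) * expR (y u - d).
    by apply: ler_wpM2l => //; lra.
  nra.
have := ler_wpM2r d_ge0 h3; lra.
Qed.

End Flow.

(** * Averages over independent choices *)

Section ProductAverage.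
Context {R : realType} {I T : finType}.
Implicit Types (q : I -> T -> R) (w : {ffun I -> T}).

(** Expectation of [F] when the coordinates are independent and the [i]-th one has law [q i]. *)
Definition pavg q (F : {ffun I -> T} -> R) : R :=
  \sum_(w : {ffun I -> T}) (\prod_i q i (w i)) * F w.

Definition upd w (j : I) (o : T) : {ffun I -> T} := [ffun i => if i == j then o else w i].

(** Averaging over coordinate [j] first. The inner sum ignores [w j], so any law [q' j] may be put
    there; the reindexing swaps [w j] with the summation variable [o]. *)
Lemma pavg_upd q q' j F : (forall i, i != j -> q i =1 q' i) -> \sum_o q' j o = 1 ->
  pavg q F = pavg q' (fun w => \sum_o q j o * F (upd w j o)).
Proof.
move=> qq' s1; rewrite /pavg; under [RHS]eq_bigr do rewrite mulr_sumr.
rewrite pair_bigA /=.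
pose h (p : {ffun I -> T} * T) := (upd p.1 j p.2, p.1 j).
have hK : involutive h.
  move=> [w o]; rewrite /h /= ffunE eqxx; congr (_, _).
  by apply/ffunP => i; rewrite !ffunE; case: eqP => [->|].
rewrite (reindex_inj (inv_inj hK)) /=.
rewrite -(pair_bigA _ (fun w o => (\prod_i q' i (upd w j o i)) *
  (q j (w j) * F (upd (upd w j o) j (w j))))) /=.
apply: eq_bigr => w _.
under [RHS]eq_bigr => o _.
  have -> : upd (upd w j o) j (w j) = w.
    by apply/ffunP => i; rewrite !ffunE; case: eqP => [->|].
  rewrite (bigD1 j) //= ffunE eqxx.
  rewrite (eq_bigr (fun i => q i (w i))); last first.
    by move=> i ij; rewrite ffunE (negbTE ij) qq'.
  rewrite -mulrA; over.
by rewrite -mulr_suml s1 mul1r (bigD1 j) //=; ring.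
Qed.

Lemma pavg_cst q (c : R) : (forall i, \sum_o q i o = 1) -> pavg q (fun=> c) = c.
Proof.
move=> s1; rewrite /pavg -mulr_suml -(bigA_distr_bigA q) big1 ?mul1r //.
Qed.

Lemma pavg_le q F G : (forall i o, 0 <= q i o) -> (forall w, F w <= G w) ->
  pavg q F <= pavg q G.
Proof.
by move=> q0 FG; apply: ler_sum => w _; rewrite ler_wpM2l // prodr_ge0.
Qed.

End ProductAverage.

(** * Increments, gains and concavity of [fhat] *)

Section FhatCalculus.
Context {R : realType} {E : finType}.
Implicit Types (f g : {set E} -> R) (B S : E -> R) (u v : E) (X Y : {set E}).

Definition coin S u (b : bool) : R := if b then 1 - expR (- S u) else expR (- S u).

Lemma coin_sum S u : \sum_b coin S u b = 1.
Proof. by rewrite big_bool /= /coin; ring. Qed.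

Lemma fhat_pavg f S : fhat f S = pavg (coin S) (fun w => f [set x | w x]%SET).
Proof.
rewrite /fhat /pavg.
have hb : bijective (fun w : {ffun E -> bool} => [set x | w x]%SET).
  exists (fun X : {set E} => [ffun x => x \in X]) => [w|X].
    by apply/ffunP => x; rewrite ffunE inE.
  by apply/setP => x; rewrite inE ffunE.
rewrite (reindex _ (onW_bij _ hb)); apply: eq_bigr => w _; congr (_ * _).
rewrite [RHS](bigID (fun u => w u)) /=; congr (_ * _).
  by apply: eq_big => [u|u]; rewrite inE // /coin => ->.
by apply: eq_big => [u|u]; rewrite !inE // /coin => /negbTE ->.
Qed.

(** Conditioning on whether [u] belongs to the random set. *)
Lemma fhat_upd f S S' u : (forall v, v != u -> S v = S' v) ->
  fhat f S = expR (- S u) * fhat (fun X => f (X :\ u)%SET) S' +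
             (1 - expR (- S u)) * fhat (fun X => f (u |: X)%SET) S'.
Proof.
move=> SS'; rewrite !fhat_pavg (@pavg_upd _ _ _ _ (coin S') u).
- rewrite /pavg !mulr_sumr -big_split /=; apply: eq_bigr => w _.
  rewrite big_bool /=.
  have -> : [set x | upd w u true x]%SET = (u |: [set x | w x])%SET.
    by apply/setP => x; rewrite !inE ffunE; case: eqP.
  have -> : [set x | upd w u false x]%SET = ([set x | w x] :\ u)%SET.
    by apply/setP => x; rewrite !inE ffunE; case: eqP.
  by rewrite /coin; ring.
- by move=> v vu b; rewrite /coin SS'.
- exact: coin_sum.
Qed.

Lemma fhatB f g S : fhat (fun X => f X - g X) S = fhat f S - fhat g S.
Proof. by rewrite /fhat -sumrB; apply: eq_bigr => X _; ring. Qed.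

Lemma fhatN f S : fhat (fun X => - f X) S = - fhat f S.
Proof. by rewrite /fhat -sumrN; apply: eq_bigr => X _; ring. Qed.

Lemma fhatD f g S : fhat (fun X => f X + g X) S = fhat f S + fhat g S.
Proof. by rewrite /fhat -big_split; apply: eq_bigr => X _ /=; ring. Qed.

Lemma fhat_sum (P : pred E) (F : E -> {set E} -> R) S :
  fhat (fun X => \sum_(o | P o) F o X) S = \sum_(o | P o) fhat (F o) S.
Proof.
rewrite /fhat exchange_big /=; apply: eq_bigr => X _.
by rewrite mulr_sumr.
Qed.

Lemma eq_fhat f g S : f =1 g -> fhat f S = fhat g S.
Proof. by move=> H; apply: eq_bigr => X _; rewrite H. Qed.

Lemma fhat_cst (c : R) S : fhat (fun=> c) S = c.
Proof. by rewrite fhat_pavg pavg_cst // => i; exact: coin_sum. Qed.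

Lemma fhat_le f g S : (forall v, 0 <= S v) -> (forall X, f X <= g X) ->
  fhat f S <= fhat g S.
Proof.
move=> S0 fg; rewrite !fhat_pavg; apply: pavg_le => [u b|w]; last exact: fg.
by rewrite /coin; case: b; rewrite ?expR_ge0 // subr_ge0 expR_le1 oppr_le0.
Qed.

(* Only the sets inside the support of [S] have positive probability. *)
Lemma fhat_support f g S (s : pred E) : (forall v, v \notin s -> S v = 0) ->
  (forall X, {subset X <= s} -> f X = g X) -> fhat f S = fhat g S.
Proof.
move=> S0 fg; apply: eq_bigr => X _.
have [sub|nsub] := pselect {subset X <= s}; first by rewrite fg.
have [v /andP[vX vs]] : exists v, (v \in X) && (v \notin s).
  apply/not_existsP => H; apply: nsub => v vX.
  by apply/negPn/negP => vs; apply: (H v); rewrite vX vs.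
by rewrite (bigD1 v vX) /= S0 // oppr0 expR0 subrr !mul0r.
Qed.

Lemma fhat0 f S : (forall v, S v = 0) -> fhat f S = f finset.set0.
Proof.
move=> S0; rewrite -[RHS](fhat_cst _ S); apply: (@fhat_support _ _ _ pred0) => // X X0.
by congr f; apply/setP => x; rewrite inE; apply/negP => /X0.
Qed.

(** Expected marginal value of [u] over the random set; [fhat_atE] identifies it with the right
    derivative. *)
Definition gain f u B : R := fhat (fun X => f (u |: X)%SET) B - fhat f B.

Lemma fhat_add_congr f u S S' : (forall v, v != u -> S v = S' v) ->
  fhat (fun X => f (u |: X)%SET) S = fhat (fun X => f (u |: X)%SET) S'.
Proof.
move=> SS'; rewrite (fhat_upd _ SS').
rewrite [X in _ * X + _](@eq_fhat _ (fun X => f (u |: X)%SET)); last first.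
  by move=> X; congr f; apply/setP => x; rewrite !inE; case: eqP.
rewrite [X in _ + _ * X](@eq_fhat _ (fun X => f (u |: X)%SET)); last first.
  by move=> X; congr f; apply/setP => x; rewrite !inE; case: eqP.
by ring.
Qed.

Lemma incr_neq B u t v : v != u -> incr B u t v = B v.
Proof. by rewrite /incr => /negbTE->. Qed.

Lemma fhat_incr f B u t : fhat f (incr B u t) - fhat f B = (1 - expR (- t)) * gain f u B.
Proof.
rewrite /gain (@fhat_upd f (incr B u t) B u) => [|v]; last exact: incr_neq.
rewrite (@fhat_upd f B B u) // /incr eqxx opprD expRD; ring.
Qed.

(** With probability [1 - expR (- t)] the additional mass already puts [u] in the random set, and
    nothing more is gained. This is the origin of the exponential weights of a round. *)
Lemma gain_incr f B u t : gain f u (incr B u t) = expR (- t) * gain f u B.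
Proof.
have := fhat_incr f B u t.
rewrite /gain (@fhat_add_congr f u _ B) => [|v]; last exact: incr_neq.
by move=> e; rewrite -[fhat f (incr B u t)](subrK (fhat f B)) e; ring.
Qed.

Lemma fhat_atE f u B : fhat_at f u B = gain f u B.
Proof.
apply/cvg_lim => //.
suff : right_derivative (fun t => fhat f (incr B u t)) 0 (gain f u B).
  have B0 : incr B u 0 = B by apply/funext => v; rewrite /incr addr0 if_same.
  by rewrite /right_derivative B0; under eq_fun do rewrite add0r.
apply/right_derivativeP => e e0.
have G0 : 0 < `|gain f u B| + 1 by have := normr_ge0 (gain f u B); lra.
exists (e / (`|gain f u B| + 1)); first exact: divr_gt0.
move=> h /andP[h0]; rewrite ltr_pdivlMr // add0r => hd.
have -> : incr B u 0 = B by apply/funext => v; rewrite /incr addr0 if_same.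
rewrite fhat_incr (_ : _ - _ = (1 - expR (- h) - h) * gain f u B); last by ring.
rewrite normrM.
have /andP[h1 h2] := expR_diff_bounds (ltW h0).
rewrite oppr0 expR0 addr0 mul1r in h1 h2.
have h3 := ler_wpM2r (ltW h0) (expR_ge1Dx (- h)).
have : `|1 - expR (- h) - h| <= h * h by rewrite ler_norml; lra.
move/(ler_wpM2r (normr_ge0 (gain f u B)))/le_trans; apply.
rewrite -mulrA mulrC; apply: ler_wpM2r; [exact: ltW | nra].
Qed.

(** Raises the coordinates one at a time along an enumeration of [E]. *)
Lemma coordinate_ind (P : (E -> R) -> Prop) B B' : P B ->
  (forall B1 u t, (forall v, B v <= B1 v) -> 0 <= t -> P B1 -> P (incr B1 u t)) ->
  (forall v, B v <= B' v) -> P B'.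
Proof.
move=> PB Pi BB'.
pose mix (s : seq E) v := if v \in s then B' v else B v.
have mixE : mix (enum E) = B' by apply/funext => v; rewrite /mix mem_enum.
rewrite -mixE; elim: (enum E) => [|u s IH]; first exact: PB.
have -> : mix (u :: s) = incr (mix s) u (B' u - mix s u).
  apply/funext => v; rewrite /incr /mix in_cons; case: eqP => [->|//] /=.
  by rewrite addrC subrK.
apply: Pi => // [v|]; rewrite /mix; first by case: ifP.
by rewrite subr_ge0; case: ifP.
Qed.

Lemma fhat_mono f B B' : monotone_setfun f -> (forall v, 0 <= B v) ->
  (forall v, B v <= B' v) -> fhat f B <= fhat f B'.
Proof.
move=> fm B0; apply: (coordinate_ind (P := fun B1 => fhat f B <= fhat f B1)) => //.
move=> B1 u t BB1 t0 /le_trans; apply; rewrite -subr_ge0 fhat_incr mulr_ge0 //.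
  by rewrite subr_ge0 expR_le1 oppr_le0.
rewrite subr_ge0; apply: fhat_le => [v|X]; first exact: le_trans (BB1 v).
by apply: fm; exact: finset.subsetUr.
Qed.

Lemma gain_ge0 f u B : monotone_setfun f -> (forall v, 0 <= B v) -> 0 <= gain f u B.
Proof.
by move=> fm B0; rewrite subr_ge0; apply: fhat_le => // X; apply/fm/finset.subsetUr.
Qed.

Lemma submodular_gain f X Y u : submodular_setfun f -> monotone_setfun f -> X \subset Y ->
  f (u |: Y)%SET - f Y <= f (u |: X)%SET - f X.
Proof.
move=> fs fm XY; have [uY|uY] := boolP (u \in Y).
  have -> : (u |: Y)%SET = Y by apply/finset.setUidPr; rewrite finset.sub1set.
  by rewrite subrr subr_ge0; apply/fm/finset.subsetUr.
have := fs (u |: X)%SET Y.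
have -> : ((u |: X) :|: Y)%SET = (u |: Y)%SET.
  by rewrite -finset.setUA (finset.setUidPr XY).
have -> : ((u |: X) :&: Y)%SET = X.
  apply/setP => x; rewrite !inE; case: eqP => [->|_] /=.
    by rewrite (negbTE uY); apply/esym/negP => /(fintype.subsetP XY); exact/negP.
  by case xX: (x \in X) => //=; exact: (fintype.subsetP XY).
lra.
Qed.

(** By [submodular_gain] the negated marginal value is a monotone set function, so [fhat_mono]
    applies to it. *)
Lemma gain_antitone f u B B' : submodular_setfun f -> monotone_setfun f ->
  (forall v, 0 <= B v) -> (forall v, B v <= B' v) -> gain f u B' <= gain f u B.
Proof.
move=> fs fm B0 BB'; rewrite /gain -!fhatB -lerN2 -!fhatN.
by apply: fhat_mono => // X Y XY; rewrite lerN2; exact: submodular_gain.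
Qed.

(** Raise one coordinate at a time: an increment is [(1 - expR (- t)) * gain], at most [t * gain],
    and gains have only decreased since [B]. *)
Lemma fhat_concave f B p : submodular_setfun f -> monotone_setfun f ->
  (forall v, 0 <= B v) -> (forall v, 0 <= p v) ->
  fhat f (fun v => B v + p v) <= fhat f B + \sum_v p v * gain f v B.
Proof.
move=> fs fm B0 p0.
pose P B1 := fhat f B1 <= fhat f B + \sum_v (B1 v - B v) * gain f v B.
have -> : \sum_v p v * gain f v B = \sum_v (B v + p v - B v) * gain f v B.
  by apply: eq_bigr => v _; congr (_ * _); ring.
rewrite -/(P (fun v => B v + p v)); apply: (@coordinate_ind P B).
- by rewrite /P big1 ?addr0 // => v _; rewrite subrr mul0r.
- move=> B1 u t BB1 t0; rewrite /P => IH.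
  have := fhat_incr f B1 u t; have := gain_antitone u fs fm B0 BB1.
  have := gain_ge0 u fm (fun v => le_trans (B0 v) (BB1 v)).
  rewrite (bigD1 u) //= in IH; rewrite (bigD1 u) //= /incr eqxx.
  rewrite [X in _ + (_ + X)](eq_bigr (fun v => (B1 v - B v) * gain f v B)); last first.
    by move=> v /negbTE->.
  have e1 := expR_ge1Dx (- t); have e2 := expR_gt0 (- t).
  move=> g0 g1 e.
  have : (1 - expR (- t)) * gain f u B1 <= t * gain f u B.
    apply: (@le_trans _ _ (t * gain f u B1)).
      by apply: ler_wpM2r => //; lra.
    exact: ler_wpM2l.
  lra.
- by move=> v; rewrite lerDl.
Qed.

Lemma submodular_le_gains f O X : submodular_setfun f -> monotone_setfun f ->
  f (O :|: X)%SET <= f X + \sum_(o in O) (f (o |: X)%SET - f X).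
Proof.
move=> fs fm.
suff H (s : seq E) : uniq s -> f ([set x in s] :|: X)%SET <=
    f X + \sum_(o <- s) (f (o |: X)%SET - f X).
  have := H (enum O) (enum_uniq _); rewrite big_enum /= => h.
  by apply: le_trans h; rewrite finset.set_enum.
elim: s => [_|o s IH /= /andP[os us]].
  rewrite big_nil addr0; have -> // : ([set x in [::]] :|: X)%SET = X.
  by apply/setP => x; rewrite !inE.
rewrite big_cons.
have -> : ([set x in o :: s] :|: X)%SET = (o |: ([set x in s] :|: X))%SET.
  by apply/setP => x; rewrite !inE orbA.
have sub : X \subset ([set x in s] :|: X)%SET by exact: finset.subsetUr.
have := submodular_gain o fs fm sub; have := IH us; lra.
Qed.

(** [submodular_le_gains] averaged over the random set of [B]. *)
Lemma opt_le_gains f O B : submodular_setfun f -> monotone_setfun f ->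
  (forall v, 0 <= B v) -> f O <= fhat f B + \sum_(o in O) gain f o B.
Proof.
move=> fs fm B0; rewrite -{1}(fhat_cst (f O) B).
under eq_bigr do rewrite /gain -fhatB.
rewrite -fhat_sum -fhatD; apply: fhat_le => // X.
by apply: le_trans (submodular_le_gains O X fs fm); apply/fm/finset.subsetUl.
Qed.

End FhatCalculus.

(** * Sample points against independent coins *)

Section Hits.
Context {R : realType} {E I : finType}.
Implicit Types (f : {set E} -> R) (w : {ffun I -> option E}).

Lemma big_option (F : option E -> R) : \sum_o F o = F None + \sum_u F (Some u).
Proof.
rewrite (bigD1 None) //=; congr (_ + _).
rewrite (reindex_omap (Some : E -> option E) id) => [|[]//].
by apply: eq_bigl => u; rewrite eqxx.
Qed.

Definition hits (r : seq I) w : {set E} :=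
  [set u | has (fun i => w i == Some u) r]%SET.

(* The sample points are replaced one by one by independent coins. *)
Lemma hits_ge f (q : I -> option E -> R) : submodular_setfun f -> monotone_setfun f ->
  (forall i o, 0 <= q i o) -> (forall i, \sum_o q i o = 1) ->
  fhat f (fun u => \sum_i q i (Some u)) <= pavg q (fun w => f (hits (enum I) w)).
Proof.
move=> fs fm q0 q1.
(* Hybrid argument: the points in [r] are actual draws, the others are still coins. [H [::]] has
   coins only, [H (enum I)] draws only. *)
pose B (r : seq I) u := \sum_(i | i \notin r) q i (Some u).
pose H r w := fhat (fun X => f (hits r w :|: X)%SET) (B r).
have B0 r u : 0 <= B r u by apply: sumr_ge0.
suff st r : uniq r -> pavg q (H [::]) <= pavg q (H r).
  have -> : fhat f (fun u => \sum_i q i (Some u)) = pavg q (H [::]).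
    rewrite -[LHS](pavg_cst (q := q)) //; congr pavg; apply/funext => w; rewrite /H.
    have -> : B [::] = fun u => \sum_i q i (Some u) by [].
    by apply: eq_fhat => X; congr f; apply/setP => x; rewrite !inE.
  apply: le_trans (st _ (enum_uniq I)) _; apply: pavg_le => // w; rewrite /H.
  rewrite fhat0 ?finset.setU0 // => v; apply: big1 => i.
  by rewrite mem_enum.
elim: r => [//|j r IH /= /andP[jr ur]].
apply: le_trans (IH ur) _; rewrite [leRHS](@pavg_upd _ _ _ q q j) //.
apply: pavg_le => // w; rewrite big_option.
have hr o : hits r (upd w j o) = hits r w.
  apply/setP => x; rewrite !inE; apply: eq_in_has => i ir; rewrite ffunE.
  by case: (eqVneq i j) => // ij; rewrite ij (negbTE jr) in ir.
have -> : H (j :: r) (upd w j None) = fhat (fun X => f (hits r w :|: X)%SET) (B (j :: r)).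
  apply: eq_fhat => X; congr (f (_ :|: X)%SET).
  by rewrite -(hr None); apply/setP => x; rewrite !inE /= ffunE eqxx.
under eq_bigr => u _.
  have -> : H (j :: r) (upd w j (Some u)) =
      fhat (fun X => f (hits r w :|: (u |: X))%SET) (B (j :: r)).
    apply: eq_fhat => X; congr f; rewrite -(hr (Some u)).
    apply/setP => x; rewrite !inE /= ffunE eqxx (inj_eq Some_inj) eq_sym.
    by rewrite orbCA orbA.
  over.
have BE : B r = fun u => B (j :: r) u + q j (Some u).
  apply/funext => u; rewrite /B (bigD1 j) //= addrC; congr (_ + _).
  by apply: eq_bigl => i; rewrite in_cons negb_or andbC.
pose h X := f (hits r w :|: X)%SET.
have hm : monotone_setfun h by move=> X Y XY; apply: fm; exact: finset.setUS.
have hs : submodular_setfun h.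
  by move=> X Y; rewrite /h finset.setUUr finset.setUIr; exact: fs.
(* Concavity bounds the effect of the coins of point [j] linearly, and this linear bound is exactly
   the expected effect of one draw of that point. *)
have := fhat_concave hs hm (B0 (j :: r)) (fun u => q0 j (Some u)).
rewrite -BE -/(H r w); move/le_trans; apply.
have -> : q j None = 1 - \sum_u q j (Some u) by rewrite -(q1 j) big_option addrK.
rewrite [X in _ + X <= _](eq_bigr _ (fun v _ => mulrBr _ _ _)).
rewrite sumrB -mulr_suml /h; lra.
Qed.

End Hits.

(** * Masses, integrals and removal rates expressed by coordinates *)

Section RegionFormulas.
Context {R : realType} {E : finType} {L : nat}.
Variables (part : E -> 'I_L) (k : 'I_L -> nat).
Implicit Types (S : E -> R) (w : E -> R -> R) (y : E -> R) (l : 'I_L).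

Definition class l : {set E} := [set v | part v == l]%SET.

Lemma xsection_restr S l v :
  xsection (restr part l (region S)) v = if v \in class l then `]0, S v]%classic else set0.
Proof.
apply/seteqP; split => t; rewrite /xsection /= inE /restr /region /= ?inE.
  by case=> h <-; rewrite eqxx /= in_itv.
by case: eqP => // <-; rewrite /= in_itv.
Qed.

Lemma lebesgue_measure_oc (s : R) : 0 <= s -> lebesgue_measure `]0, s]%classic = s%:E.
Proof.
move=> s0; rewrite lebesgue_measure_itv /= lte_fin.
case: ltP => [_|s0']; first by rewrite -EFinD subr0.
have -> : s = 0 by lra.
by [].
Qed.

Lemma mass_restr S l : (forall v, 0 <= S v) ->
  mass (restr part l (region S)) = (total (class l) S)%:E.
Proof.
move=> S0; rewrite /mass /total -sumEFin [RHS]big_mkcond /=; apply: eq_bigr => v _.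
rewrite xsection_restr; case: ifP => _; first exact: lebesgue_measure_oc.
exact: measure0.
Qed.

Lemma Rintegral_expR (b s : R) : 0 <= s ->
  \int[lebesgue_measure]_(t in `]0, s]) expR (b - t) = expR b * (1 - expR (- s)).
Proof.
rewrite le_eqVlt => /predU1P[<-|s0].
  rewrite set_itvoc0 Rintegral_set0 oppr0 expR0 subrr mulr0 //.
have cf : continuous (fun t : R => expR (b - t)).
  move=> t; apply: continuous_comp; last exact: continuous_expR.
  by apply: cvgB; [exact: cvg_cst | exact: cvg_id].
rewrite /Rintegral integral_itv_obnd_cbnd; last first.
  by apply/measurable_EFinP; apply: measurable_funTS; exact: continuous_measurable_fun.
have dF (t : R) : is_derive t 1 (fun t : R => - expR (b - t)) (expR (b - t)).
  have -> : expR (b - t) = - (expR (b - t) * (0 - 1)) by ring.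
  by apply: is_deriveN; apply: (@is_derive1_comp _ expR (fun t => b - t)).
have cF : continuous (fun t : R => - expR (b - t)).
  by move=> t; apply: cvgN; exact: cf.
rewrite (@continuous_FTC2 _ _ (fun t => - expR (b - t))) //.
- by rewrite -EFinD /= subr0 opprK expRD; ring.
- exact: continuous_subspaceT.
- split => //.
  + by apply: cvg_at_right_filter; exact: cF.
  + by apply: cvg_at_left_filter; exact: cF.
- by move=> t _; rewrite derive1E; apply: derive_val.
Qed.

Lemma integ_restr w y S l : (forall v, 0 <= S v) ->
  (forall v t, part v = l -> 0 < t <= S v -> w v t = expR (y v - t)) ->
  integ w (restr part l (region S)) = value (class l) y S.
Proof.
move=> S0 Hw; rewrite /integ /value [RHS]big_mkcond /=; apply: eq_bigr => v _.
rewrite xsection_restr; case: ifPn => [|_]; last exact: Rintegral_set0.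
rewrite inE => /eqP vl; rewrite -Rintegral_expR //; apply: eq_Rintegral => t.
by rewrite inE /= in_itv; exact: Hw.
Qed.

Lemma in_tops w y S l v : (forall v, 0 <= S v) ->
  (forall v t, part v = l -> 0 < t <= S v -> w v t = expR (y v - t)) ->
  v \in tops part w S l <-> [/\ v \in class l, 0 < S v &
    forall v', v' \in class l -> 0 < S v' -> y v - S v <= y v' - S v'].
Proof.
move=> S0 Hw; rewrite !inE; split=> [/andP[vl /asboolP[]]|[/eqP vl Sv H]].
  rewrite /restr /region /= => -[/andP[Sv _] pv] H.
  split => // v'; rewrite inE => /eqP v'l Sv'.
  have := H (v', S v'); rewrite /= Sv' lexx => /(_ (conj isT v'l)).
  by rewrite !Hw ?Sv ?Sv' ?lexx // ler_expR.
rewrite vl eqxx /=; apply/asboolP; split; first by rewrite /restr /region /= Sv lexx.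
move=> [v' t] [/=/andP[t0 tS] v'l].
have Sv' : 0 < S v' by exact: lt_le_trans tS.
have -> : w v (S v) = expR (y v - S v) by apply: Hw; rewrite ?Sv ?lexx.
have -> : w v' t = expR (y v' - t) by apply: Hw; rewrite ?t0.
rewrite ler_expR; have := H v' _ Sv'; rewrite inE v'l eqxx => /(_ isT).
by move: tS => /= tS; lra.
Qed.

Lemma removal_rate_ge0 w S l v : 0 <= removal_rate k part w S l v.
Proof.
rewrite /removal_rate; case: ifP => // _.
by rewrite divr_ge0 ?invr_ge0 ?normr_ge0 ?sumr_ge0 // => x _; rewrite invr_ge0 normr_ge0.
Qed.

Lemma removal_rate_sum w S l : \sum_(v in class l) removal_rate k part w S l v <= 1.
Proof.
rewrite /removal_rate.
have [full|nf] := eqVneq (mass (restr part l (region S))) (k l)%:R%:E; last by rewrite big1.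
rewrite -big_mkcondr /=.
rewrite (eq_bigl (fun v => v \in tops part w S l)) => [|v]; last first.
  by rewrite !inE; case: eqP.
rewrite -mulr_suml; have [->|ne] := eqVneq (\sum_(v in tops part w S l) (eta w S v)^-1) 0.
  by rewrite mul0r.
by rewrite mulfV.
Qed.

Lemma removal_rate_neq0 w S l v : (forall v, 0 <= S v) ->
  removal_rate k part w S l v != 0 ->
  total (class l) S = (k l)%:R /\ v \in tops part w S l.
Proof.
move=> S0; rewrite /removal_rate mass_restr //.
by case: ifP => [/andP[/eqP[->] ->]|]; rewrite ?eqxx.
Qed.

Lemma derive1_expRN (c b : R) : derive1 (fun t => c * expR (- t)) b = - (c * expR (- b)).
Proof.
rewrite derive1E; apply: derive_val.
have -> : - (c * expR (- b)) = c * (expR (- b) * (- 1)) by ring.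
apply: is_deriveZ; apply: (@is_derive1_comp _ expR (fun t => - t)).
Qed.

(* All the elements of T have the same weight at their top. *)
Lemma removal_rateE w y S l v : (forall v, 0 <= S v) ->
  (forall v, part v = l -> 0 < S v -> w v = fun t => expR (y v) * expR (- t)) ->
  total (class l) S = (k l)%:R -> v \in tops part w S l ->
  removal_rate k part w S l v = (#|tops part w S l|%:R)^-1.
Proof.
move=> S0 Hw full vT; rewrite /removal_rate mass_restr // full eqxx vT /=.
have Hw' v1 t : part v1 = l -> 0 < t <= S v1 -> w v1 t = expR (y v1 - t).
  by move=> h /andP[t0 tS]; rewrite Hw ?expRD //; exact: lt_le_trans tS.
have etaE x : x \in tops part w S l -> eta w S x = expR (y v - S v).
  move=> xT; have [vC Sv mv] := (in_tops v S0 Hw').1 vT.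
  have [xC Sx mx] := (in_tops x S0 Hw').1 xT.
  move: (xC); rewrite inE => /eqP xl.
  rewrite /eta Hw // derive1_expRN normrN gtr0_norm ?mulr_gt0 ?expR_gt0 // -expRD.
  by congr expR; apply/eqP; rewrite eq_le mx // mv.
rewrite etaE // (eq_bigr (fun=> (expR (y v - S v))^-1)) => [|x xT]; last by rewrite etaE.
rewrite sumr_const -[X in _ / X]mulr_natr invfM mulrA mulfV ?mul1r // invr_neq0 //.
by rewrite gt_eqF ?expR_gt0.
Qed.

End RegionFormulas.

(** * The invariant kept by the rounds *)

Section Sound.
Context {R : realType} {E : finType} {L : nat}.
Variables (alpha : R) (k : 'I_L -> nat) (part : E -> 'I_L) (f : {set E} -> R).
Hypotheses (alpha_gt1 : 1 < alpha) (alphaE : alpha = expR (alpha - 2)).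
Hypothesis k_gt0 : forall l, (0 < k l)%N.
Hypotheses (f_ge0 : nonneg_setfun f) (f_mono : monotone_setfun f).
Hypothesis f_sub : submodular_setfun f.
Implicit Types (S a y : E -> R) (st : state R E L) (l : 'I_L).

Record class_ok l a y S : Prop := ClassOk {
  class_adm : admissible alpha (k l)%:R (low_mass (class part l) a y)
                (low_value (class part l) a y);
  class_cut : cut_of (class part l) a y S;
  class_full : full_or_all (k l)%:R (class part l) a S;
  class_cap : total (class part l) S <= (k l)%:R }.

(* The level [y v] of an element that never got any mass is irrelevant. *)
Section Congruence.
Variables (l : 'I_L) (a a' y y' S S' : E -> R).
Hypothesis S_ge0 : forall v, v \in class part l -> 0 <= S v <= a v.
Hypothesis agree : forall v, v \in class part l ->
  [/\ a v = a' v, S v = S' v & y v = y' v \/ a v = 0].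

Lemma above_congr xi v : v \in class part l -> above a y xi v = above a' y' xi v.
Proof.
rewrite /above => vC; have [<- _ [<-//|->]] := agree vC.
have clip0 z : clip 0 z = 0 :> R by case: (clipP z (lexx (0 : R))) => -[? ->]; lra.
by rewrite !clip0.
Qed.

Lemma value_congr X X' : (forall v, v \in class part l -> X v = X' v /\ 0 <= X v <= a v) ->
  value (class part l) y X = value (class part l) y' X'.
Proof.
move=> H; apply: eq_bigr => v vC; have [<- X0] := H v vC.
have [_ _ [->//|a0]] := agree vC.
have -> : X v = 0 by lra.
by rewrite oppr0 expR0 subrr !mulr0.
Qed.

Lemma excess_congr :
  excess alpha (class part l) a y S = excess alpha (class part l) a' y' S'.
Proof.
rewrite /excess; congr (_ * _ - _); apply: value_congr => v vC;
  by have [h1 h2 _] := agree vC; have := S_ge0 vC; split => //; lra.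
Qed.

Lemma class_ok_congr : class_ok l a y S -> class_ok l a' y' S'.
Proof.
have S0 := S_ge0; have ag := agree.
have a0 v : v \in class part l -> 0 <= a v by move=> /S0; lra.
have lm xi : low_mass (class part l) a y xi = low_mass (class part l) a' y' xi.
  rewrite !low_massE; apply: eq_bigr => v vC; rewrite (above_congr xi vC).
  by have [-> _ _] := ag v vC.
have lv xi : low_value (class part l) a y xi = low_value (class part l) a' y' xi.
  rewrite /low_value; congr (_ - _); apply: value_congr => v vC.
    by have [-> _ _] := ag v vC; have := a0 v vC; have [-> _ _] := ag v vC; rewrite lexx andbT.
  by rewrite (above_congr xi vC) -(above_congr xi vC) above_ge0 ?above_le ?a0.
have tS : total (class part l) S = total (class part l) S'.
  by apply: eq_bigr => v /ag[].
case=> adm [cS cT] fu cap; split.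
- by move=> xi eta; rewrite -!lm -!lv; exact: adm.
- split=> [v vC|v v' vC v'C]; first by have [<- <- _] := ag v vC; exact: S0.
  have [<- <- yv] := ag v vC; have [e1 <- yv'] := ag v' v'C => lt gt.
  have := cT v v' vC v'C lt gt.
  case: yv => [->|a1]; last by have := S0 v vC; lra.
  by case: yv' => [->//|a1]; have := S0 v' v'C; lra.
- rewrite /full_or_all -tS; case: fu => [->|all]; [by left|right] => v vC.
  by have [<- <- _] := ag v vC; exact: all.
- by rewrite -tS.
Qed.

End Congruence.

(** The exponent [y v] of the weights [expR (y v - t)]. If the weight at 0 vanishes, the element
    received no mass and the value of [ln] there is immaterial. *)
Definition level st v : R := ln (weight st v 0).

(** [sound_charged] says that the loop test fails for every arrived element at any later time too.
    [sound_sub] ranges over all profiles below [ever st], since later removals may produce others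
    than the current one; it holds because each weight was a gain over a larger set. *)
Record sound (s : seq E) st : Prop := Sound {
  sound_cur : forall v, 0 <= cur st v <= ever st v;
  sound_out : forall v, v \notin s -> ever st v = 0;
  sound_weight : forall v, v \in s -> [/\ 0 <= weight st v 0,
    weight st v = fun t => weight st v 0 * expR (- t) &
    0 < ever st v -> 0 < weight st v 0];
  sound_class : forall l, class_ok l (ever st) (level st) (cur st);
  sound_gain : forall v, v \in s -> gain f v (ever st) <= weight st v (ever st v);
  sound_charged : forall v, v \in s ->
    (k (part v))%:R * weight st v (ever st v) <=
    excess alpha (class part (part v)) (ever st) (level st) (cur st);
  sound_ever : fhat f (ever st) = f finset.set0 + value [set: E] (level st) (ever st);
  sound_sub : forall S, (forall v, 0 <= S v <= ever st v) ->
    f finset.set0 + value [set: E] (level st) S <= fhat f S }.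

Lemma sound_nil st : initial st -> sound [::] st.
Proof.
move=> [cur0 ever0].
have z0 y C S : (forall v, S v = 0) -> value C y S = 0.
  by move=> S0; apply: big1 => v _; rewrite S0 oppr0 expR0 subrr mulr0.
have ab xi v : above (ever st) (level st) xi v = 0.
  rewrite /above ever0; case: (clipP (level st v - xi) (lexx 0)) => -[? ->]; lra.
split => //.
- by move=> v; rewrite cur0 ever0 lexx.
- move=> l; split.
  + move=> xi eta _; rewrite /low_value !z0 ?subrr ?mulr0 ?add0r ?mulr_ge0 ?expR_ge0 //.
  + by split => [v _|v v' _ _]; rewrite !cur0 ?ever0 ?lexx ?ltxx.
  + by right => v _; rewrite cur0 ever0.
  + by rewrite /total big1 // => v _.
- by rewrite fhat0 // z0 // addr0.
- move=> S S0; have S0' v : S v = 0 by have := S0 v; rewrite ever0; lra.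
  by rewrite fhat0 // z0 // addr0.
Qed.

Lemma threshold_excess (w : E -> R -> R) l a y S : (forall v, 0 <= S v <= a v) ->
  (forall v, 0 < a v -> w v = fun t => expR (y v) * expR (- t)) ->
  threshold alpha k part w S a l = (k l)%:R^-1 * excess alpha (class part l) a y S.
Proof.
move=> Sa Hw; have a0 v : 0 <= a v by have := Sa v; lra.
have h v t : 0 < a v -> w v t = expR (y v - t) by move=> /Hw ->; rewrite expRD.
rewrite /threshold (@integ_restr _ _ _ _ _ y S); last 2 first.
- by move=> v; have := Sa v; lra.
- by move=> v t _ tS; apply: h; have := Sa v; lra.
rewrite (@integ_restr _ _ _ _ _ y a) //.
by move=> v t _ tS; apply: h; lra.
Qed.

Section Step.
Variables (s : seq E) (u : E) (st st' : state R E L).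
Hypotheses (snd : sound s st) (us : u \notin s).
Hypothesis round : cont_round alpha k part f u st st'.

Let l := part u.
Let w := weight st'.
Let A t := incr (ever st) u t.
Let c := gain f u (ever st).
Let y := level st'.

Let ever_ge0 v : 0 <= ever st v.
Proof. by have := sound_cur snd v; lra. Qed.

Let ever_u : ever st u = 0.
Proof. exact: sound_out snd u us. Qed.

Let c_ge0 : 0 <= c.
Proof. exact: gain_ge0. Qed.

Let wu : w u = fun t => c * expR (- t).
Proof.
apply/funext => t; have [_ [H _]] := round; rewrite /w H eqxx fhat_atE gain_incr.
by rewrite mulrC.
Qed.

Let wv v : v != u -> w v = weight st v.
Proof. by move=> vu; have [_ [H _]] := round; rewrite /w H (negbTE vu). Qed.

Let yv v : v != u -> y v = level st v.
Proof. by move=> vu; rewrite /y /level -/w wv. Qed.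

Let yu : 0 < c -> expR (y u) = c.
Proof. by move=> c0; rewrite /y /level -/w wu oppr0 expR0 mulr1 lnK. Qed.

Let ever_s v : 0 < ever st v -> v \in s /\ v != u.
Proof.
move=> v0; split; last by apply: contraTneq v0 => ->; rewrite ever_u ltxx.
by apply: contraTT v0 => /(sound_out snd) ->; rewrite ltxx.
Qed.

Let wE v : 0 < ever st v -> w v = fun t => expR (y v) * expR (- t).
Proof.
move=> v0; have [vs vu] := ever_s v0; have [_ e /(_ v0) c0] := sound_weight snd vs.
by rewrite (yv vu) (wv vu) {1}e /level lnK.
Qed.

Let wuE : 0 < c -> w u = fun t => expR (y u) * expR (- t).
Proof. by move=> c0; rewrite yu. Qed.

Let old_class l' : class_ok l' (ever st) y (cur st).
Proof.
apply: class_ok_congr (sound_class snd l') => [v _|v _]; first exact: sound_cur snd v.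
split => //; have [->|vu] := eqVneq v u; [by right | left].
by rewrite yv.
Qed.

Let old_excess l' : excess alpha (class part l') (ever st) y (cur st) =
  excess alpha (class part l') (ever st) (level st) (cur st).
Proof.
apply: excess_congr => [v _|v _]; first exact: sound_cur snd v.
split => //; have [->|vu] := eqVneq v u; [by right | left].
by rewrite yv.
Qed.

Let k_gt0R l' : 0 < (k l')%:R :> R.
Proof. by rewrite ltr0n. Qed.

Lemma sound_step : [/\ sound (rcons s u) st', forall v, v != u -> cur st' v <= cur st v &
  cur st' u = ever st' u].
Proof.
have [cu0 [_ [d [S [d0 [S0 [Sd [Ad [Scont [Scap [flow stop]]]]]]]]]]] := round.
have cur_a v := sound_cur snd v.
have Sni v t : v != u -> 0 <= t <= d -> 0 <= S t v <= cur st v.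
  move=> vu td; rewrite (Scap t td).1 /= -S0.
  apply: (@right_derivative_le0 _ (S ^~ v)); first by lra.
    by apply: (within_continuousW (Scont v)); lra.
  move=> r rt; have [_ /(_ v) h] := flow r ltac:(lra).
  eexists; last exact: h.
  by rewrite (negbTE vu) sub0r oppr_le0 removal_rate_ge0.
have Sout v t : v \notin class part l -> 0 <= t <= d -> S t v = cur st v.
  move=> vl td; rewrite -S0.
  apply: (@right_derivative_eq0 _ (S ^~ v)); first by lra.
    by apply: (within_continuousW (Scont v)); lra.
  move=> r rt; have [_ /(_ v)] := flow r ltac:(lra).
  have -> : removal_rate k part (weight st') (S r) (part u) v = 0.
    rewrite /removal_rate /tops !inE; move: vl; rewrite inE => /negbTE ->.
    by rewrite andbF.
  have -> : v == u = false by apply: contraNF vl => /eqP ->; rewrite inE.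
  by rewrite subrr.
have exc0 : 0 <= excess alpha (class part l) (ever st) y (cur st).
  have [adm cut full cap] := old_class l.
  exact: (cut_excess_ge0 alpha_gt1 alphaE (k_gt0R l) ever_ge0 adm cut full).
have th0 : threshold alpha k part w (cur st) (ever st) l =
    (k l)%:R^-1 * excess alpha (class part l) (ever st) y (cur st).
  by apply: threshold_excess => // v v0; exact: wE.
have A0 : A 0 = ever st by apply/funext => v; rewrite /A /incr addr0 if_same.
(* The loop was entered although its threshold is nonnegative; so [c] is positive and [ln c] is its
   true logarithm. *)
have c_gt0 : 0 < d -> 0 < c.
  move=> dgt0; have [h _] := flow 0 ltac:(lra); move: h.
  rewrite -/w -/(A 0) A0 S0 cu0 wu oppr0 expR0 mulr1 th0.
  by apply: le_lt_trans; rewrite mulr_ge0 // invr_ge0 ltW.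
have AE v t : A t v = if v == u then t else ever st v.
  by rewrite /A /incr; case: eqP => [->|//]; rewrite ever_u add0r.
have dA v : 0 <= ever st v <= A d v.
  by rewrite AE ever_ge0; case: eqP => [->|_]; rewrite ?ever_u //=.
have [cls curu chu exinc] : [/\ class_ok l (A d) y (S d), S d u = d,
    (k l)%:R * w u d <= excess alpha (class part l) (A d) y (S d) &
    excess alpha (class part l) (ever st) y (cur st) <=
    excess alpha (class part l) (A d) y (S d)].
  move: stop; rewrite -leNgt -/w -/(A d) => stop.
  (* In an empty round nothing changes, and the failed test is itself the charge of [u]. *)
  have [dz|dneq] := eqVneq d 0.
    rewrite dz A0 S0 cu0; rewrite dz A0 S0 cu0 th0 in stop; split => //.
    by rewrite -ler_pdivlMl.
  have dgt0 : 0 < d by rewrite lt_neqAle eq_sym dneq.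
  have c0 := c_gt0 dgt0.
  have StA t : 0 <= t <= d -> (S t u <= t) -> forall v, 0 <= S t v <= A t v.
    move=> td Stu v; rewrite AE; have [->|vu] := eqVneq v u.
      by rewrite Stu (Scap t td).1.
    by have := Sni v t vu td; have := cur_a v; lra.
  (* This one-sided bound is what expressing the threshold through [excess] requires; the equality
     comes only later, from [flow_good]. *)
  have Stu t : 0 <= t <= d -> S t u <= t.
    move=> td; have h : S 0 u - 0 = 0 by rewrite S0 cu0 subr0.
    rewrite -subr_le0 -h; apply: (@right_derivative_le0 _ (fun r => S r u - r)); first by lra.
      apply: within_continuousB; first by apply: (within_continuousW (Scont u)); lra.
      by apply: continuous_subspaceT => x; exact: cvg_id.
    move=> r rt; have [_ /(_ u)] := flow r ltac:(lra); rewrite eqxx /= => hr.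
    eexists; last first.
      by apply: right_derivativeD hr _; apply: right_derivativeN; exact: right_derivative_id.
    have := @removal_rate_ge0 _ _ _ part k (weight st') (S r) (part u) u; lra.
  have wA t v : 0 < A t v -> w v = fun r => expR (y v) * expR (- r).
    by rewrite AE; case: eqP => [-> _|_]; [exact: wuE | exact: wE].
  have thE t : 0 <= t <= d -> threshold alpha k part w (S t) (A t) l =
      (k l)%:R^-1 * excess alpha (class part l) (A t) y (S t).
    by move=> td; apply: threshold_excess => [v|v]; [exact: StA td (Stu t td) v | exact: wA].
  have wtop t v r : 0 <= t <= d -> part v = l -> 0 < r <= S t v -> w v r = expR (y v - r).
    move=> td _ rS; rewrite (wA t) ?expRD //.
    by have := StA t td (Stu t td) v; lra.
  have [adm cut full cap] := old_class l.
  pose rate t v := removal_rate k part w (S t) l v.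
  have uC : u \in class part l by rewrite inE.
  have totE t : 0 <= t <= d -> (forall v, 0 <= S t v) /\ total (class part l) (S t) <= (k l)%:R.
    move=> td; have [p feas] := Scap t td; split => //.
    by have := feas l; rewrite mass_restr // lee_fin.
  have rateP t : 0 <= t < d -> (forall v, 0 <= rate t v) /\
      forall v, rate t v != 0 -> [/\ total (class part l) (S t) = (k l)%:R,
        v \in class part l, 0 < S t v &
        forall v', v' \in class part l -> 0 < S t v' -> y v - S t v <= y v' - S t v'].
    move=> td; have td' : 0 <= t <= d by lra.
    split => [v|v]; first exact: removal_rate_ge0.
    move=> /(removal_rate_neq0 (totE t td').1)[tot].
    by move=> /(in_tops v (totE t td').1 (fun v r => @wtop t v r td'))[].
  have rsum t : 0 <= t < d -> \sum_(v in class part l) rate t v <= 1.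
    by move=> _; exact: removal_rate_sum.
  have der t v : 0 <= t < d -> right_derivative (S ^~ v) t ((v == u)%:R - rate t v).
    by move=> td; exact: (flow t td).2.
  have cnd t : 0 <= t < d -> excess alpha (class part l) (A t) y (S t) <
      (k l)%:R * expR (y u - S t u).
    move=> td; have [h _] := flow t td; move: h; rewrite -/w -/(A t) thE; last by lra.
    by rewrite wuE // ltr_pdivrMl // expRD.
  rewrite -S0 in cut full.
  have [gadm gSu gcut gfull] := flow_good alpha_gt1 alphaE (k_gt0R l) ever_ge0 uC ever_u
    d0 Scont totE cut full adm rateP rsum der cnd dgt0 (t := d) ltac:(lra).
  have gex := flow_excess alpha_gt1 alphaE (k_gt0R l) ever_ge0 uC ever_u
    d0 Scont totE cut full adm rateP rsum der cnd dgt0.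
  split => //; last by rewrite -S0.
    by split => //; apply: (totE d _).2; lra.
  by move: stop; rewrite thE ?gSu ?ler_pdivlMl //; lra.
have dd : 0 <= d <= d by rewrite d0 lexx.
pose S' := S d.
have S'A v : 0 <= S' v <= A d v.
  rewrite AE /S'; have [->|vu] := eqVneq v u; first by rewrite curu lexx andbT.
  by have := Sni v d vu dd; have := cur_a v; lra.
have wu0 : w u 0 = c by rewrite wu oppr0 expR0 mulr1.
split; last 2 first.
- by move=> v vu; rewrite -Sd; case/andP: (Sni v d vu dd).
- by rewrite -Sd -Ad curu -/(A d) AE eqxx.
have other l' : l' != l -> class_ok l' (ever st) y (cur st) -> class_ok l' (A d) y S' /\
    excess alpha (class part l') (ever st) y (cur st) = excess alpha (class part l') (A d) y S'.
  move=> ll' ok; have nu v : v \in class part l' -> v != u.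
    by move=> vC; apply: contraNneq ll' => vu; move: vC; rewrite vu inE eq_sym.
  have ag v : v \in class part l' -> [/\ ever st v = A d v, cur st v = S' v &
      y v = y v \/ ever st v = 0].
    move=> vC; split; [by rewrite AE (negbTE (nu v vC)) | | by left].
    apply/esym/Sout; last exact: dd.
    by rewrite inE; move: vC; rewrite inE => /eqP ->.
  split; first by apply: class_ok_congr ok => // v _; exact: cur_a.
  by apply: excess_congr => // v _; exact: cur_a.
(* No class loses excess during the round, so the elements charged earlier remain charged. *)
have exmono l' : excess alpha (class part l') (ever st) (level st) (cur st) <=
    excess alpha (class part l') (A d) y S'.
  rewrite -old_excess; have [->|ll'] := eqVneq l' l; first exact: exinc.
  by have [_ ->] := other l' ll' (old_class l').
(* When [d = 0] the level of [u] may be meaningless, but then [X u = 0] and its term vanishes. *)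
have valS X : (forall v, 0 <= X v <= A d v) -> (X u = 0 \/ 0 < d) ->
    value [set: E] y X = value [set: E] (level st) (fun v => if v == u then 0 else X v) +
      c * (1 - expR (- X u)).
  move=> XA Xu; rewrite /value (bigD1 u) ?inE //= [in RHS](bigD1 u) ?inE //= eqxx.
  rewrite oppr0 expR0 subrr mulr0 add0r addrC; congr (_ + _).
    by apply: eq_bigr => v /andP[_ vu]; rewrite (negbTE vu) yv.
  case: Xu => [->|/c_gt0 c0]; last by rewrite yu.
  by rewrite oppr0 expR0 subrr !mulr0.
have du : d = 0 \/ 0 < d.
  by have [->|dn] := eqVneq d 0; [left | right; rewrite lt_neqAle eq_sym dn].
have ever'E : (fun v => if v == u then 0 else A d v) = ever st.
  by apply/funext => v; rewrite AE; case: eqP => // ->; rewrite ever_u.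
have adu : A d u = d by rewrite AE eqxx.
rewrite -/(A d) in Ad.
split; rewrite -?Ad -?Sd -/S' -/y -/w.
- exact: S'A.
- move=> v; rewrite mem_rcons in_cons negb_or => /andP[vu vs].
  by rewrite AE (negbTE vu) (sound_out snd).
- move=> v; rewrite mem_rcons in_cons => /predU1P[->|vs].
    by rewrite wu0 adu.
  have vu : v != u by apply: contraNneq us => <-.
  rewrite (wv vu) AE (negbTE vu); exact: (sound_weight snd vs).
- move=> l'; have [->|ll'] := eqVneq l' l; first exact: cls.
  exact: (other l' ll' (old_class l')).1.
- move=> v; rewrite mem_rcons in_cons => /predU1P[->|vs].
    by rewrite gain_incr adu wu mulrC.
  have vu : v != u by apply: contraNneq us => <-.
  rewrite (wv vu) [X in weight _ _ X]AE (negbTE vu).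
  apply: le_trans (sound_gain snd vs); apply: gain_antitone => // x.
  by case/andP: (dA x).
- move=> v; rewrite mem_rcons in_cons => /predU1P[->|vs]; first by rewrite adu.
  have vu : v != u by apply: contraNneq us => <-.
  rewrite (wv vu) [X in weight _ _ X]AE (negbTE vu).
  exact: le_trans (sound_charged snd vs) (exmono _).
- have := fhat_incr f (ever st) u d; rewrite -/(A d) -/c (sound_ever snd).
  rewrite valS ?ever'E ?adu; last 2 first.
  + by move=> v; have := dA v; lra.
  + by case: du; [left|right].
  lra.
(* The invariant applies to the profile without [u]; as this lies below [ever st], the gain of [u]
   over it is at least [c]. *)
- move=> X XA; pose X0 v := if v == u then 0 else X v.
  have X0e v : 0 <= X0 v <= ever st v.
    by rewrite /X0; have := XA v; rewrite AE; case: eqP => // _ _; rewrite lexx ever_ge0.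
  have XE : X = incr X0 u (X u).
    by apply/funext => v; rewrite /incr /X0; case: eqP => // ->; rewrite add0r.
  have Xu : X u = 0 \/ 0 < d.
    by case: du => [dz|]; [left | right]; have := XA u; rewrite adu; lra.
  rewrite valS // -/X0; have := sound_sub snd X0e.
  have := fhat_incr f X0 u (X u); rewrite -XE.
  have g : c <= gain f u X0.
    by apply: gain_antitone => // v; case/andP: (X0e v).
  have e1 : 0 <= 1 - expR (- X u).
    by rewrite subr_ge0 expR_le1 oppr_le0; have := XA u; lra.
  have := ler_wpM2l e1 g; lra.
Qed.

End Step.
End Sound.

(** * Charging the optimum to the classes *)

Section Charging.
Context {R : realType} {E : finType} {L : nat}.
Variables (alpha : R) (k : 'I_L -> nat) (part : E -> 'I_L) (f : {set E} -> R).
Hypotheses (alpha_gt1 : 1 < alpha) (alphaE : alpha = expR (alpha - 2)).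
Hypothesis k_gt0 : forall l, (0 < k l)%N.
Hypotheses (f_ge0 : nonneg_setfun f) (f_mono : monotone_setfun f).
Hypothesis f_sub : submodular_setfun f.

Lemma value_classes (y S : E -> R) :
  value [set: E] y S = \sum_l value (class part l) y S.
Proof.
rewrite /value (partition_big part xpredT) //=; apply: eq_bigr => l _.
by apply: eq_bigl => v; rewrite !inE.
Qed.

Lemma sound_opt_le (s : seq E) (st : state R E L) (O : {set E}) :
  sound alpha k part f s st -> indep part k O -> {subset O <= s} ->
  f O <= alpha * fhat f (cur st).
Proof.
move=> snd /forallP ind Os; have a1 := alpha_gt1.
have ever0 v : 0 <= ever st v by have := sound_cur snd v; lra.
apply: le_trans (opt_le_gains O f_sub f_mono ever0) _.
pose ex l := excess alpha (class part l) (ever st) (level st) (cur st).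
have ex0 l : 0 <= ex l.
  have [adm cut full cap] := sound_class snd l.
  have K0 : 0 < (k l)%:R :> R by rewrite ltr0n.
  exact: (cut_excess_ge0 alpha_gt1 alphaE K0 ever0 adm cut full).
have charge : \sum_(o in O) gain f o (ever st) <= \sum_l ex l.
  rewrite (partition_big part xpredT) //=; apply: ler_sum => l _.
  have K0 : 0 < (k l)%:R :> R by rewrite ltr0n.
  (* Each element of [O] in the class is charged [ex l / k l], and independence allows at most [k l]
     of them. *)
  apply: (@le_trans _ _ (\sum_(o in O | part o == l) ex l / (k l)%:R)).
    apply: ler_sum => o /andP[oO /eqP ol]; rewrite ler_pdivlMr // mulrC.
    apply: le_trans (_ : (k l)%:R * weight st o (ever st o) <= _).
      by rewrite ler_wpM2l ?ler0n //; exact: (sound_gain snd (Os _ oO)).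
    by have := sound_charged snd (Os _ oO); rewrite ol.
  rewrite sumr_const -[leLHS]mulr_natr mulrAC ler_pdivrMr //.
  apply: ler_wpM2l => //; rewrite ler_nat.
  apply: leq_trans (ind l); rewrite subset_leq_card //.
  by apply/fintype.subsetP => o; rewrite !inE.
have exE : \sum_l ex l = alpha * value [set: E] (level st) (cur st) -
    value [set: E] (level st) (ever st).
  by rewrite !value_classes mulr_sumr -sumrB.
have sub := sound_sub snd (sound_cur snd).
have := ler_wpM2l (_ : 0 <= alpha) sub => /(_ ltac:(lra)).
have : 0 <= (alpha - 1) * f finset.set0 by rewrite mulr_ge0 ?f_ge0 //; lra.
rewrite (sound_ever snd); lra.
Qed.

End Charging.

(** * Positions of the pairs and the elements hit by the sample points *)

Section Held.
Context {R : realType} {E : finType} {L : nat}.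
Variables (k : 'I_L -> nat) (part : E -> 'I_L).
Hypothesis k_gt0 : forall l, (0 < k l)%N.

Record well_assigned (st : state R E L) : Prop := WellAssigned {
  assigned_range : forall z, region (cur st) z ->
    (phi st z).1 = part z.1 /\ 0 < (phi st z).2 <= (k (part z.1))%:R;
  assigned_inj : {in region (cur st) &, injective (phi st)};
  assigned_mass : forall B, B `<=` region (cur st) -> smeasurable B ->
    smeasurable (phi st @` B) /\ mass (phi st @` B) = mass B }.

Variable st : state R E L.
Hypotheses (cur_ge0 : forall v, 0 <= cur st v) (wa : well_assigned st).

Local Notation I := {l : 'I_L & 'I_(k l)}.

(** A held element of the class is hit by one of the [k l] sample points, and injectivity of the
    assignment prevents a point from hitting two elements. *)
Lemma held_indep (z : I -> R) : indep part k (held st z).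
Proof.
apply/forallP => l.
have ex (v : E) : exists i : 'I_(k l), (v \in held st z) && (part v == l) ->
    exists t, region (cur st) (v, t) /\ phi st (v, t) = (l, z (Tagged (fun l => 'I_(k l)) i)).
  have [|nv] := boolP ((v \in held st z) && (part v == l)); last by exists (Ordinal (k_gt0 l)).
  rewrite inE => /andP[/asboolP [t [vt [[l' i] /= e]]] /eqP pv].
  have := (assigned_range wa vt).1; rewrite e /= pv => ll'; subst l'.
  by exists i => _; exists t.
have [g gP] := choice ex.
have inj : {in [set u in held st z | part u == l]%SET &, injective g}.
  move=> v v'; rewrite inE => /gP [t [vt e]]; rewrite inE => /gP [t' [vt' e']] gg.
  have : (v, t) = (v', t') by apply: (assigned_inj wa); rewrite ?inE // e e' gg.
  by case.
rewrite -(card_in_imset inj); apply: leq_trans (max_card _) _.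
by rewrite card_ord.
Qed.

Definition spot (u : E) : set R :=
  [set x | exists t, region (cur st) (u, t) /\ phi st (u, t) = (part u, x)].

Let bar u : set (E * R) := [set z | z.1 = u /\ 0 < z.2 <= cur st u].

Let bar_cur u : bar u `<=` region (cur st).
Proof. by move=> [v t] [/= -> h]. Qed.

Let bar_section u v : xsection (bar u) v = if v == u then `]0, cur st u]%classic else set0.
Proof.
apply/seteqP; split => t; rewrite /xsection /= inE /bar /=.
  by case=> -> h; rewrite eqxx /= in_itv.
by case: eqP => // ->; rewrite /= in_itv.
Qed.

Let bar_meas u : smeasurable (bar u).
Proof. by move=> v; rewrite bar_section; case: ifP. Qed.

Let bar_image u l : xsection (phi st @` bar u) l = if l == part u then spot u else set0.
Proof.
apply/seteqP; split => x; rewrite /xsection /= inE /=.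
  move=> [[v t] [/= -> h] e]; have r : region (cur st) (u, t) by [].
  have := (assigned_range wa r).1; rewrite e /= => ->.
  by rewrite eqxx; exists t; rewrite e -(assigned_range wa r).1 e.
case: eqP => // -> [t [r e]]; exists (u, t) => //.
Qed.

Lemma spot_measurable u : measurable (spot u : set (measurableTypeR R)).
Proof.
have [m _] := assigned_mass wa (@bar_cur u) (@bar_meas u).
by have := m (part u); rewrite bar_image eqxx.
Qed.

Lemma spot_measure u : lebesgue_measure (spot u) = (cur st u)%:E.
Proof.
have [_] := assigned_mass wa (@bar_cur u) (@bar_meas u).
rewrite /mass (bigD1 (part u)) //= big1 => [|l /negbTE lu]; last by rewrite bar_image lu.
rewrite [in RHS](bigD1 u) //= [in RHS]big1 => [|v /negbTE vu]; last by rewrite bar_section vu.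
by rewrite bar_image bar_section !eqxx !adde0 lebesgue_measure_oc.
Qed.

Lemma spot_range u : spot u `<=` [set x | 0 < x <= (k (part u))%:R].
Proof. by move=> x [t [r e]]; have := (assigned_range wa r).2; rewrite e. Qed.

Lemma spot_disjoint u v x : part u = part v -> spot u x -> spot v x -> u = v.
Proof.
move=> uv [t [r e]] [t' [r' e']].
have : (u, t) = (v, t') by apply: (assigned_inj wa); rewrite ?inE // e e' uv.
by case.
Qed.

(* [zone i o]: the positions of the [i]-th sample point that hit the region of
   [u] when [o = Some u], and no region when [o = None]. *)
Definition zone (i : I) (o : option E) : set R :=
  match o with
  | Some u => if part u == tag i then spot u else set0
  | None => ~` \big[setU/set0]_(u : E) (if part u == tag i then spot u else set0)
  end.

Definition hit_prob (i : I) (o : option E) : R :=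
  let p u := if part u == tag i then cur st u / (k (tag i))%:R else 0 in
  match o with Some u => p u | None => 1 - \sum_u p u end.

Lemma zone_measurable i o : measurable (zone i o : set (measurableTypeR R)).
Proof.
have H u : measurable ((if part u == tag i then spot u else set0) : set (measurableTypeR R)).
  by case: ifP => // _; exact: spot_measurable.
case: o => [u|]; first exact: H.
by apply: measurableC; apply: bigsetU_measurable.
Qed.

Lemma zone_cover i x : exists o, zone i o x.
Proof.
have [[u ux]|nu] := pselect (exists u, zone i (Some u) x); first by exists (Some u).
exists None => /=; rewrite -bigcup_seq => -[u _ h]; apply: nu.
by exists u.
Qed.

Lemma zone_inj i o o' x : zone i o x -> zone i o' x -> o = o'.
Proof.
have N u : zone i None x -> zone i (Some u) x -> False.
  rewrite /= -bigcup_seq => h h'; apply: h; exists u => //=.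
  by rewrite mem_index_enum.
case: o => [u|]; case: o' => [v|] //.
- rewrite /=; case: eqP => // pu; case: eqP => // pv h h'; congr Some.
  by apply: spot_disjoint h h'; rewrite pu.
- by move=> h h'; have := N u h' h.
- by move=> h h'; have := N v h h'.
Qed.

Lemma hit_prob_sum i : \sum_o hit_prob i o = 1.
Proof. by rewrite big_option /= subrK. Qed.

(** The class has [k] sample points, each of which hits [u] with probability [cur st u / k]. *)
Lemma hit_prob_total u : \sum_i hit_prob i (Some u) = cur st u.
Proof.
rewrite /hit_prob /=.
rewrite (partition_big (fun i : I => tag i) xpredT) //= (bigD1 (part u)) //=.
rewrite [X in _ + X]big1 ?addr0 => [|l lu]; last first.
  by apply: big1 => i /eqP il; rewrite il eq_sym (negbTE lu).
rewrite (eq_bigr (fun=> cur st u / (k (part u))%:R)) => [|i /eqP ->]; last by rewrite eqxx.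
rewrite sumr_const.
have -> : #|[pred i : I | tag i == part u]| = k (part u).
  pose h (j : 'I_(k (part u))) : I := Tagged (fun l => 'I_(k l)) j.
  have hinj : injective h by move=> j j' /eqP; rewrite -tag_eqE /tag_eq /= eqxx tagged_asE => /eqP.
  rewrite -[RHS]card_ord -(card_imset _ hinj); apply: eq_card => -[l j].
  rewrite inE /=; apply/eqP/imsetP => [lu|[j' _ /(congr1 (fun i : I => tag i)) //]].
  by subst l; exists j.
by rewrite -[LHS]mulr_natr divfK // pnatr_eq0 -lt0n.
Qed.

End Held.

(** * Expectation of the value of the held set *)

Section HeldExpectation.
Context {R : realType} {E : finType} {L : nat}.
Variables (k : 'I_L -> nat) (part : E -> 'I_L) (f : {set E} -> R) (st : state R E L).
Hypotheses (k_gt0 : forall l, (0 < k l)%N) (f_ge0 : nonneg_setfun f).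
Hypotheses (f_mono : monotone_setfun f) (f_sub : submodular_setfun f).
Hypotheses (cur_ge0 : forall v, 0 <= cur st v) (wa : well_assigned k part st).
Hypothesis cur_cap : forall l, total (class part l) (cur st) <= (k l)%:R.
Context {d : measure_display} {T : measurableType d}.
Variables (P : probability T R) (Z : {l : 'I_L & 'I_(k l)} -> {RV P >-> R}).
Hypothesis ZP : uniform_samples Z.

Local Notation I := {l : 'I_L & 'I_(k l)}.
Local Notation zn := (zone (k := k) part st).
Local Notation pr := (hit_prob (k := k) part st).

Let k_gt0R l : 0 < (k l)%:R :> R. Proof. by rewrite ltr0n. Qed.

Lemma hit_prob_ge0 (i : I) o : 0 <= pr i o.
Proof.
case: o => [u|] /=; first by case: ifP => // _; rewrite divr_ge0 ?ler0n.
rewrite subr_ge0 -big_mkcond -mulr_suml ler_pdivrMr // mul1r.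
apply: le_trans (cur_cap (tag i)); rewrite /total le_eqVlt; apply/orP; left; apply/eqP.
by apply: eq_bigl => v; rewrite inE.
Qed.

Lemma integral_partition (O : finType) (G : O -> set T) (g : O -> R) (h : T -> R) :
  (forall o, measurable (G o)) -> (forall x, exists o, G o x) ->
  (forall x o o', G o x -> G o' x -> o = o') -> (forall o, 0 <= g o) ->
  (forall x o, G o x -> h x = g o) ->
  (\int[P]_x (h x)%:E = \sum_o (g o)%:E * P (G o))%E.
Proof.
move=> mG cov disj g0 hg.
have -> : (fun x => (h x)%:E) = (fun x => \sum_o ((g o)%:E * (\1_(G o) x)%:E)%E).
  apply/funext => x; have [p Go] := cov x.
  rewrite (bigD1 p) //= big1 => [|o' oo'].
    by rewrite indicE mem_set // mule1 adde0 (hg x p).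
  rewrite indicE memNset ?mule0 // => Go'.
  by move: oo'; rewrite (disj _ _ _ Go Go') eqxx.
have mI o : measurable_fun setT (fun x => (\1_(G o) x)%:E : \bar R).
  by apply/measurable_EFinP; exact: measurable_indic.
rewrite ge0_integral_sum //.
- apply: eq_bigr => o _; rewrite ge0_integralZl_EFin //.
  by rewrite integral_indic // setIT.
- by move=> o; apply: measurable_funeM; exact: mI.
- by move=> o x _; rewrite mule_ge0 ?lee_fin // indicE ler0n.
Qed.

Let event_measurable (i : I) o : measurable (Z i @^-1` zn i o).
Proof.
apply: measurable_funPTI; exact: (zone_measurable wa).
Qed.

Lemma zone_prob (i : I) o : P (Z i @^-1` zn i o) = (pr i o)%:E.
Proof.
have S u : P (Z i @^-1` zn i (Some u)) = (pr i (Some u))%:E.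
  rewrite /=; case: eqP => [pu|_]; last by rewrite preimage_set0 measure0.
  rewrite ZP.2; last exact: (spot_measurable wa).
  rewrite setIidl; last by rewrite -pu; exact: (spot_range wa).
  by rewrite (spot_measure cur_ge0 wa) -EFinM mulrC.
case: o => [u|]; first exact: S.
(* The zones partition the sample space; integrating the constant 1 makes their probabilities add up
   to 1, which leaves the value for [None]. *)
have := @integral_partition _ (fun o => Z i @^-1` zn i o) (fun=> 1) (fun=> 1)
  (@event_measurable i) (fun x => zone_cover part st i (Z i x)).
move=> /(_ (fun x o o' => @zone_inj _ _ _ k part st wa i o o' (Z i x))).
move=> /(_ (fun=> ler01) (fun _ _ _ => erefl)).
have -> : (\int[P]_x (1%:E : \bar R) = 1)%E.
  by rewrite integral_cst //; rewrite mul1e; exact: probability_setT.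
under eq_bigr do rewrite mul1e.
have -> : forall F : option E -> \bar R, (\sum_o F o = F None + \sum_u F (Some u))%E.
  move=> F; rewrite (bigD1 None) //=; congr (_ + _)%E.
  rewrite (reindex_omap (Some : E -> option E) id) => [|[]//].
  by apply: eq_bigl => u; rewrite eqxx.
rewrite (eq_bigr _ (fun u _ => S u)) sumEFin => e1.
have fin : P (Z i @^-1` zn i None) \is a fin_num.
  by apply: fin_num_measure; exact: event_measurable.
move: e1; rewrite -(fineK fin) -EFinD => -[e1].
by congr EFin; move: e1 => /=; lra.
Qed.

Lemma held_hits x (w : {ffun I -> option E}) : (forall i, zn i (w i) (Z i x)) ->
  held st (fun i => Z i x) = hits (enum {: I}) w.
Proof.
move=> H; apply/setP => u; rewrite !inE; apply/idP/hasP => [/asboolP|].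
  move=> [t [r [i e]]]; exists i; first by rewrite mem_enum.
  have pu : part u = tag i by have := (assigned_range wa r).1; rewrite e.
  apply/eqP; apply: (@zone_inj _ _ _ k part st wa i _ _ (Z i x)) (H i) _.
  by rewrite /= pu eqxx; exists t; rewrite e pu.
move=> [i _ /eqP wi]; apply/asboolP; have := H i; rewrite wi /=.
by case: eqP => // pu [t [r e]]; exists t; split => //; exists i; rewrite e pu.
Qed.

Lemma held_expectation :
  ((fhat f (cur st))%:E <= 'E_P[fun x => f (held st (fun i => Z i x))])%E.
Proof.
(* [G w] is the event that every sample point falls into the zone named by [w]: the held set is
   constant on it, and independence factors its probability. *)
pose G (w : {ffun I -> option E}) : set T := \bigcap_i (Z i @^-1` zn i (w i)).
have PG w : P (G w) = (\prod_i pr i (w i))%:E.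
  rewrite /G ZP.1 => [|i]; last exact: (zone_measurable wa).
  by rewrite -prodEFin; apply: eq_bigr => i _; exact: zone_prob.
have -> : ('E_P[fun x => f (held st (fun i => Z i x))] =
    \sum_w (f (hits (enum {: I}) w))%:E * P (G w))%E.
  rewrite unlock; apply: integral_partition => //.
  - move=> w; rewrite /G; apply: fin_bigcap_measurable => [|i _]; last exact: event_measurable.
    exact: finite_finset.
  - move=> x; have [g gP] := choice (fun i => zone_cover part st i (Z i x)).
    by exists (finfun g) => i _ /=; rewrite ffunE.
  - move=> x w w' Gw Gw'; apply/ffunP => i.
    exact: (@zone_inj _ _ _ k part st wa i _ _ (Z i x)) (Gw i Logic.I) (Gw' i Logic.I).
  - by move=> x w Gw; rewrite (@held_hits x w) // => i; exact: Gw.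
under eq_bigr => w _ do rewrite PG -EFinM mulrC.
rewrite sumEFin lee_fin.
have -> : cur st = fun u => \sum_i pr i (Some u).
  by apply/funext => u; rewrite hit_prob_total.
apply: hits_ge => // [i o|i]; first exact: hit_prob_ge0.
exact: hit_prob_sum.
Qed.

End HeldExpectation.

(** * Invariants along executions *)

Section Executions.
Context {R : realType} {E : finType} {L : nat}.
Variables (alpha : R) (k : 'I_L -> nat) (part : E -> 'I_L) (f : {set E} -> R).
Hypotheses (alpha_gt1 : 1 < alpha) (alphaE : alpha = expR (alpha - 2)).
Hypothesis k_gt0 : forall l, (0 < k l)%N.
Hypotheses (f_ge0 : nonneg_setfun f) (f_mono : monotone_setfun f).
Hypothesis f_sub : submodular_setfun f.
Implicit Types (st : state R E L) (s : seq E) (u : E).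

Lemma well_assigned_nil st : initial st -> well_assigned k part st.
Proof.
move=> [cur0 _]; have r0 : region (cur st) = set0.
  by apply/seteqP; split => // -[v t]; rewrite /region /= cur0; lra.
split; rewrite r0 //; first by move=> x y; rewrite inE.
move=> B B0; have -> : B = set0 by apply/seteqP; split.
move=> _; rewrite image_set0; split.
  by move=> i; rewrite xsection0.
by rewrite /mass !big1 // => i _; rewrite xsection0 measure0.
Qed.

Lemma well_assigned_step s u st st' : sound alpha k part f s st -> u \notin s ->
  step alpha k part f st u st' -> well_assigned k part st'.
Proof.
move=> snd us [rnd [_ rng inj ms]].
have [snd' _ _] := sound_step alpha_gt1 alphaE k_gt0 f_mono f_sub snd us rnd.
split => // -[v t] /= vt; apply: rng; rewrite /region /= in vt *.
by have := sound_cur snd' v; lra.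
Qed.

Lemma execution_invariant s st : uniq s -> execution alpha k part f s st ->
  sound alpha k part f s st /\ well_assigned k part st.
Proof.
move=> us ex; elim: ex us => [st0 init _|s0 u st0 st1 ex IH stp].
  by split; [apply: sound_nil | exact: well_assigned_nil].
rewrite rcons_uniq => /andP[us us0]; have [snd wa] := IH us0.
have [snd' _ _] := sound_step alpha_gt1 alphaE k_gt0 f_mono f_sub snd us stp.1.
by split => //; exact: (well_assigned_step snd us stp).
Qed.

(** Coordinates other than that of [u] only shrink, and surviving pairs keep their points. *)
Lemma held_step s u st st' z : sound alpha k part f s st -> u \notin s ->
  step alpha k part f st u st' -> held st' z \subset (u |: held (k := k) st z)%SET.
Proof.
move=> snd us [rnd [keep _ _ _]].
have [_ le _] := sound_step alpha_gt1 alphaE k_gt0 f_mono f_sub snd us rnd.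
apply/fintype.subsetP => v vh; rewrite in_setU1; case: (eqVneq v u) => //= vu.
move: vh; rewrite /held !inE => -[t [vt [i e]]]; exists t.
have r : region (cur st) (v, t).
  by rewrite /region /= in vt *; have := le v vu; lra.
split => //; exists i; rewrite -e keep //.
by rewrite /region /= in r *; have := sound_cur snd v; lra.
Qed.

Lemma held_competitive s st (O : {set E}) (d : measure_display) (T : measurableType d)
    (P : probability T R) (Z : {l : 'I_L & 'I_(k l)} -> {RV P >-> R}) :
  sound alpha k part f s st -> well_assigned k part st -> is_opt part k f s O ->
  uniform_samples Z ->
  ((alpha^-1 * f O)%:E <= 'E_P[fun x => f (held st (fun i => Z i x))])%E.
Proof.
move=> snd wa [indO Os _] ZP.
have cur0 v : 0 <= cur st v by have := sound_cur snd v; lra.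
apply: le_trans (held_expectation k_gt0 f_ge0 f_mono f_sub cur0 wa _ ZP).
  rewrite lee_fin ler_pdivrMl; last exact: lt_trans alpha_gt1.
  exact: (sound_opt_le alpha_gt1 alphaE k_gt0 f_ge0 f_mono f_sub snd).
by move=> l; exact: class_cap (sound_class snd l).
Qed.

End Executions.

(** * An explicit solution of the flow *)

Section FlowExistence.
Context {R : realType} {E : finType}.
Variables (alpha K : R) (C : {set E}) (a y S0 : E -> R) (u : E).
Hypotheses (alpha_gt1 : 1 < alpha) (alphaE : alpha = expR (alpha - 2)).
Hypotheses (K_gt0 : 0 < K) (a_ge0 : forall v, 0 <= a v).
Hypotheses (uC : u \in C) (au : a u = 0).
Hypotheses (S0cut : cut_of C a y S0) (S0full : full_or_all K C a S0).
Hypotheses (S0cap : total C S0 <= K) (S0out : forall v, 0 <= S0 v).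
Hypothesis adm0 : admissible alpha K (low_mass C a y) (low_value C a y).
Let A t := incr a u t.

Lemma uniform_delta (Q : E -> R -> Prop) :
  (forall v, exists2 d, 0 < d & forall h, 0 < h < d -> Q v h) ->
  exists2 d, 0 < d & forall h, 0 < h < d -> forall v, Q v h.
Proof.
move=> H; have : exists2 d, 0 < d & forall h, 0 < h < d -> forall v, v \in enum E -> Q v h.
  elim: (enum E) => [|v s [d1 d10 IH]]; first by exists 1.
  have [d2 d20 H2] := H v; exists (Num.min d1 d2); first by rewrite lt_min d10.
  move=> h; rewrite lt_min => /andP[h0 /andP[h1 h2]] v'.
  rewrite in_cons => /predU1P[->|]; first by apply: H2; rewrite h0.
  by apply: IH; rewrite h0.
by move=> [d d0 Hd]; exists d => // h hd v; apply: Hd => //; rewrite mem_enum.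
Qed.

(** The mass to cut away is [Num.max (total C b - K) 0]. The nonnegativity of [b] stands under the
    existential so that [choice] yields a level for every [b]. *)
Lemma level_exists (b : E -> R) : exists xi, (forall v, 0 <= b v) ->
  total C (above b y xi) = Num.min (total C b) K.
Proof.
have [b0|nb] := pselect (forall v, 0 <= b v); last by exists 0.
have [x0 [x1 H]] := profile_bounds b y.
have T := low_tail C b0 (fun v => (H v).1).
have [n1 J1] := low_mass_top C b0 (fun v => (H v).2).
have [|xi nxi _] := tail_ivt T (lo := x0) (hi := x1) (r := Num.max (total C b - K) 0).
  rewrite (tail_mass0 T) n1 le_max lexx orbT /= ge_max.
  have : 0 <= total C b by apply: sumr_ge0.
  by have := K_gt0; lra.
exists xi => _; have := nxi; rewrite /low_mass.
by case: (leP (total C b - K) 0); case: (leP (total C b) K); lra.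
Qed.

Let lev := projT1 (choice level_exists).
Let levP b : (forall v, 0 <= b v) -> total C (above b y (lev b)) = Num.min (total C b) K.
Proof. exact: (projT2 (choice level_exists) b). Qed.

(** The solution at time [t] will be [kept (A t)]; the bars outside [C] are frozen. *)
Definition kept (b : E -> R) (v : E) : R := if v \in C then above b y (lev b) v else S0 v.

Let kept_above b : {in C, kept b =1 above b y (lev b)}.
Proof. by move=> v vC; rewrite /kept vC. Qed.

Lemma kept_total b : (forall v, 0 <= b v) -> total C (kept b) = Num.min (total C b) K.
Proof. by move=> b0; rewrite -levP //; apply: eq_total; exact: kept_above. Qed.

Lemma eq_total_le (X Y : E -> R) : (forall v, v \in C -> X v <= Y v) ->
  total C X = total C Y -> forall v, v \in C -> X v = Y v.
Proof.
move=> le e v vC; apply/eqP; rewrite -subr_eq0 -oppr_eq0 opprB; apply/eqP.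
have : \sum_(v in C) (Y v - X v) = 0 by rewrite sumrB -!/(total _ _) e subrr.
by move/psumr_eq0P; apply => // i iC; rewrite subr_ge0 le.
Qed.

(** The level need not be unique, but the truncation is: truncations at two levels are comparable
    bar by bar, and here they have the same total. *)
Lemma kept_unique b xi : (forall v, 0 <= b v) ->
  total C (above b y xi) = Num.min (total C b) K -> forall v, v \in C -> kept b v = above b y xi v.
Proof.
move=> b0 e v vC; rewrite kept_above //.
have ee : total C (above b y xi) = total C (above b y (lev b)) by rewrite e levP.
have [le|lt] := leP xi (lev b).
  by apply: eq_total_le vC => // x xC; have := above_antitone y (b0 x) le; lra.
by apply/esym; apply: eq_total_le vC => // x xC;
   have := above_antitone y (b0 x) (ltW lt); lra.
Qed.

Lemma kept_all b : (forall v, 0 <= b v) -> total C b <= K -> forall v, v \in C -> kept b v = b v.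
Proof.
move=> b0 bK; apply: eq_total_le => [v vC|]; first by rewrite kept_above // above_le.
by rewrite kept_total // min_l.
Qed.

Lemma kept_cut b : (forall v, 0 <= b v) -> cut_of C b y (kept b).
Proof.
move=> b0; have [h1 h2] := above_cut C y (lev b) b0.
split => [v vC|v v' vC v'C]; first by rewrite kept_above //; exact: h1.
by rewrite !kept_above //; exact: h2.
Qed.

Lemma kept_full b : (forall v, 0 <= b v) -> full_or_all K C b (kept b).
Proof.
move=> b0; have [bK|Kb] := leP (total C b) K; first by right; exact: kept_all.
by left; rewrite kept_total // min_r // ltW.
Qed.

Let A_ge0 t v : 0 <= t -> 0 <= A t v. Proof. exact: incr_ge0. Qed.

Let AE t v : A t v = if v == u then t else a v.
Proof. by rewrite /A /incr; case: eqP => [->|//]; rewrite au add0r. Qed.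

Let total_A t : total C (A t) = total C a + t.
Proof.
rewrite /total (bigD1 u uC) /= [in RHS](bigD1 u uC) /= au AE eqxx add0r addrC; congr (_ + _).
by apply: eq_bigr => v /andP[_ /negbTE vu]; rewrite AE vu.
Qed.

Let S t := kept (A t).

Let S_cut t : 0 <= t -> cut_of C (A t) y (S t).
Proof. by move=> t0; apply: kept_cut => v; exact: A_ge0. Qed.

Let S_full t : 0 <= t -> full_or_all K C (A t) (S t).
Proof. by move=> t0; apply: kept_full => v; exact: A_ge0. Qed.

Let S_total t : 0 <= t -> total C (S t) = Num.min (total C a + t) K.
Proof. by move=> t0; rewrite /S kept_total ?total_A // => v; exact: A_ge0. Qed.

Lemma kept_initial : S 0 = S0.
Proof.
apply/funext => v; rewrite /S; have -> : A 0 = a.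
  by apply/funext => x; rewrite /A /incr addr0 if_same.
have [vC|vC] := boolP (v \in C); last by rewrite /kept (negbTE vC).
case: S0full => [full|all]; last first.
  by rewrite kept_all ?all //; rewrite -(eq_total all).
have [|m [_ _ _ lm]] := cut_level S0cut; first by rewrite full.
rewrite lm //; apply: kept_unique => //; rewrite -(eq_total lm) full min_r //.
by rewrite -full; apply: ler_sum => x xC; case/andP: (S0cut.1 x xC).
Qed.

(** If the level does not rise, all bars of [C] grow, by at most the growth [t' - t] of the total.
    If it rises, only [u] can grow, by at most [t' - t], and as the total does not drop, the losses
    of the others are bounded by this. *)
Lemma kept_lipschitz v t t' : 0 <= t -> t <= t' -> `|S t' v - S t v| <= t' - t.
Proof.
move=> t0 tt'; have t'0 := le_trans t0 tt'.
have [vC|vC] := boolP (v \in C); last first.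
  by rewrite /S /kept (negbTE vC) subrr normr0 subr_ge0.
have tot : 0 <= total C (S t') - total C (S t) <= t' - t.
  rewrite !S_total //.
  by case: (leP (total C a + t') K); case: (leP (total C a + t) K); lra.
have dsum : total C (S t') - total C (S t) = \sum_(x in C) (S t' x - S t x).
  by rewrite sumrB.
have up xi x : x \in C -> 0 <= above (A t') y xi x - above (A t) y xi x <= (x == u)%:R * (t' - t).
  move=> xC; rewrite /above !AE; case: eqP => [->|_]; last by rewrite subrr mul0r lexx.
  rewrite mul1r; case: (clipP (y u - xi) t0) => -[? ->];
    case: (clipP (y u - xi) t'0) => -[? ->]; lra.
have [le|lt] := leP (lev (A t')) (lev (A t)).
  have inc x : x \in C -> 0 <= S t' x - S t x.
    move=> xC; rewrite /S !kept_above //.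
    have := up (lev (A t')) x xC.
    by have := above_antitone y (A_ge0 x t0) le; lra.
  rewrite ger0_norm ?inc //; move: tot; rewrite dsum (bigD1 v vC) /=.
  have : 0 <= \sum_(x in C | x != v) (S t' x - S t x).
    by apply: sumr_ge0 => x /andP[xC _]; exact: inc.
  lra.
have dec x : x \in C -> S t' x - S t x <= (x == u)%:R * (t' - t).
  move=> xC; rewrite /S !kept_above //.
  have := up (lev (A t')) x xC.
  by have := above_antitone y (A_ge0 x t0) (ltW lt); lra.
have := dec v vC; move: tot; rewrite dsum (bigD1 v vC) /=.
have rest : \sum_(x in C | x != v) (S t' x - S t x) <= (v != u)%:R * (t' - t).
  apply: (@le_trans _ _ (\sum_(x in C | x != v) (x == u)%:R * (t' - t))).
    by apply: ler_sum => x /andP[xC _]; exact: dec.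
  rewrite -mulr_suml; apply: ler_wpM2r; first by rewrite subr_ge0.
  have [->|vu] := eqVneq v u.
    by rewrite big1 // => x /andP[_ /negbTE ->].
  rewrite (bigD1 u) /=; last by rewrite uC eq_sym.
  by rewrite eqxx big1 ?addr0 // => x /andP[_ /negbTE ->].
rewrite ler_norml; move: rest; case: (eqVneq v u) => _ /=; rewrite ?mul0r ?mul1r; lra.
Qed.

Lemma kept_continuous v b : {within `[0, b], continuous (S ^~ v)}.
Proof.
apply/within_itvP => t tb e e0; exists e => // s sb.
have [st|ts] := leP s t.
  rewrite [X in X < _ -> _]distrC ger0_norm; last by rewrite subr_ge0.
  by apply: le_lt_trans; rewrite distrC; apply: kept_lipschitz; lra.
rewrite ger0_norm; last by rewrite subr_ge0 ltW.
by apply: le_lt_trans; apply: kept_lipschitz; lra.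
Qed.

Let slack t := K * expR (y u - S t u) - excess alpha C (A t) y (S t).

(** If [u] were cut, its top would weigh no more than the lowest kept top, whereas the loop
    condition and [cut_gap] make it heavier. *)
Let slack_u t : 0 <= t -> round_adm alpha K C a y u t -> 0 < slack t -> S t u = t.
Proof.
move=> t0 adm sl; have [tK|all] := S_full t0; last by rewrite all // AE eqxx.
have [m [mC Sm mmin rem gap]] := cut_gap alpha_gt1 alphaE K_gt0
  (fun v => A_ge0 v t0) adm (S_cut t0) tK.
have /andP[_ Su] := (S_cut t0).1 u uC; rewrite AE eqxx in Su.
apply/eqP; rewrite eq_le Su /= leNgt; apply/negP => lt.
have := rem u uC; rewrite AE eqxx => /(_ lt).
rewrite -ler_expR -(ler_pM2l K_gt0).
have := mulr_gt0 K_gt0 (expR_gt0 (y m - S t m)).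
move: sl; rewrite /slack; lra.
Qed.

Lemma kept_adm b : 0 <= b -> (forall t, 0 <= t < b -> 0 < slack t) ->
  round_adm alpha K C a y u b.
Proof.
move=> b0 Hs; apply: (@real_induction _ (round_adm alpha K C a y u) 0 b) => //.
- by rewrite /round_adm; have -> : incr a u 0 = a by apply/funext => x; rewrite /incr addr0 if_same.
- move=> t tb adm; have t0 : 0 <= t by lra.
  have sl := Hs t tb; have Su := slack_u t0 adm sl.
  have ex := cut_excess alpha_gt1 K_gt0 (fun v => A_ge0 v t0) (S_cut t0) (S_full t0).
  have lt : excess alpha C (A t) y (S t) < K * expR (y u - t).
    by move: sl; rewrite /slack Su; lra.
  have [t1 tt1 H] := round_adm_extend alpha_gt1 alphaE K_gt0 a_ge0 uC au t0 adm ex lt.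
  exists (Num.min t1 b); first by rewrite lt_min tt1 ge_min lexx orbT andbT; lra.
  by apply: H; rewrite ge_min lexx le_min (ltW tt1) /=; lra.
- move=> t tb H; apply: (round_adm_closed alpha_gt1 K_gt0 a_ge0 uC au) => //; lra.
Qed.

Definition lowest (X : E -> R) : {set E} :=
  [set v in C | (0 < X v) &&
     [forall (v' | v' \in C), (0 < X v') ==> (y v - X v <= y v' - X v')]]%SET.

Lemma in_lowest X v : v \in lowest X <-> [/\ v \in C, 0 < X v &
  forall v', v' \in C -> 0 < X v' -> y v - X v <= y v' - X v'].
Proof.
rewrite inE; split=> [/and3P[vC Xv /forall_inP H]|[vC Xv H]].
  by split => // v' v'C Xv'; exact: (implyP (H v' v'C)).
by rewrite vC Xv; apply/forall_inP => v' v'C; apply/implyP; exact: H.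
Qed.

Let rate X v := if (total C X == K) && (v \in lowest X) then (#|lowest X|%:R)^-1 else 0 : R.

(** The solution is affine just after [t]: either the class has room and only [u] grows, or the
    level of the cut rises at speed [1 / p], where [p] is the number of elements of T. *)
Lemma kept_deriv t v : 0 <= t -> round_adm alpha K C a y u t -> 0 < slack t ->
  right_derivative (S ^~ v) t ((v == u)%:R - rate (S t) v).
Proof.
move=> t0 adm sl; have Su := slack_u t0 adm sl.
have A0 h : 0 < h -> forall v, 0 <= A (t + h) v.
  by move=> h0 x; apply: A_ge0; lra.
suff [dl dl0 H] : exists2 dl, 0 < dl & forall h, 0 < h < dl -> forall v,
    S (t + h) v = S t v + ((v == u)%:R - rate (S t) v) * h.
  apply/right_derivativeP => e e0; exists dl => // h hd.
  rewrite H // (_ : _ - _ - _ = 0); last by ring.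
  by rewrite normr0 mulr_ge0 ?(ltW e0) //; lra.
have out h x : x \notin C -> S (t + h) x = S t x + ((x == u)%:R - rate (S t) x) * h.
  move=> xC; rewrite /S /kept (negbTE xC).
  have -> : x == u = false by apply: contraNF xC => /eqP ->.
  have -> : rate (S t) x = 0 by rewrite /rate inE (negbTE xC) andbF.
  by rewrite subrr mul0r addr0.
have [Ka|aK] := leP K (total C a + t); last first.
  exists (K - (total C a + t)); first by lra.
  move=> h hd x; have [xC|xC] := boolP (x \in C); last exact: out.
  have -> : rate (S t) x = 0.
    by rewrite /rate S_total // min_l ?(ltW aK) // lt_eqF.
  rewrite /S !kept_all ?total_A //; try lra; last 2 first.
  - by move=> z; exact: A_ge0.
  - by apply: A0; lra.
  rewrite !AE subr0; case: eqP => _; rewrite ?mul1r ?mul0r ?addr0 //.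
have tK : total C (S t) = K by rewrite S_total // min_r.
have [m [mC Sm mmin rem gap]] := cut_gap alpha_gt1 alphaE K_gt0
  (fun v => A_ge0 v t0) adm (S_cut t0) tK.
set X := y m - S t m in mmin rem gap.
have XU : X < y u - t.
  rewrite -ltr_expR -(ltr_pM2l K_gt0); have := mulr_gt0 K_gt0 (expR_gt0 X).
  by move: sl; rewrite /slack Su; lra.
pose T := lowest (S t).
have inT x : x \in T <-> [/\ x \in C, 0 < S t x & y x - S t x = X].
  rewrite in_lowest; split=> [[xC Sx H]|[xC Sx e]]; split => //.
    by apply/eqP; rewrite eq_le mmin // andbT; exact: H.
  by move=> v' v'C Sv'; rewrite e; exact: mmin.
have uT : u \notin T by apply/negP => /inT[_ _]; rewrite Su; lra.
pose p : R := #|T|%:R.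
have p1 : 1 <= p.
  rewrite ler1n; apply/card_gt0P; exists m; apply/inT; split => //.
have p0 : 0 < p by lra.
have rateE x : rate (S t) x = (x \in T)%:R / p.
  by rewrite /rate tK eqxx /= -/T; case: ifP; rewrite ?mul1r ?mul0r.
have St x : x \in C -> [/\ 0 <= S t x, S t x <= A t x & S t x < A t x -> y x - S t x <= X].
  by move=> xC; have /andP[? ?] := (S_cut t0).1 x xC; split => //; exact: rem.
(* One bar cut at the guessed level [X + h / p], for small [h]: [u] stays whole, the bars of T lose
   [h / p], the others do not change. *)
have above_eq x : exists2 dx, 0 < dx & forall h, 0 < h < dx -> x \in C ->
    above (A (t + h)) y (X + h / p) x = S t x + ((x == u)%:R - rate (S t) x) * h.
  have [xC|xC] := boolP (x \in C); last by exists 1.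
  have hp h : 0 < h -> 0 < h / p <= h.
    by move=> h0; rewrite divr_gt0 // ler_pdivrMr // ler_peMr // ltW.
  have [s0 sA sX] := St x xC; rewrite rateE /above.
  have [xu|xu] := eqVneq x u.
    exists ((y u - t - X) / 2); first by lra.
    move=> h hd _; rewrite xu (negbTE uT) mul0r subr0 mul1r AE eqxx Su.
    have := hp h ltac:(lra).
    by case: (@clipP _ (t + h) (y u - (X + h / p)) ltac:(lra)) => -[? ->]; lra.
  have Ax h : A (t + h) x = A t x by rewrite !AE (negbTE xu).
  have [xT|xT] := boolP (x \in T).
    have [_ Sx e] := (inT x).1 xT.
    exists (S t x) => // h hd _; rewrite Ax.
    have -> : (false%:R - true%:R / p) * h = - (h / p) by rewrite /=; ring.
    have := hp h ltac:(lra).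
    by case: (clipP (y x - (X + h / p)) (A_ge0 x t0)) => -[? ->]; lra.
  have [Sx0|Sx] := leP (S t x) 0.
    exists 1 => // h hd _; rewrite Ax mul0r subrr mul0r.
    have := hp h ltac:(lra).
    have [lt|ge] := ltP (S t x) (A t x); first have := sX lt;
    by case: (clipP (y x - (X + h / p)) (A_ge0 x t0)) => -[? ->]; lra.
  have sne : X < y x - S t x.
    rewrite lt_neqAle mmin // andbT; apply/eqP => e.
    by move/negP : xT; apply; apply/inT.
  have sAx : S t x = A t x.
    by apply/eqP; rewrite eq_le sA /= leNgt; apply/negP => /sX; lra.
  exists (y x - S t x - X); first by lra.
  move=> h hd _; rewrite Ax mul0r subrr mul0r.
  have := hp h ltac:(lra).
  by case: (clipP (y x - (X + h / p)) (A_ge0 x t0)) => -[? ->]; lra.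
have [dl dl0 Hd] := uniform_delta above_eq.
exists dl => // h hd x; have [xC|xC] := boolP (x \in C); last exact: out.
have th0 : 0 <= t + h by lra.
(* It remains to check the total of the guess: [u] brings [h], and the [p] bars of T lose [h / p]
   each. *)
rewrite -(Hd h hd x xC); apply: kept_unique xC => [z|]; first exact: A_ge0.
rewrite total_A min_r; last by lra.
rewrite /total (eq_bigr (fun x => S t x + ((x == u)%:R - rate (S t) x) * h)); last first.
  by move=> z zC; exact: Hd.
rewrite big_split /= -/(total _ _) tK -mulr_suml sumrB.
have -> : \sum_(x in C) (x == u)%:R = 1 :> R.
  by rewrite (bigD1 u uC) /= eqxx big1 ?addr0 // => z /andP[_ /negbTE ->].
have -> : \sum_(x in C) rate (S t) x = 1.
  under eq_bigr do rewrite rateE.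
  rewrite -mulr_suml; have -> : \sum_(x in C) (x \in T)%:R = p; last by rewrite divff // gt_eqF.
  rewrite -natr_sum -big_mkcondr sum1_card; congr _%:R; apply: eq_card => z.
  apply/andP/idP => [[]//|zT]; split => //; by have [] := (inT z).1 zT.
by rewrite subrr mul0r addr0.
Qed.

Lemma flow_exists : exists (d : R) (F : R -> E -> R),
  [/\ 0 <= d, F 0 = S0, forall v, {within `[0, d], continuous (F ^~ v)},
    forall t, 0 <= t <= d -> [/\ forall v, 0 <= F t v, total C (F t) <= K,
      forall v, v \in C -> F t v <= incr a u t v & forall v, v \notin C -> F t v = S0 v] &
    (forall t, 0 <= t < d ->
       excess alpha C (incr a u t) y (F t) < K * expR (y u - F t u) /\
       forall v, right_derivative (F ^~ v) t ((v == u)%:R - rate (F t) v)) /\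
    K * expR (y u - F d u) <= excess alpha C (incr a u d) y (F d)].
Proof.
have K1 : 0 <= K + 1 by have := K_gt0; lra.
have sc b : {within `[0, b], continuous slack}.
  have -> : slack = - (fun r => excess alpha C (incr a u r) y (S r) - K * expR (y u - S r u)).
    by apply/funext => r; exact: (esym (opprB _ _)).
  move=> x; apply: cvgN; apply: within_continuous_slack => v; exact: kept_continuous.
have props t : 0 <= t -> [/\ forall v, 0 <= S t v, total C (S t) <= K,
      forall v, v \in C -> S t v <= A t v & forall v, v \notin C -> S t v = S0 v].
  move=> t0; split.
  - move=> v; have [vC|vC] := boolP (v \in C); last by rewrite /S /kept (negbTE vC).
    by case/andP: ((S_cut t0).1 v vC).
  - by rewrite S_total // ge_min lexx orbT.
  - by move=> v vC; case/andP: ((S_cut t0).1 v vC).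
  - by move=> v vC; rewrite /S /kept (negbTE vC).
(* The loop cannot last until [K + 1], when [u] alone would exceed the capacity [K]. *)
have [pos|[d d0b [sd pos]]] := first_failure K1 (sc (K + 1)).
  have adm := kept_adm K1 (fun t tK => pos t ltac:(lra)).
  have Su := slack_u K1 adm (pos (K + 1) ltac:(rewrite K1 lexx //)).
  have [S_ge0 cap _ _] := props (K + 1) K1.
  have : S (K + 1) u <= total C (S (K + 1)).
    by rewrite /total (bigD1 u uC) /= lerDl sumr_ge0.
  by rewrite Su; lra.
exists d, S; split.
- by lra.
- exact: kept_initial.
- by move=> v; exact: kept_continuous.
- by move=> t td; apply: props; lra.
- split; last by move: sd; rewrite /slack -/(A d); lra.
  move=> t td; have st := pos t td; split; first by move: st; rewrite /slack -/(A t); lra.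
  move=> v; apply: kept_deriv => //; first by lra.
  by apply: kept_adm => [|s sd']; [lra | apply: pos; lra].
Qed.

End FlowExistence.

(** * Existence of a round *)

Section RoundExistence.
Context {R : realType} {E : finType} {L : nat}.
Variables (alpha : R) (k : 'I_L -> nat) (part : E -> 'I_L) (f : {set E} -> R).
Hypotheses (alpha_gt1 : 1 < alpha) (alphaE : alpha = expR (alpha - 2)).
Hypothesis k_gt0 : forall l, (0 < k l)%N.
Hypotheses (f_mono : monotone_setfun f) (f_sub : submodular_setfun f).
Variables (s : seq E) (u : E) (st : state R E L).
Hypotheses (snd : sound alpha k part f s st) (us : u \notin s).

Let l := part u.
Let A t := incr (ever st) u t.
Let c := gain f u (ever st).

Definition next_weight v : R -> R :=
  if v == u then fun t => fhat_at f u (incr (ever st) u t) else weight st v.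

Let w := next_weight.
Let y v := if v == u then ln c else level st v.

Let ever_ge0 v : 0 <= ever st v.
Proof. by have := sound_cur snd v; lra. Qed.

Let ever_u : ever st u = 0.
Proof. exact: sound_out snd u us. Qed.

Let c_ge0 : 0 <= c.
Proof. exact: gain_ge0. Qed.

Let wu : w u = fun t => c * expR (- t).
Proof.
by apply/funext => t; rewrite /w /next_weight eqxx fhat_atE gain_incr mulrC.
Qed.

Let wE v : 0 < ever st v -> w v = fun t => expR (y v) * expR (- t).
Proof.
move=> v0; have vu : v != u by apply: contraTneq v0 => ->; rewrite ever_u ltxx.
have vs : v \in s by apply: contraTT v0 => /(sound_out snd) ->; rewrite ltxx.
have [_ e /(_ v0) c0] := sound_weight snd vs.
by rewrite /w /next_weight /y (negbTE vu) {1}e /level lnK.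
Qed.

Let wA t v : 0 < c -> 0 < A t v -> w v = fun r => expR (y v) * expR (- r).
Proof.
move=> c0; rewrite /A /incr; case: eqP => [-> _|_]; last exact: wE.
by rewrite wu /y eqxx lnK.
Qed.

Let old_class l' : class_ok alpha k part l' (ever st) y (cur st).
Proof.
apply: class_ok_congr (sound_class snd l') => [v _|v _]; first exact: sound_cur snd v.
by split => //; rewrite /y; case: eqP => [->|_]; [right | left].
Qed.

Let K0 : 0 < (k l)%:R :> R. Proof. by rewrite ltr0n. Qed.

Lemma round_exists : exists (d : R) (S : R -> E -> R),
  [/\ 0 <= d, S 0 = cur st, forall v, {within `[0, d], continuous (S ^~ v)},
    forall t, 0 <= t <= d -> [/\ forall v, 0 <= S t v, feasible k part (S t) &
      forall v, v \notin rcons s u -> S t v = 0] &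
    (forall t, 0 <= t < d ->
       w u (S t u) > threshold alpha k part w (S t) (A t) l /\
       forall v, right_derivative (S ^~ v) t
         ((v == u)%:R - removal_rate k part w (S t) l v)) /\
    ~~ (w u (S d u) > threshold alpha k part w (S d) (A d) l)].
Proof.
have cur_a v := sound_cur snd v; have [adm cut full cap] := old_class l.
have cur0 v : 0 <= cur st v by have := cur_a v; lra.
have cur_u : cur st u = 0 by have := cur_a u; rewrite ever_u; lra.
have cur_out v : v \notin rcons s u -> cur st v = 0.
  rewrite mem_rcons in_cons negb_or => /andP[_ /(sound_out snd) e].
  by have := cur_a v; rewrite e; lra.
have capped l' : total (class part l') (cur st) <= (k l')%:R.
  exact: class_cap (sound_class snd l').
(* Without a positive gain [ln c] is of no use, but the test fails at once because the threshold is
   nonnegative. *)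
have [c0|cpos] := leP c 0.
  have A0 : A 0 = ever st by apply/funext => v; rewrite /A /incr addr0 if_same.
  exists 0, (fun=> cur st); split => //.
  - by move=> v; apply: continuous_subspaceT; exact: cst_continuous.
  - move=> t _; split => // l'.
    by rewrite mass_restr // lee_fin.
  split; first by move=> t; lra.
  rewrite -leNgt A0 (@threshold_excess _ _ _ _ _ _ _ _ _ y) // cur_u wu.
  rewrite oppr0 expR0 mulr1; apply: le_trans c0 _; rewrite mulr_ge0 ?invr_ge0 ?ler0n //.
  exact: (cut_excess_ge0 alpha_gt1 alphaE K0 ever_ge0 adm cut full).
have uC : u \in class part l by rewrite inE.
have [d [S [d0 S0 Scont props [flow stop]]]] := flow_exists alpha_gt1 alphaE K0 ever_ge0
  uC ever_u cut full cap cur0 adm.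
have SA t : 0 <= t <= d -> forall v, 0 <= S t v <= A t v.
  move=> td v; have [p1 _ p3 p4] := props t td; rewrite p1 /=.
  have [vC|vC] := boolP (v \in class part l); first exact: p3.
  rewrite p4 // /A /incr; case: eqP => [vu|_]; last by have := cur_a v; lra.
  by rewrite vu uC in vC.
have thE t : 0 <= t <= d -> threshold alpha k part w (S t) (A t) l =
    (k l)%:R^-1 * excess alpha (class part l) (A t) y (S t).
  by move=> td; apply: threshold_excess => [v|v]; [exact: SA | exact: wA].
have wuS t : w u (S t u) = expR (y u - S t u).
  by rewrite wu expRD /y eqxx lnK.
exists d, S; split => //.
- move=> t td; have [p1 p2 p3 p4] := props t td; split => //.
    move=> l'; rewrite mass_restr // lee_fin.
    have [->//|ll'] := eqVneq l' l.
    rewrite (_ : total _ _ = total (class part l') (cur st)) //.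
    apply: eq_bigr => v vC; apply: p4; rewrite inE.
    by move: vC; rewrite inE => /eqP ->.
  move=> v vs; have := SA t td v.
  move: vs; rewrite /A /incr mem_rcons in_cons negb_or => /andP[/negbTE -> /(sound_out snd) ->].
  lra.
- split; last first.
    by rewrite -leNgt wuS thE ?ler_pdivlMl //; lra.
  move=> t td; have td' : 0 <= t <= d by lra.
  have [p1 _ _ _] := props t td'; have [ex der] := flow t td; split.
    by rewrite wuS thE // ltr_pdivrMl.
  move=> v; have := der v; set r := (if _ then _ else _).
  suff -> : r = removal_rate k part w (S t) l v by [].
  have wS v1 : part v1 = l -> 0 < S t v1 -> w v1 = fun t => expR (y v1) * expR (- t).
    by move=> _ h; apply: (wA (t := t)) => //; have := SA t td' v1; lra.
  have wS' v1 t1 : part v1 = l -> 0 < t1 <= S t v1 -> w v1 t1 = expR (y v1 - t1).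
    by move=> h h1; rewrite wS ?expRD //; lra.
  have topsE : tops part w (S t) l = lowest (class part l) y (S t).
    apply/setP => x; apply/idP/idP.
      by move=> /(in_tops x p1 wS') h; apply/in_lowest.
    by move=> /in_lowest h; apply/(in_tops x p1 wS').
  rewrite /r -topsE; case: ifPn => [/andP[/eqP tot vT]|].
    by rewrite (removal_rateE p1 wS tot vT).
  by rewrite /removal_rate mass_restr // eqe => /negbTE ->.
Qed.

(** One round serves all instances that agree on the arrived elements, since the coordinates vanish
    on the others. The assignment is left free, to be chosen once the round is known. *)
Lemma cont_round_exists : exists (c' e' : E -> R) (w' : E -> R -> R),
  forall asg (part' : E -> 'I_L) (f' : {set E} -> R),
  {in rcons s u, part =1 part'} ->
  (forall X : {set E}, {subset X <= rcons s u} -> f X = f' X) ->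
  cont_round alpha k part' f' u st (State c' e' w' asg).
Proof.
have [d [S [d0 S0 Scont props [flow stop]]]] := round_exists.
exists (S d), (A d), w => asg part' f' pp ff.
have cur_u : cur st u = 0 by have := sound_cur snd u; rewrite ever_u; lra.
have uin : u \in rcons s u by rewrite mem_rcons mem_head.
have restrE (X : E -> R) l' : (forall v, v \notin rcons s u -> X v = 0) ->
    restr part' l' (region X) = restr part l' (region X).
  move=> X0; apply/seteqP; split => -[v t] []; rewrite /region /= => vt e; split => //=.
    have [vs|vs] := boolP (v \in rcons s u); first by rewrite pp.
    by exfalso; have := X0 v vs; lra.
  have [vs|vs] := boolP (v \in rcons s u); first by rewrite -pp.
  by exfalso; have := X0 v vs; lra.
have A_out t v : v \notin rcons s u -> A t v = 0.
  by rewrite /A /incr mem_rcons in_cons negb_or => /andP[/negbTE -> /(sound_out snd) ->].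
have rateE (X : E -> R) v : (forall v, v \notin rcons s u -> X v = 0) ->
    removal_rate k part' w X l v = removal_rate k part w X l v.
  move=> X0; rewrite /removal_rate restrE //.
  suff -> : tops part' w X l = tops part w X l by [].
  apply/setP => x; rewrite !inE restrE //.
  have [xs|xs] := boolP (x \in rcons s u); first by rewrite pp.
  case: asboolP => [[[h _] _]|_]; rewrite ?andbF //.
  by move: h; rewrite /region /= X0 //; lra.
have thE t (X : E -> R) : (forall v, v \notin rcons s u -> X v = 0) ->
    threshold alpha k part' w X (A t) l = threshold alpha k part w X (A t) l.
  by move=> X0; rewrite /threshold !restrE //; exact: A_out.
have lu : part' u = l by rewrite /l pp.
split => //; split => /=.
  move=> v; rewrite /w /next_weight; case: eqP => // _; apply/funext => t.
  rewrite !fhat_atE /gain.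
  have fh (g g' : {set E} -> R) : (forall X : {set E}, {subset X <= rcons s u} -> g X = g' X) ->
      fhat g (A t) = fhat g' (A t).
    move=> gg; apply: (@fhat_support _ _ _ _ _ [pred x | x \in rcons s u]) => [v' h|Y Ys].
      by apply: A_out; move: h; rewrite inE.
    by apply: gg => x /Ys; rewrite inE.
  rewrite -/(A t) (fh f f') // (fh (fun X => f (u |: X)%SET) (fun X => f' (u |: X)%SET)) //.
  by move=> X Xs; apply: ff => x; rewrite in_setU1 => /predU1P[->//|]; exact: Xs.
rewrite lu; exists d, S.
have out t : 0 <= t <= d -> forall v, v \notin rcons s u -> S t v = 0.
  by move=> td; have [] := props t td.
have flow' t : 0 <= t < d -> w u (S t u) > threshold alpha k part' w (S t) (A t) l /\
    forall v, right_derivative (S ^~ v) t ((v == u)%:R - removal_rate k part' w (S t) l v).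
  move=> td; have o := out t ltac:(lra); have [h1 h2] := flow t td.
  by rewrite thE //; split => // v; rewrite rateE.
do 5!(split; first by []); split.
  by move=> t td; have [p1 p2 p3] := props t td; split => // l'; rewrite restrE.
by split; [exact: flow' | rewrite thE //; apply: out; lra].
Qed.

End RoundExistence.

(** * Finite unions of half-open intervals *)

Section Steplike.
Context {R : realType}.
Implicit Types (F G : set R).

(* Finite unions of intervals of the form [`]a, b]], [`]-oo, b]] or [`]a, +oo[]. *)
Definition steplike F : Prop := exists bs : seq R, forall x z,
  (forall b, b \in bs -> (b < x) = (b < z)) -> F x -> F z.

Lemma steplike_set0 : steplike set0.
Proof. by exists [::]. Qed.

Lemma steplike_le (b : R) : steplike [set x | x <= b].
Proof.
by exists [:: b] => x z /(_ b); rewrite inE eqxx /= => /(_ isT) e; rewrite !leNgt e.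
Qed.

Lemma steplikeC F : steplike F -> steplike (~` F).
Proof.
move=> [bs H]; exists bs => x z e nF Fz; apply: nF; apply: H Fz => b bb.
by rewrite e.
Qed.

Lemma steplikeI F G : steplike F -> steplike G -> steplike (F `&` G).
Proof.
move=> [bs H] [cs H']; exists (bs ++ cs) => x z e [Fx Gx]; split.
  by apply: H Fx => b bb; apply: e; rewrite mem_cat bb.
by apply: H' Gx => b bb; apply: e; rewrite mem_cat bb orbT.
Qed.

Lemma steplike_bigcup (I : finType) (F : I -> set R) :
  (forall i, steplike (F i)) -> steplike (\bigcup_i F i).
Proof.
move=> H; have [bs Hbs] := choice H.
exists (flatten [seq bs i | i <- enum I]) => x z e [i _ Fx]; exists i => //.
apply: Hbs Fx => b bb; apply: e; apply/flatten_mapP; exists i => //.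
by rewrite mem_enum.
Qed.

(** There are finitely many patterns of comparison with the breakpoints, and [F] is the union of the
    atoms that it contains. *)
Lemma steplike_measurable F : steplike F -> measurable (F : set (measurableTypeR R)).
Proof.
move=> [bs H].
pose atom (w : {ffun 'I_(size bs) -> bool}) : set R :=
  \bigcap_(i in [set: 'I_(size bs)]) [set x | (nth 0 bs i < x) = w i].
have mh (b : R) (e : bool) : measurable ([set x | (b < x) = e] : set (measurableTypeR R)).
  case: e.
    rewrite (_ : [set x | _] = `]b, +oo[%classic) //.
    by apply/seteqP; split => x /=; rewrite in_itv /= andbT.
  rewrite (_ : [set x | _] = `]-oo, b]%classic) //.
  by apply/seteqP; split => x /=; rewrite in_itv /= leNgt; [move=> -> | move/negbTE].
have ma w : measurable (atom w : set (measurableTypeR R)).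
  by apply: fin_bigcap_measurable => // i _; exact: mh.
rewrite (_ : F = \bigcup_(w in [set w | atom w `<=` F]) atom w); last first.
  apply/seteqP; split => [x Fx|x [w wF wx]]; last exact: wF.
  exists [ffun i => nth 0 bs (nat_of_ord i) < x] => /= [z Hz|i _ /=]; last by rewrite ffunE.
  apply: H Fx => b bb; have := Hz (Ordinal (etrans (index_mem b bs) bb)) Logic.I.
  by rewrite /= ffunE /= nth_index.
apply: fin_bigcup_measurable => // w _; exact: ma.
Qed.

(** A comparison [b < x] does not change when [x] moves slightly to the left. *)
Lemma steplike_left F x : steplike F ->
  exists2 e, 0 < e & forall z, x - e < z <= x -> (F z <-> F x).
Proof.
move=> [bs H].
have [e e0 He] : exists2 e, 0 < e & forall b, b \in bs -> b < x -> b <= x - e.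
  elim: bs {H} => [|b bs [e e0 IH]]; first by exists 1.
  have [bx|xb] := ltP b x; last first.
    exists e => // b'; rewrite in_cons => /predU1P[->|]; last exact: IH.
    by move=> h; have := lt_le_trans h xb; rewrite ltxx.
  exists (Num.min e (x - b)); first by rewrite lt_min e0 subr_gt0.
  have m1 : Num.min e (x - b) <= e by rewrite ge_min lexx.
  have m2 : Num.min e (x - b) <= x - b by rewrite ge_min lexx orbT.
  move=> b'; rewrite in_cons => /predU1P[->|h h']; first by lra.
  by have := IH b' h h'; lra.
exists e => // z xz.
have e' b : b \in bs -> (b < z) = (b < x).
  move=> bb; apply/idP/idP => h; first by lra.
  by have := He b bb h; lra.
by split; apply: H => b bb; rewrite e'.
Qed.

End Steplike.

(** * A length-preserving parametrisation of such a set *)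

Section Filling.
Context {R : realType}.
Variables (F : set R) (K : R).
Hypotheses (sF : steplike F) (F_sub : F `<=` `]0, K]%classic) (K_ge0 : 0 <= K).

Local Notation lambda := (@lebesgue_measure R).

Let mF : measurable (F : set (measurableTypeR R)). Proof. exact: steplike_measurable. Qed.

Let finF (X : set R) : measurable (X : set (measurableTypeR R)) ->
  lambda (F `&` X) \is a fin_num.
Proof.
move=> mX; rewrite ge0_fin_numE; last exact: measure_ge0.
apply: (@le_lt_trans _ _ (lambda `]0, K]%classic)); last first.
  by rewrite lebesgue_measure_oc // ltry.
apply: le_measure; rewrite ?inE //; first exact: measurableI.
by apply: subset_trans F_sub; exact: subIsetl.
Qed.

(** Distribution function of the Lebesgue measure of [F]; its inverse, with values in [F], is the
    parametrisation sought. *)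
Definition filled (x : R) : R := fine (lambda (F `&` `]-oo, x])).

Lemma filledE x : lambda (F `&` `]-oo, x]) = (filled x)%:E.
Proof. by rewrite /filled fineK // finF. Qed.

Lemma filled_sub x z : x <= z -> lambda (F `&` `]x, z]) = (filled z - filled x)%:E.
Proof.
move=> xz; have : (filled z)%:E = ((filled x)%:E + lambda (F `&` `]x, z]))%E.
  rewrite -!filledE -measureU //; last 3 first.
  - exact: measurableI.
  - exact: measurableI.
  - apply/seteqP; split => // v [[_ /=]]; rewrite in_itv /= => vx [_ /=].
    by rewrite in_itv /=; lra.
  congr (lambda _); rewrite -setIUr; congr (_ `&` _).
  apply/seteqP; split => v /=; rewrite !in_itv /=.
    by move=> vz; have [vx|xv] := leP v x; [left | right].
  by move=> [vx|/andP[_ //]]; exact: le_trans xz.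
have fin : lambda (F `&` `]x, z]) \is a fin_num by apply: finF.
by rewrite -(fineK fin) -EFinD => -[->]; congr EFin; ring.
Qed.

Lemma filled_lip x z : x <= z -> 0 <= filled z - filled x <= z - x.
Proof.
move=> xz; rewrite -!lee_fin -filled_sub // measure_ge0 /=.
apply: (@le_trans _ _ (lambda `]x, z]%classic)).
  by apply: le_measure; rewrite ?inE //; exact: measurableI.
rewrite lebesgue_measure_itv /= lte_fin; case: ifP => // _.
by rewrite lee_fin subr_ge0.
Qed.

Lemma filled_mono x z : x <= z -> filled x <= filled z.
Proof. by move=> /filled_lip; lra. Qed.

Lemma filled_inside x : F x -> exists2 e, 0 < e &
  forall h, 0 <= h < e -> filled x - filled (x - h) = h.
Proof.
move=> Fx; have [e e0 He] := steplike_left x sF; exists e => // h he.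
apply: EFin_inj; rewrite -filled_sub; last by lra.
rewrite (_ : F `&` _ = `]x - h, x]%classic).
  rewrite lebesgue_measure_itv /= lte_fin; case: ifP => [_|/negbT].
    by rewrite -EFinD; congr EFin; ring.
  by rewrite -leNgt => hh; congr EFin; lra.
apply/seteqP; split => v /=; first by case.
rewrite in_itv /= => vx; split => //; apply/He => //; lra.
Qed.

Lemma filled_outside x : ~ F x -> exists2 e, 0 < e &
  forall h, 0 <= h < e -> filled (x - h) = filled x.
Proof.
move=> Fx; have [e e0 He] := steplike_left x sF; exists e => // h he.
apply/eqP; rewrite eq_sym -subr_eq0; apply/eqP.
apply: EFin_inj; rewrite -filled_sub; last by lra.
rewrite (_ : F `&` _ = set0) ?measure0 //.
apply/seteqP; split => // v /= [Fv]; rewrite in_itv /= => vx.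
by apply: Fx; apply/(He v) => //; lra.
Qed.

Lemma filled_lt x z : F z -> x < z -> filled x < filled z.
Proof.
move=> Fz xz; have [e e0 He] := filled_inside Fz.
pose h := Num.min (e / 2) (z - x).
have h1 : h <= e / 2 by rewrite ge_min lexx.
have h2 : h <= z - x by rewrite ge_min lexx orbT.
have h0 : 0 < h by rewrite lt_min; lra.
have := He h ltac:(lra); have := filled_mono (_ : x <= z - h) => /(_ ltac:(lra)).
lra.
Qed.

Lemma filled_inj x z : F x -> F z -> filled x = filled z -> x = z.
Proof.
move=> Fx Fz e; case: (ltgtP x z) => // h.
  by have := filled_lt Fz h; rewrite e ltxx.
by have := filled_lt Fx h; rewrite e ltxx.
Qed.

Lemma filled0 : filled 0 = 0.
Proof.
rewrite /filled (_ : F `&` _ = set0) ?measure0 //.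
apply/seteqP; split => // v /= [/F_sub /=]; rewrite !in_itv /=; lra.
Qed.

Let total_fill := fine (lambda F).

Lemma filledK : filled K = total_fill.
Proof.
rewrite /filled /total_fill (_ : F `&` _ = F) //.
apply/seteqP; split => [v []//|v Fv]; split => //.
by have := F_sub Fv; rewrite /= !in_itv /= => /andP[].
Qed.

Lemma filled_gt0 x : F x -> 0 < filled x <= total_fill.
Proof.
move=> Fx; have := F_sub Fx; rewrite /= in_itv /= => /andP[x0 xK].
by rewrite -{1}filled0 (filled_lt Fx x0) -filledK filled_mono.
Qed.

(** The candidate is the supremum of the points where [filled] is below [t]. Outside [F] it would
    have a left neighbourhood on which [filled] is constant, hence already equal to [t]. *)
Lemma fill_exists t : 0 < t <= total_fill -> exists2 x, F x & filled x = t.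
Proof.
move=> tN; pose X := [set x | 0 <= x <= K /\ filled x < t].
have X0 : X 0 by rewrite /X /= lexx K_ge0 filled0; split => //; lra.
have hX : has_sup X by split; [exists 0 | exists K => x [/andP[]]].
have s0 : 0 <= sup X by exact: sup_upper_bound.
have sK : sup X <= K by apply: ge_sup => [|x [/andP[]]//]; exists 0.
have below x : x < sup X -> filled x < t.
  move=> xs; have e0 : 0 < sup X - x by rewrite subr_gt0.
  have [z [_ zt]] := sup_adherent e0 hX.
  rewrite opprB addrCA subrr addr0 => /ltW /filled_mono; lra.
have st : filled (sup X) = t.
  apply/eqP; rewrite eq_le; apply/andP; split.
    rewrite leNgt; apply/negP => lt.
    have := filled_lip (_ : sup X - (filled (sup X) - t) <= sup X) => /(_ ltac:(lra)).
    have := below (sup X - (filled (sup X) - t)) ltac:(lra); lra.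
  rewrite leNgt; apply/negP => lt.
  have neK : sup X != K by apply: contraTneq lt => ->; rewrite filledK -leNgt; lra.
  have ltK : sup X < K by rewrite lt_neqAle neK.
  pose h := Num.min ((t - filled (sup X)) / 2) (K - sup X).
  have h1 : h <= (t - filled (sup X)) / 2 by rewrite ge_min lexx.
  have h2 : h <= K - sup X by rewrite ge_min lexx orbT.
  have h0 : 0 < h by rewrite lt_min; lra.
  have Xh : X (sup X + h).
    split; first by lra.
    by have := filled_lip (_ : sup X <= sup X + h) => /(_ ltac:(lra)); lra.
  by have := sup_upper_bound hX Xh; lra.
exists (sup X) => //; have [//|nF] := pselect (F (sup X)).
have [e e0 He] := filled_outside nF.
have := below (sup X - e / 2) ltac:(lra); rewrite He ?st ?ltxx //; lra.
Qed.

Lemma filled_continuous : continuous (filled : R -> R).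
Proof.
move=> x; apply/cvgrPdist_lt => e e0; near=> z.
have : `|x - z| < e by near: z; exact: cvgr_dist_lt.
apply: le_lt_trans; have [xz|zx] := leP x z.
  have := filled_lip xz => /andP[h1 h2].
  by rewrite distrC ger0_norm // distrC ger0_norm ?subr_ge0.
have := filled_lip (ltW zx) => /andP[h1 h2].
by rewrite ger0_norm // ger0_norm ?subr_ge0 // ltW.
Unshelve. all: by end_near.
Qed.

Let mfilled : measurable_fun setT (filled : measurableTypeR R -> measurableTypeR R).
Proof. exact: continuous_measurable_fun filled_continuous. Qed.

Let N0 : 0 <= total_fill.
Proof. by rewrite -filledK -filled0; exact: filled_mono. Qed.

(* [filled] carries the Lebesgue measure of [F] to that of [`]0, total_fill]]. *)
Lemma filled_preimage_measure (B : set (measurableTypeR R)) : measurable B ->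
  B `<=` `]0, total_fill]%classic -> lambda (F `&` filled @^-1` B) = lambda B.
Proof.
(* Lebesgue measure is characterised on the whole line by its values on intervals; so the measure
   transported from [F] is completed by Lebesgue measure outside []0, total_fill]]. *)
pose D : set (measurableTypeR R) := ~` `]0, total_fill]%classic.
have mD : measurable D by apply: measurableC.
pose mu := measure_add (measure_function_pushforward__canonical__measure_function_Measure
  (mrestr lebesgue_measure mF) mfilled) (mrestr lebesgue_measure mD).
have muE X : mu X = (lambda (F `&` filled @^-1` X) + lambda (X `&` D))%E.
  by rewrite /mu measure_addE; congr (_ + _)%E; rewrite setIC.
have mu_itv p q : mu `]p, q]%classic = lambda `]p, q]%classic.
  apply/esym; rewrite muE.
  have [qp|pq] := leP q p.
    rewrite set_itv_ge -?leNgt ?bnd_simp //.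
    by rewrite preimage_set0 setI0 set0I measure0 adde0.
  (* End points outside the range of [filled] are clamped to it, so that each gets a preimage [x r];
     intervals then pull back to intervals within [F]. *)
  pose cl r := Num.max 0 (Num.min r total_fill).
  have clP r : [\/ r <= 0 /\ cl r = 0, 0 <= r <= total_fill /\ cl r = r |
      total_fill <= r /\ cl r = total_fill].
    have N0' := N0; rewrite /cl; have [rN|Nr] := leP r total_fill.
      have [r0|r0] := leP 0 r; first by constructor 2.
      by constructor 1; rewrite ltW.
    by constructor 3; rewrite ltW // max_r.
  have clN r : 0 <= cl r <= total_fill.
    by rewrite /cl le_max lexx ge_max N0 ge_min lexx orbT.
  have exl r : exists z, filled z = cl r.
    have := clN r; rewrite le_eqVlt => /andP[/predU1P[<- _|c0 cN]].
      by exists 0; rewrite filled0.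
    have h : 0 < cl r <= total_fill by rewrite c0.
    by have [z _ <-] := fill_exists h; exists z.
  have [x xP] := choice exl.
  have N0' := N0.
  have clt r z : F z -> (r < filled z) = (x r < z).
    move=> Fz; have := filled_gt0 Fz => fz; apply/idP/idP => h; last first.
      by have := filled_lt Fz h; rewrite xP; case: (clP r) => -[? ->]; lra.
    rewrite ltNge; apply/negP => /filled_mono; rewrite xP.
    by case: (clP r) => -[? ->]; lra.
  have -> : F `&` filled @^-1` `]p, q] = F `&` `]x p, x q]%classic.
    apply/seteqP; split => z [Fz /=]; rewrite in_itv /= => h; split => //=;
      by move: h; rewrite in_itv /= !leNgt !clt.
  have -> : lambda (F `&` `]x p, x q]) = (cl q - cl p)%:E.
    have [le|lt] := leP (x p) (x q); first by rewrite filled_sub // !xP.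
    rewrite (_ : `]x p, x q]%classic = set0) ?setI0 ?measure0; last first.
      by apply/seteqP; split => // z /=; rewrite in_itv /=; lra.
    have := filled_mono (ltW lt); rewrite !xP => h; congr EFin.
    have : cl p <= cl q.
      by case: (clP p) => -[? ->]; case: (clP q) => -[? ->]; lra.
    lra.
  have -> : lambda (`]p, q]%classic `&` D) = ((q - p) - (cl q - cl p))%:E.
    rewrite -setDE measureD //=; last by rewrite lebesgue_measure_itv /= lte_fin pq -EFinD ltry.
    have -> : `]p, q]%classic `&` `]0, total_fill]%classic =
        `]Num.max p 0, Num.min q total_fill]%classic :> set R.
      apply/seteqP; split => z /=; rewrite !in_itv /= gt_max le_min.
        by move=> [/andP[-> ->] /andP[-> ->]].
      by move=> /andP[/andP[-> ->] /andP[-> ->]].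
    rewrite !lebesgue_measure_itv /= !lte_fin pq -!EFinD.
    have -> : (if Num.max p 0 < Num.min q total_fill
        then (Num.min q total_fill - Num.max p 0)%:E else 0%E) = (cl q - cl p)%:E.
      case: (leP p 0) => ?; case: (leP q total_fill) => ?; case: ifPn; rewrite -?leNgt => ?;
        congr EFin; case: (clP p) => -[? ->]; case: (clP q) => -[? ->]; lra.
    by rewrite -EFinD.
  rewrite lebesgue_measure_itv /= lte_fin pq -!EFinD; congr EFin; ring.
move=> mB BD; have : lambda B = mu B.
  apply: lebesgue_measure_unique mB => X [[p q] _ <-]; rewrite -[RHS]/(mu _).
  exact/esym/mu_itv.
by rewrite muE (_ : B `&` D = set0) ?measure0 ?adde0 //; apply/seteqP; split => // x [/BD].
Qed.

(** [g] inverts [filled] on [F]. The last clause concerns initial segments because later rounds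
    shorten the bar from its top: what remains occupied is still steplike. *)
Lemma filling (d : R) : 0 <= d -> (d%:E <= lambda F)%E -> exists g : R -> R,
  [/\ forall t, 0 < t <= d -> F (g t),
      forall t t', 0 < t <= d -> 0 < t' <= d -> g t = g t' -> t = t',
      forall B : set (measurableTypeR R), measurable B -> B `<=` `]0, d]%classic ->
        measurable (g @` B : set (measurableTypeR R)) /\ lambda (g @` B) = lambda B &
      forall s, s <= d -> steplike (g @` `]0, s]%classic)].
Proof.
move=> d0 dF.
have dN : d <= total_fill.
  have fin : lambda F \is a fin_num by rewrite -[F]setIT; apply: finF.
  by rewrite -lee_fin /total_fill fineK.
have ex t : exists x, 0 < t <= d -> F x /\ filled x = t.
  have [td|nt] := boolP (0 < t <= d); last by exists 0.
  have h : 0 < t <= total_fill by lra.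
  by have [x Fx fx] := fill_exists h; exists x.
have [g gP] := choice ex.
have img (B : set R) : B `<=` `]0, d]%classic -> g @` B = F `&` filled @^-1` B.
  move=> Bd; have bd t : B t -> 0 < t <= d by move=> /Bd /=; rewrite in_itv.
  apply/seteqP; split => [x [t Bt <-]|x [Fx Bx]].
    by have [h1 h2] := gP t (bd t Bt); split => //=; rewrite h2.
  exists (filled x) => //; have [h1 h2] := gP _ (bd _ Bx).
  exact: filled_inj.
exists g; split.
- by move=> t td; have [] := gP t td.
- move=> t t' td td' e; have [_ <-] := gP t td; have [_ <-] := gP t' td'.
  by rewrite e.
- move=> B mB Bd; rewrite img //; split.
    apply: measurableI => //; rewrite -[X in measurable X]setTI; exact: mfilled.
  apply: filled_preimage_measure => //; apply: subset_trans Bd _.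
  by move=> x /=; rewrite !in_itv /=; lra.
- move=> s sd; have [s0|s0] := leP s 0.
    rewrite set_itv_ge ?image_set0; first exact: steplike_set0.
    by rewrite bnd_simp -leNgt.
  rewrite img; last by move=> x /=; rewrite !in_itv /=; lra.
  have [Fs fs] := gP s ltac:(lra).
  rewrite (_ : F `&` _ = F `&` [set x | x <= g s]); first exact: steplikeI (steplike_le _).
  apply/seteqP; split => x [Fx /=]; rewrite in_itv /= => h; split => //=.
    rewrite leNgt; apply/negP => /(filled_lt Fx); rewrite fs; lra.
  by have := filled_gt0 Fx; have := filled_mono h; rewrite fs; lra.
Qed.

End Filling.

(** * Assignment of positions and existence of a step *)

Section StepExistence.
Context {R : realType} {E : finType} {L : nat}.
Variables (alpha : R) (k : 'I_L -> nat) (part : E -> 'I_L) (f : {set E} -> R).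
Hypotheses (alpha_gt1 : 1 < alpha) (alphaE : alpha = expR (alpha - 2)).
Hypothesis k_gt0 : forall l, (0 < k l)%N.
Hypotheses (f_mono : monotone_setfun f) (f_sub : submodular_setfun f).

Definition position (st : state R E L) (v : E) (t : R) : R := (phi st (v, t)).2.

(* The invariant that makes the free part of each interval a finite union of
   intervals, hence fillable by a map that preserves lengths. *)
Record well_placed (p : E -> 'I_L) (st : state R E L) : Prop := WellPlaced {
  placed_range : forall z, region (ever st) z ->
    (phi st z).1 = p z.1 /\ 0 < (phi st z).2 <= (k (p z.1))%:R;
  placed_steplike : forall v r, r <= ever st v -> steplike (position st v @` `]0, r]%classic) }.

Variables (s : seq E) (u : E) (st : state R E L).
Hypotheses (snd : sound alpha k part f s st) (us : u \notin s).
Hypotheses (wa : well_assigned k part st) (wp : well_placed part st).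

Let l := part u.
Let K : R := (k l)%:R.
Local Notation lambda := (@lebesgue_measure R).

(** Positions are assigned once the round is over: those of the surviving pairs are occupied, the
    rest of the interval is free, and by the capacity its length is at least the mass [d] of [u]. *)
Lemma step_exists : exists st', forall (part' : E -> 'I_L) (f' : {set E} -> R),
  {in rcons s u, part =1 part'} ->
  (forall X : {set E}, {subset X <= rcons s u} -> f X = f' X) ->
  well_placed part' st' /\ step alpha k part' f' st u st'.
Proof.
have [c' [e' [w' rnd]]] := cont_round_exists alpha_gt1 alphaE k_gt0 snd us.
have rnd0 := rnd (assign st) part f (fun _ _ => erefl) (fun _ _ => erefl).
have [snd' cle cu] := sound_step alpha_gt1 alphaE k_gt0 f_mono f_sub snd us rnd0.
rewrite /= in cle cu.
have [d [d0 e'E]] : exists d, 0 <= d /\ incr (ever st) u d = e'.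
  by have [_ [_ [d [S [d0 [_ [_ [? _]]]]]]]] := rnd0; exists d.
have cur_a v := sound_cur snd v.
have c'a v : 0 <= c' v <= e' v := sound_cur snd' v.
have ever_u : ever st u = 0 := sound_out snd us.
have e'v v : v != u -> e' v = ever st v by move=> vu; rewrite -e'E incr_neq.
have e'u : e' u = d by rewrite -e'E /incr eqxx ever_u add0r.
have c'u : c' u = d by rewrite cu e'u.
have K0 : 0 <= K by rewrite ler0n.
(* The profile after the round without [u]; it lies below the one before the round, so its points
   are already assigned. *)
pose c0 v := if v == u then 0 else c' v.
have c00 v : 0 <= c0 v by rewrite /c0; case: ifP => // _; have := c'a v; lra.
have c0cur v : c0 v <= cur st v.
  by rewrite /c0; case: eqP => [_|/eqP /cle//]; have := cur_a v; lra.
pose B0 := restr part l (region c0).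
have B0cur : B0 `<=` region (cur st).
  by move=> [v t] [+ _]; rewrite /region /= => h; have := c0cur v; lra.
pose O := \bigcup_v (position st v @` (if v \in class part l then `]0, c0 v]%classic else set0)).
have Osec : xsection (phi st @` B0) l = O.
  apply/seteqP; split => x; rewrite /xsection /= inE /=.
    move=> [[v t] [vt pv] e]; exists v => //; exists t; last by rewrite /position e.
    by move: vt; rewrite inE pv eqxx /region /= in_itv.
  move=> [v _ [t]]; case: ifP => //; rewrite inE => /eqP vl; rewrite /= in_itv /= => vt <-.
  have bt : B0 (v, t) by [].
  exists (v, t) => //; rewrite /position; have [h _] := assigned_range wa (B0cur _ bt).
  by move: h; case: (phi st (v, t)) => a b /= ->; rewrite vl.
have B0m : smeasurable B0 by move=> v; rewrite xsection_restr; case: ifP.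
have [Om Oeq] := assigned_mass wa B0cur B0m.
have mO : measurable (O : set (measurableTypeR R)) by rewrite -Osec; exact: Om.
have Ole : (lambda O <= (total (class part l) c0)%:E)%E.
  rewrite -(mass_restr part l c00) -/B0 -Oeq /mass (bigD1 l) //= Osec leeDl //.
  by apply: sume_ge0 => i _; exact: measure_ge0.
have Ostep : steplike O.
  apply: steplike_bigcup => v; case: ifP => _; last first.
    by rewrite image_set0; exact: steplike_set0.
  by apply: (placed_steplike wp); have := c0cur v; have := cur_a v; lra.
pose F := `]0, K]%classic `&` ~` O.
have Fstep : steplike F.
  apply: steplikeI (steplikeC Ostep).
  rewrite (_ : `]0, K]%classic = [set x | x <= K] `&` ~` [set x | x <= 0]).
    by apply: steplikeI (steplike_le _) (steplikeC (steplike_le _)).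
  apply/seteqP; split => x /=; rewrite in_itv /=.
    by move=> /andP[x0 xK]; split => //; apply/negP; rewrite -ltNge.
  by move=> [xK /negP]; rewrite -ltNge => ->.
have Fsub : F `<=` `]0, K]%classic by apply: subIsetl.
have mF : measurable (F : set (measurableTypeR R)) by apply: measurableI => //; apply: measurableC.
have dF : (d%:E <= lambda F)%E.
  have cap : total (class part l) c0 + d <= K.
    apply: le_trans (class_cap (sound_class snd' l)) => /=.
    rewrite le_eqVlt; apply/orP; left; apply/eqP.
    have uC : u \in class part l by rewrite inE.
    rewrite /total (bigD1 u uC) [RHS](bigD1 u uC) /= c'u {1}/c0 eqxx add0r addrC.
    by congr (_ + _); apply: eq_bigr => v /andP[_ /negbTE vu]; rewrite /c0 vu.
  have : (K%:E <= lambda F + (total (class part l) c0)%:E)%E.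
    apply: (@le_trans _ _ (lambda (F `|` (`]0, K]%classic `&` O)))).
      by rewrite /F -setIUr [~` O `|` O]setUC setUv setIT lebesgue_measure_oc.
    rewrite measureU //=; [|exact: measurableI|].
      rewrite leeD2l //; apply: le_trans Ole; apply: le_measure; rewrite ?inE //.
      exact: measurableI.
    by apply/seteqP; split => // x [[_ nO] [_ /nO]].
  have fin : lambda F \is a fin_num.
    rewrite ge0_fin_numE ?measure_ge0 //; apply: (@le_lt_trans _ _ (lambda `]0, K]%classic)).
      by apply: le_measure; rewrite ?inE.
    by rewrite lebesgue_measure_oc // ltry.
  by rewrite -(fineK fin) -EFinD !lee_fin; lra.
have [g [gF ginj gmeas gstep]] := filling Fstep Fsub K0 d0 dF.
pose asg v t := if v == u then (l, g t) else assign st v t.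
pose st' := State c' e' w' asg.
have phiu t : phi st' (u, t) = (l, g t) by rewrite /phi /= /asg eqxx.
have phiv v t : v != u -> phi st' (v, t) = phi st (v, t).
  by move=> /negbTE vu; rewrite /phi /= /asg vu.
have gK t : 0 < t <= d -> 0 < g t <= K by move=> /gF /Fsub /=; rewrite in_itv.
have in_s v t : v != u -> 0 < t <= e' v -> v \in s /\ region (ever st) (v, t).
  move=> vu; rewrite e'v // => vt; split => //.
  have [//|/(sound_out snd) h] := boolP (v \in s); exfalso; lra.
have rangeP (part' : E -> 'I_L) : {in rcons s u, part =1 part'} -> forall z, region e' z ->
    (phi st' z).1 = part' z.1 /\ 0 < (phi st' z).2 <= (k (part' z.1))%:R.
  move=> pp [v t] r; have vt : 0 < t <= e' v := r.
  have -> : (v, t).1 = v by [].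
  have [vu|vu] := eqVneq v u.
    rewrite vu phiu /= -pp ?mem_rcons ?mem_head //; split => //.
    by apply: gK; rewrite -e'u -vu.
  have [vs r'] := in_s v t vu vt.
  rewrite phiv // -pp ?mem_rcons ?in_cons ?vs ?orbT //.
  exact: (placed_range wp r').
have old v t : v != u -> region c' (v, t) -> region (cur st) (v, t).
  by move=> vu; rewrite /region /= => h; have := cle v vu; lra.
(* [g] takes its values off [O], so old and new pairs never share a point. *)
have notO v t x : v != u -> region c' (v, t) -> phi st (v, t) = (l, x) -> O x.
  move=> vu r e; have [h _] := assigned_range wa (old _ _ vu r).
  exists v => //; exists t; last by rewrite /position e.
  rewrite inE -h e eqxx /= in_itv /= /c0 (negbTE vu); exact: r.
have region_u t : region c' (u, t) -> 0 < t <= d by rewrite /region /= c'u.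
exists st' => part' f' pp ff; split.
  split; first exact: rangeP.
  move=> v r /=; have [->|vu] := eqVneq v u.
    rewrite e'u => rd.
    rewrite (_ : position st' u = g); first exact: gstep.
    by apply/funext => t; rewrite /position phiu.
  rewrite e'v // => re; rewrite (_ : position st' v = position st v).
    exact: (placed_steplike wp).
  by apply/funext => t; rewrite /position phiv.
split; first exact: rnd.
split.
- move=> [v t]; rewrite /region /= => vt; apply: phiv.
  by apply: contraTneq vt => ->; rewrite ever_u; lra.
- exact: rangeP.
- move=> [v t] [v' t']; rewrite !inE => r r'.
  have [vu|vu] := eqVneq v u; have [v'u|v'u] := eqVneq v' u.
  + subst v v'; rewrite !phiu => -[/ginj ->] //; exact: region_u.
  + subst v; rewrite phiu phiv // => e; have := notO _ _ _ v'u r' (esym e).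
    by have [_] := gF t (region_u _ r).
  + subst v'; rewrite phiu phiv // => e; have := notO _ _ _ vu r e.
    by have [_] := gF t' (region_u _ r').
  + rewrite !phiv // => e; apply: (assigned_inj wa) => //; rewrite inE; exact: old.
- move=> B Bc mB.
  (* Old pairs and pairs of [u] are treated apart: each part keeps its measure, and their images in
     the class are disjoint. *)
  pose B1 := B `&` [set z | z.1 != u].
  have B1cur : B1 `<=` region (cur st) by move=> [v t] [/Bc r /= vu]; exact: old.
  have B1sec v : xsection B1 v = if v == u then set0 else xsection B v.
    apply/seteqP; split => t; rewrite /xsection /= inE.
      by move=> [h /= /negbTE ->]; rewrite /= inE.
    by case: eqP => // /eqP vu; rewrite /= inE.
  have mB1 : smeasurable B1 by move=> v; rewrite B1sec; case: ifP.
  have [mI1 eI1] := assigned_mass wa B1cur mB1.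
  have B2d : xsection B u `<=` `]0, d]%classic.
    by move=> t; rewrite /xsection /= inE in_itv /= => /Bc /region_u.
  have [mI2 eI2] := gmeas _ (mB u) B2d.
  have sec i : xsection (phi st' @` B) i =
      xsection (phi st @` B1) i `|` (if i == l then g @` xsection B u else set0).
    apply/seteqP; split => x; rewrite /xsection /= !inE /=.
      move=> [[v t] Bvt evt]; have e : phi st' (v, t) = (i, x) := evt.
      have [vu|vu] := eqVneq v u.
        subst v; right; move: e; rewrite phiu => -[<- <-]; rewrite eqxx.
        by exists t => //; rewrite /xsection /= inE.
      left; exists (v, t) => //; exact: etrans (esym (phiv _ _ vu)) e.
    move=> [[[v t] [Bvt /= vu] e]|].
      by exists (v, t) => //; exact: etrans (phiv _ _ vu) e.
    case: eqP => // -> [t]; rewrite /xsection /= inE => Bt <-.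
    by exists (u, t) => //; exact: phiu.
  have disj : xsection (phi st @` B1) l `&` (g @` xsection B u) = set0.
    apply/seteqP; split => // x [+ [t Bt gx]]; rewrite /xsection /= inE /=.
    move=> [[v t'] [Bvt /= vu] e]; have := notO _ _ _ vu (Bc _ Bvt) e.
    by have [_] := gF t (B2d _ Bt); rewrite gx.
  split.
    move=> i; rewrite sec; apply: measurableU; first exact: mI1.
    by case: ifP.
  have mI1l := mI1 l.
  rewrite /mass (bigD1 l) //= sec eqxx measureU //=.
  rewrite (eq_bigr (fun i => lambda (xsection (phi st @` B1) i))); last first.
    by move=> i /negbTE il; rewrite sec il setU0.
  have -> : (lambda (xsection (phi st @` B1) l) + lambda (g @` xsection B u) +
      \sum_(i | i != l) lambda (xsection (phi st @` B1) i) =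
      mass (phi st @` B1) + lambda (xsection B u))%E.
    by rewrite eI2 /mass [in RHS](bigD1 l) //= addeAC.
  rewrite eI1 /mass (bigD1 u) //= B1sec eqxx measure0 add0e [in RHS](bigD1 u) //= addeC.
  by congr (_ + _)%E; apply: eq_bigr => v /negbTE vu; rewrite B1sec vu.
Qed.

End StepExistence.

(** * The deterministic online rule *)

Section Algorithm.
Context {R : realType} {E : finType} {L : nat}.
Variables (alpha : R) (k : 'I_L -> nat).
Hypotheses (alpha_gt1 : 1 < alpha) (alphaE : alpha = expR (alpha - 2)).
Hypothesis k_gt0 : forall l, (0 < k l)%N.
Implicit Types (part : E -> 'I_L) (f : {set E} -> R) (st : state R E L).

Definition first_class (l : 'I_L) : 'I_L := Ordinal (leq_ltn_trans (leq0n l) (ltn_ord l)).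

(* The argument only witnesses that there is a class. *)
Definition empty_state part : state R E L :=
  State (fun=> 0) (fun=> 0) (fun _ _ => 0) (fun v _ => (first_class (part v), 0)).

Lemma empty_state_congr part part' : empty_state part = empty_state part'.
Proof.
by congr State; apply/funext => v; apply/funext => t; congr (_, _); apply: val_inj.
Qed.

(** Classical choice: extensionally equal predicates select the same state, which is how [run_congr]
    compares indistinguishable instances. *)
Definition choose_state st0 (P : state R E L -> Prop) : state R E L :=
  if pselect (exists st, P st) is left ex then projT1 (cid ex) else st0.

Lemma choose_stateP st0 (P : state R E L -> Prop) :
  (exists st, P st) -> P (choose_state st0 P).
Proof.
by move=> ex; rewrite /choose_state; case: pselect => // ex'; case: (cid ex').
Qed.

Definition same_knowledge (s : seq E) part f part' f' : Prop :=
  {in s, part =1 part'} /\ forall X : {set E}, {subset X <= s} -> f X = f' X.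

(* [good_next] quantifies over all the instances that the arrived elements
   cannot distinguish, so that its extension depends on those elements only. *)
Definition good_next part f (s : seq E) u st st' : Prop :=
  forall part' f', same_knowledge (u :: s) part f part' f' ->
    well_placed k part' st' /\ step alpha k part' f' st u st'.

(** The latest arrival is the head of the list. *)
Fixpoint run part f (r : seq E) : state R E L :=
  if r is u :: r' then
    choose_state (empty_state part) (good_next part f r' u (run part f r'))
  else empty_state part.

Lemma run_congr part part' f f' r : same_knowledge r part f part' f' ->
  run part f r = run part' f' r.
Proof.
elim: r => [|u r IH] ag /=; first exact: empty_state_congr.
have [ag1 ag2] := ag.
rewrite IH; last first.
  split=> [v vr|X Xr]; first by apply: ag1; rewrite in_cons vr orbT.
  by apply: ag2 => v /Xr vr; rewrite in_cons vr orbT.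
rewrite (empty_state_congr part part'); congr choose_state.
apply/funext => st; apply/propext; split=> H p g [pg1 pg2]; apply: H; split.
- by move=> v vr; rewrite ag1 // pg1.
- by move=> X Xr; rewrite ag2 // pg2.
- by move=> v vr; rewrite -ag1 // pg1.
- by move=> X Xr; rewrite -ag2 // pg2.
Qed.

Lemma step_exists_run part f (s : seq E) u st :
  monotone_setfun f -> submodular_setfun f ->
  sound alpha k part f s st -> u \notin s -> well_assigned k part st -> well_placed k part st ->
  exists st', good_next part f (rev s) u st st'.
Proof.
move=> fm fs snd us wa wp.
have [st' H] := step_exists alpha_gt1 alphaE k_gt0 fm fs snd us wa wp.
have mem v : (v \in u :: rev s) = (v \in rcons s u) by rewrite mem_rcons !in_cons mem_rev.
exists st' => p g [pg1 pg2]; apply: H => [v vs|X Xs]; first by apply: pg1; rewrite mem.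
by apply: pg2 => v /Xs; rewrite mem.
Qed.

Lemma run_invariant part f (s : seq E) :
  nonneg_setfun f -> monotone_setfun f -> submodular_setfun f -> uniq s ->
  [/\ sound alpha k part f s (run part f (rev s)), well_assigned k part (run part f (rev s)) &
      well_placed k part (run part f (rev s))].
Proof.
move=> f0 fm fs; elim/last_ind: s => [_|s u IH].
  have init : initial (empty_state part) by [].
  split; [exact: sound_nil | exact: well_assigned_nil |].
  split=> [[v t]|v r]; rewrite /region /=; first lra.
  move=> r0; rewrite set_itv_ge ?image_set0; first exact: steplike_set0.
  by rewrite bnd_simp -leNgt.
rewrite rcons_uniq => /andP[us uqs]; have [snd wa wp] := IH uqs.
have := choose_stateP (empty_state part) (step_exists_run fm fs snd us wa wp).
rewrite rev_rcons /= => /(_ part f (conj (fun _ _ => erefl) (fun _ _ => erefl))) [wp' stp].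
have [snd' _ _] := sound_step alpha_gt1 alphaE k_gt0 fm fs snd us stp.1.
by split => //; exact: (well_assigned_step alpha_gt1 alphaE k_gt0 fm fs snd us stp).
Qed.

Lemma run_step part f (s : seq E) u :
  nonneg_setfun f -> monotone_setfun f -> submodular_setfun f -> uniq (rcons s u) ->
  step alpha k part f (run part f (rev s)) u (run part f (rev (rcons s u))).
Proof.
move=> f0 fm fs; rewrite rcons_uniq => /andP[us uqs].
have [snd wa wp] := run_invariant part f0 fm fs uqs.
have := choose_stateP (empty_state part) (step_exists_run fm fs snd us wa wp).
by rewrite rev_rcons /= => /(_ part f (conj (fun _ _ => erefl) (fun _ _ => erefl))) [].
Qed.

End Algorithm.

Theorem theorem4p1 (R : realType) (alpha : R)
    (alpha_gt1 : 1 < alpha) (alpha_root : alpha = expR (alpha - 2))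
    (E : finType) (L : nat) (k : 'I_L -> nat) (k_gt0 : forall l, (0 < k l)%N) :
  (exists alg : (E -> 'I_L) -> ({set E} -> R) -> seq E -> state R E L,
     online_rule alg /\
     forall (part : E -> 'I_L) (f : {set E} -> R),
       nonneg_setfun f -> monotone_setfun f -> submodular_setfun f ->
       initial (alg part f [::]) /\
       forall (s : seq E) (u : E), uniq (rcons s u) ->
         step alpha k part f (alg part f s) u (alg part f (rcons s u))) /\
  forall (part : E -> 'I_L) (f : {set E} -> R),
    nonneg_setfun f -> monotone_setfun f -> submodular_setfun f ->
    forall (s : seq E) (st : state R E L), uniq s ->
      execution alpha k part f s st ->
      [/\ forall z : {l : 'I_L & 'I_(k l)} -> R, indep part k (held st z),
          forall (u : E) (st' : state R E L) (z : {l : 'I_L & 'I_(k l)} -> R),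
            u \notin s -> step alpha k part f st u st' ->
            held st' z \subset (u |: held st z)%SET &
          forall (O : {set E}) (d : measure_display) (T : measurableType d)
              (P : probability T R)
              (Z : {l : 'I_L & 'I_(k l)} -> {RV P >-> R}),
            is_opt part k f s O -> uniform_samples Z ->
            ((alpha^-1 * f O)%:E <=
               'E_P[fun x => f (held st (fun i => Z i x))])%E].
Proof.
split.
  exists (fun part f s => run alpha k part f (rev s)); split.
    move=> part part' f f' s pp ff; apply: run_congr; split=> [v|X Xs].
      by rewrite mem_rev; exact: pp.
    by apply: ff => v /Xs; rewrite mem_rev.
  move=> part f f0 fm fs; split=> [|s u us]; first by [].
  exact: run_step.
move=> part f f0 fm fs s st us ex.
have [snd wa] := execution_invariant alpha_gt1 alpha_root k_gt0 fm fs us ex.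
split=> [z|u st' z nus stp|O d T P Z opt ZP].
- exact: held_indep.
- exact: (held_step alpha_gt1 alpha_root k_gt0 fm fs z snd nus stp).
- exact: held_competitive snd wa opt ZP.
Qed.
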